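(* Let $d\ge2$, let $(f_n)_n$ be a sequence of rational maps of degree $d$, and let $M_1,\dots,M_p$ ($p\ge1$) be equivalence classes of rescalings of $(f_n)_n$. Then, after passing to a subsequence, there exist finite sets $X\subseteq Y\cap Z$, a portrait $\mathbf{F}$ of degree $d$ from $Y$ to $Z$, marked spheres $y_n,z_n$ such that $(f_n,y_n,z_n)$ is a rational map dynamically marked by $(\mathbf{F},X)$ for every $n$, and a dynamical system of (projective, holomorphic, stable) trees of spheres $(\mathcal{F},\mathcal{T}^X)$, $\mathcal{F}:\mathcal{T}^Y\to\mathcal{T}^Z$, such that (1) $(f_n,y_n,z_n)_n$ converges dynamically to $(\mathcal{F},\mathcal{T}^X)$ via some $(\phi^Y_n,\phi^Z_n)$, and (2) for every $i\in\{1,\dots,p\}$ there is a vertex $v_i$ of $T^Y$ such that $(\phi^Y_{n,v_i})_n$ belongs to the class $M_i$.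
   Context: Trees. A tree is a finite connected graph without cycles (vertex set $V$, edges $2$-element subsets of $V$, $E_v$ the edges at $v$); leaves are vertices of valence $1$, the others internal vertices $IV$; stable means every internal vertex has valence $\ge3$. For a vertex $v$ and $e\in E_v$, $B_v(e)$ is the component of $T\setminus\{v\}$ containing $e$. A tree marked by a finite set $X$ ($\mathrm{card}\,X\ge3$) has leaf set $X$. Projective trees of spheres. A tree of spheres $\mathcal{T}^X$ consists of a stable tree $T^X$ marked by $X$ and, for each internal vertex $v$, a sphere $\mathbb{S}_v$ with a projective structure (a class of homeomorphisms $\mathbb{S}_v\to\hat{\mathbb{C}}$ modulo Möbius maps) and an injection $i_v:E_v\to\mathbb{S}_v$; $X_v=i_v(E_v)$, $a_v:X\to\mathbb{S}_v$, $a_v(x)=i_v(e)$ for $x\in B_v(e)$. Covers. A cover $\mathcal{F}:\mathcal{T}^Y\to\mathcal{T}^Z$ is a map $F:T^Y\to T^Z$ sending vertices to vertices, edges $\{v,w\}$ to edges $\{F(v),F(w)\}$, $Y$ into $Z$, $IV^Y$ into $IV^Z$, with holomorphic branched coverings $f_v:\mathbb{S}_v\to\mathbb{S}_{F(v)}$ ($v\in IV^Y$) that are coverings off $Y_v$, satisfy $f_v\circ i_v=i_{F(v)}\circ F$ on $E_v$, and have equal local degrees at the two attaching points of any edge between internal vertices. Dynamical systems. $T^X$ compatible with $T^Y$: $X\subseteq Y$, $IV^X\subseteq IV^Y$, and for vertices $v,v_1,v_2,v_3$ of $T^X$, $v$ separates $v_1,v_2,v_3$ (they lie in distinct components of the complement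 of $v$) in $T^X$ iff in $T^Y$; $\mathcal{T}^X\triangleleft\mathcal{T}^Y$ if moreover internal spheres of $\mathcal{T}^X$ are the same projective spheres in $\mathcal{T}^Y$ and $a^X_v=a^Y_v|_X$. A dynamical system is a pair $(\mathcal{F},\mathcal{T}^X)$ with $X\subseteq Y\cap Z$, $\mathcal{T}^X\triangleleft\mathcal{T}^Y$, $\mathcal{T}^X\triangleleft\mathcal{T}^Z$. Marked rational maps. A portrait of degree $d$ is $\mathbf{F}=(F,\deg)$ with $F:Y\to Z$ a map of finite sets and $\deg:Y\to\mathbb{N}\setminus\{0\}$ with $\sum_{a\in Y}(\deg(a)-1)=2d-2$ and $\sum_{a\in F^{-1}(b)}\deg(a)=d$ for every $b\in Z$. A rational map dynamically marked by $(\mathbf{F},X)$ is $(f,y,z)$ with $f$ rational of degree $d$, $y:Y\to\hat{\mathbb{C}}$, $z:Z\to\hat{\mathbb{C}}$ injective, $f\circ y=z\circ F$, $\deg_{y(a)}f=\deg(a)$, and $y|_X=z|_X$. Dynamical convergence. $(f_n,y_n,z_n)$ converges dynamically to $(\mathcal{F},\mathcal{T}^X)$ via $(\phi^Y_n,\phi^Z_n)$ if the portrait of $\mathcal{F}$ ($F|_Y$ with the local degrees at leaves) is $\mathbf{F}$ and for every $v\in IV^Y$, $w=F(v)$, there are projective isomorphisms $\phi^Y_{n,v}:\hat{\mathbb{C}}\to\mathbb{S}_v$, $\phi^Z_{n,w}:\hat{\mathbb{C}}\to\mathbb{S}_w$ with $\phi^Y_{n,v}\circ y_n\to a^Y_v$,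 $\phi^Z_{n,w}\circ z_n\to a^Z_w$, $\phi^Z_{n,w}\circ f_n\circ(\phi^Y_{n,v})^{-1}\to f_v$ locally uniformly on $\mathbb{S}_v\setminus Y_v$, and $\phi^Y_{n,v}=\phi^Z_{n,v}$ for $v\in IV^X$. Rescalings. A rescaling of $(f_n)$ is a sequence of Möbius transformations $(M_n)$ such that for some $k\in\mathbb{N}$ and some rational map $g$ of degree $\ge2$, $M_n\circ f_n^k\circ M_n^{-1}\to g$ uniformly on compact subsets of $\hat{\mathbb{C}}$ minus finitely many points. Two rescalings $(M_n),(N_n)$ are equivalent if $N_n\circ M_n^{-1}$ converges in the space of Möbius transformations. Sequences $\phi_{n,v}:\hat{\mathbb{C}}\to\mathbb{S}_v$ are regarded as Möbius transformations via a fixed projective chart of $\mathbb{S}_v$. *)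

(* Defs.v *)
From mathcomp Require Import all_boot all_algebra.
From mathcomp Require Import reals complex finmap.

Set Implicit Arguments.
Unset Strict Implicit.
Unset Printing Implicit Defensive.

Import GRing.Theory Num.Theory.
Local Open Scope ring_scope.

(* The Riemann sphere  C^ = C u {oo}  (None = oo), C = R[i].           *)
(* Every projective sphere is identified with C^ via a fixed chart.   *)
Section Sphere.
Variable R : realType.

Definition Chat := option R[i].

Definition cmod (z : R[i]) : R := Num.sqrt (complex.Re z ^+ 2 + complex.Im z ^+ 2).

Definition chord (z w : Chat) : R :=
  match z, w with
  | Some a, Some b =>
      2 * cmod (a - b) / (Num.sqrt (1 + cmod a ^+ 2) * Num.sqrt (1 + cmod b ^+ 2))
  | Some a, None | None, Some a => 2 / Num.sqrt (1 + cmod a ^+ 2)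
  | None, None => 0
  end.

Definition cvgS (u : nat -> Chat) (q : Chat) : Prop :=
  forall e : R, 0 < e -> exists N, forall n, (N <= n)%N -> chord (u n) q < e.

Definition cvgC (u : nat -> R[i]) (q : R[i]) : Prop :=
  forall e : R, 0 < e -> exists N, forall n, (N <= n)%N -> cmod (u n - q) < e.

(* locally uniform convergence on C^ \ A for a finite set A: uniform
   convergence on each set {z | chord z a >= dlt for all a in A}; these
   sets exhaust the compact subsets of C^ \ A. *)
Definition lu_cvg (g : nat -> Chat -> Chat) (h : Chat -> Chat) (A : Chat -> Prop) : Prop :=
  forall dlt e : R, 0 < dlt -> 0 < e -> exists N, forall n z, (N <= n)%N ->
    (forall a, A a -> dlt <= chord z a) -> chord (g n z) (h z) < e.

Definition i0 : 'I_2 := ord0.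
Definition i1 : 'I_2 := ord_max.

Definition mob (A : 'M[R[i]]_2) (z : Chat) : Chat :=
  let a := A i0 i0 in let b := A i0 i1 in let c := A i1 i0 in let d := A i1 i1 in
  match z with
  | Some x => if c * x + d != 0 then Some ((a * x + b) / (c * x + d)) else None
  | None => if c != 0 then Some (a / c) else None
  end.

(* convergence in the space PGL_2(C) of Moebius transformations: suitable
   matrix representatives converge to an invertible matrix. *)
Definition mob_cvg (N : nat -> 'M[R[i]]_2) : Prop :=
  exists (lam : nat -> R[i]) (B : 'M[R[i]]_2),
    B \in unitmx /\ forall i j, cvgC (fun n => (lam n *: N n) i j) (B i j).

Record ratmap := RatMap { rnum : {poly R[i]}; rden : {poly R[i]} }.

Definition is_rat (f : ratmap) : Prop :=
  coprimep (rnum f) (rden f) /\ (rnum f != 0 \/ rden f != 0).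

Definition rdeg (f : ratmap) : nat := (maxn (size (rnum f)) (size (rden f))).-1.

Definition ev (f : ratmap) (z : Chat) : Chat :=
  match z with
  | Some x => if (rden f).[x] != 0 then Some ((rnum f).[x] / (rden f).[x]) else None
  | None =>
      if (size (rden f) < size (rnum f))%N then None
      else if (size (rnum f) < size (rden f))%N then Some 0
      else Some (lead_coef (rnum f) / lead_coef (rden f))
  end.

(* numerator of f - b (Q if b = oo) *)
Definition Rb (f : ratmap) (b : Chat) : {poly R[i]} :=
  match b with Some c => rnum f - c *: rden f | None => rden f end.

Definition local_deg (f : ratmap) (a : Chat) : nat :=
  match a with
  | Some x => mup x (Rb f (ev f a))
  | None => rdeg f - (size (Rb f (ev f None))).-1
  end.

Definition rescaling (f : nat -> ratmap) (M : nat -> 'M[R[i]]_2) : Prop :=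
  (forall n, M n \in unitmx) /\
  exists (k : nat) (g : ratmap) (A : seq Chat),
    is_rat g /\ (2 <= rdeg g)%N /\
    lu_cvg (fun n => mob (M n) \o iter k (ev (f n)) \o mob (invmx (M n)))
           (ev g) (fun a => a \in A).

Definition equiv_resc (N M : nat -> 'M[R[i]]_2) : Prop :=
  mob_cvg (fun n => N n *m invmx (M n)).

End Sphere.

(* Trees. Vertices: inl x for leaves (x a mark), inr k for internal.   *)
Local Open Scope fset_scope.

Definition vtx := (nat + nat)%type.

Record tree := Tree { lv : {fset nat}; iv : {fset nat}; adj : rel vtx }.

Definition verts (T : tree) : {fset vtx} :=
  [fset (inl x : vtx) | x in lv T] `|` [fset (inr k : vtx) | k in iv T].

Definition inV (T : tree) (u : vtx) : bool := u \in verts T.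

Definition valence (T : tree) (v : vtx) : nat := #|` [fset u in verts T | adj T v u] |.

Definition is_tree (T : tree) : Prop :=
  [/\ (forall u w, adj T u w = adj T w u),
      (forall u, ~~ adj T u u),
      (forall u w, adj T u w -> inV T u && inV T w),
      (forall u w, inV T u -> inV T w ->
         exists p : seq vtx, [&& all (inV T) p, path (adj T) u p & last u p == w]) &
      (forall (v : vtx) (p : seq vtx),
         ~ [/\ (2 <= size p)%N, uniq (v :: p), path (adj T) v p & adj T (last v p) v])].

Definition stable_marked (T : tree) : Prop :=
  [/\ is_tree T, (3 <= #|` lv T |)%N,
      (forall x, x \in lv T -> valence T (inl x) = 1%N) &
      (forall k, k \in iv T -> (3 <= valence T (inr k))%N)].

Definition in_branch (T : tree) (v w u : vtx) : Prop :=
  exists p : seq vtx,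
    [&& all (fun x => inV T x && (x != v)) (w :: p), path (adj T) w p & last w p == u].

Definition separates (T : tree) (v v1 v2 v3 : vtx) : Prop :=
  [/\ v1 != v, v2 != v & v3 != v] /\
  [/\ ~ in_branch T v v1 v2, ~ in_branch T v v1 v3 & ~ in_branch T v v2 v3].

Definition compatible (TX TY : tree) : Prop :=
  [/\ lv TX `<=` lv TY, iv TX `<=` iv TY &
      forall v v1 v2 v3, inV TX v -> inV TX v1 -> inV TX v2 -> inV TX v3 ->
        (separates TX v v1 v2 v3 <-> separates TY v v1 v2 v3)].

(* Trees of spheres: each internal sphere is C^ (fixed chart);        *)
(* att v w = i_v({v,w}).                                               *)
Section TreeSpheres.
Variable R : realType.

Record tsph := TS { tr :> tree; att : vtx -> vtx -> Chat R }.

Definition is_tsph (S : tsph) : Prop :=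
  stable_marked S /\
  forall k, k \in iv S -> forall u w, adj S (inr k) u -> adj S (inr k) w ->
    att S (inr k) u = att S (inr k) w -> u = w.

Definition aval (S : tsph) (v : vtx) (x : nat) (q : Chat R) : Prop :=
  exists w, adj S v w /\ in_branch S v w (inl x) /\ q = att S v w.

Definition tri (SX SY : tsph) : Prop :=
  compatible SX SY /\
  forall k x q, k \in iv SX -> x \in lv SX -> (aval SX (inr k) x q <-> aval SY (inr k) x q).

Definition is_cover (SY SZ : tsph) (Fv : vtx -> vtx) (fv : vtx -> ratmap R) : Prop :=
  [/\ (forall y, y \in lv SY -> exists z, z \in lv SZ /\ Fv (inl y) = inl z),
      (forall k, k \in iv SY -> exists k', k' \in iv SZ /\ Fv (inr k) = inr k'),
      (forall u w, adj SY u w -> adj SZ (Fv u) (Fv w)),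
      (forall k, k \in iv SY ->
         let v := inr k in
         [/\ is_rat (fv v), (1 <= rdeg (fv v))%N,
             (* covering off Y_v: no critical point outside Y_v and
                f_v^{-1}(Z_{F(v)}) contained in Y_v *)
             (forall a, (forall w, adj SY v w -> a <> att SY v w) ->
                local_deg (fv v) a = 1%N /\
                (forall w', adj SZ (Fv v) w' -> ev (fv v) a <> att SZ (Fv v) w')) &
             (forall w, adj SY v w -> ev (fv v) (att SY v w) = att SZ (Fv v) (Fv w))]) &
      (forall k k', k \in iv SY -> k' \in iv SY -> adj SY (inr k) (inr k') ->
         local_deg (fv (inr k)) (att SY (inr k) (inr k')) =
         local_deg (fv (inr k')) (att SY (inr k') (inr k)))].

Definition dynsys (SX SY SZ : tsph) : Prop :=
  lv SX `<=` lv SY `&` lv SZ /\ tri SX SY /\ tri SX SZ.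

Definition portrait (d : nat) (Y Z : {fset nat}) (Fp dg : nat -> nat) : Prop :=
  [/\ (forall a, a \in Y -> Fp a \in Z),
      (forall a, a \in Y -> (0 < dg a)%N),
      (\sum_(a <- Y) (dg a - 1))%N = (2 * d - 2)%N &
      (forall b, b \in Z -> (\sum_(a <- Y | Fp a == b) dg a)%N = d)].

Definition is_marked (d : nat) (X Y Z : {fset nat}) (Fp dg : nat -> nat)
    (f : ratmap R) (y z : nat -> Chat R) : Prop :=
  [/\ is_rat f /\ rdeg f = d,
      {in Y &, injective y}, {in Z &, injective z},
      (forall a, a \in Y -> ev f (y a) = z (Fp a) /\ local_deg f (y a) = dg a) &
      (forall x, x \in X -> y x = z x)].

Definition cover_portrait (SY : tsph) (Fv : vtx -> vtx) (fv : vtx -> ratmap R)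
    (Fp dg : nat -> nat) : Prop :=
  forall a, a \in lv SY -> Fv (inl a) = inl (Fp a) /\
    forall u, adj SY (inl a) u -> local_deg (fv u) (att SY u (inl a)) = dg a.

Definition dyn_conv (f : nat -> ratmap R) (y z : nat -> nat -> Chat R)
    (SX SY SZ : tsph) (Fv : vtx -> vtx) (fv : vtx -> ratmap R) (Fp dg : nat -> nat)
    (phiY phiZ : nat -> vtx -> 'M[R[i]]_2) : Prop :=
  [/\ cover_portrait SY Fv fv Fp dg,
      (forall k, k \in iv SY ->
         let v := inr k in let w := Fv v in
         [/\ (forall n, phiY n v \in unitmx), (forall n, phiZ n w \in unitmx),
             (forall a q, a \in lv SY -> aval SY v a q ->
                cvgS (fun n => mob (phiY n v) (y n a)) q),
             (forall b q, b \in lv SZ -> aval SZ w b q ->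
                cvgS (fun n => mob (phiZ n w) (z n b)) q) &
             lu_cvg (fun n => mob (phiZ n w) \o ev (f n) \o mob (invmx (phiY n v)))
                    (ev (fv v)) (fun a => exists u, adj SY v u /\ a = att SY v u)]) &
      (forall k, k \in iv SX -> forall n, mob (phiY n (inr k)) =1 mob (phiZ n (inr k)))].

End TreeSpheres.

(* Main.v *)
Require Import Defs.
From mathcomp Require Import all_boot all_algebra.
From mathcomp Require Import reals complex finmap.
From mathcomp Require Import all_order boolp classical_sets filter ring lra zify.

(** Mark by Z three base points, the critical values of f_n, and the images under f_n of the base points and
    of three points determining each M_i; mark by Y the full preimage of Z.  Limits are taken
    along a free ultrafilter, and a subsequence is extracted at the end.

    The vertices of the limit tree of a marked sphere are the classes of coordinates
    normalizing three marks, up to bounded change; two different coordinates each collapse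
    all but one direction of the other, and this property alone makes the tree.  In a
    coordinate of the source, f_n converges, for a suitable coordinate of the target, to a
    non-constant map g times a common factor G.  If s and m are the order of G and the local
    degree of g at a direction al, then by Hurwitz' theorem, applied to the fibres and to the
    Wronskian, the number of preimages of a mark b in that direction is s, plus m when b tends
    to g(al), and the number of critical points there is 2 s + m - 1.  Summing both counts over
    the two sides of an edge shows that the local degrees at its ends agree and that every mark
    of Z lies on exactly one side of its image; summing over all directions at a vertex gives
    the Riemann-Hurwitz relation from which the target coordinate is a vertex of the tree
    of Z. *)

Import Order.TTheory GRing.Theory Num.Theory.
Set Implicit Arguments.
Unset Strict Implicit.
Unset Printing Implicit Defensive.
Local Open Scope ring_scope.

(** * Limits along an ultrafilter *)

(** The coordinates of the trees are themselves found from limits, so ordinary subsequences would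
    have to be chosen again at every stage. Along an ultrafilter every sequence of points has a
    limit and every bounded integer datum (numbers of marks, labels, local degrees) is constant, so
    all choices are compatible; only finitely many conditions remain to be realized by one
    subsequence, with error [1 / (m + 1)] at its term [m].

    Maps are treated as pairs of binary forms: infinity is then an ordinary point, and roots
    escaping to infinity or cancelling in the limit are still counted. The marks of [Y] contain all
    zeros of the fibre forms over [Z] and of the Wronskian, so the limits of these forms are known
    from the limits of the marks.

    The delicate point is the target coordinate. It is produced by elimination from [f_n] alone, and
    nothing says at first that the marks of [Z] have three different limits in it; without that it
    would be no vertex of the tree of [Z].

    [X] consists of the three base points. Its tree has one inner vertex, whose frame is given by
    the same formula in both markings, so [phiY] and [phiZ] agree there exactly. *)

Section Modulus.
Variable R : realType.
Local Notation C := R[i].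
Implicit Types z w : C.

Lemma cmodE z : cmod z = complex.ComplexField.Normc.normc z.
Proof. by case: z. Qed.

Lemma cmod_ge0 z : 0 <= cmod z.
Proof. exact: sqrtr_ge0. Qed.

Lemma cmod0 : cmod (0 : C) = 0.
Proof. by rewrite cmodE ComplexField.Normc.normc0. Qed.

Lemma cmod1 : cmod (1 : C) = 1.
Proof. by rewrite cmodE ComplexField.Normc.normc1. Qed.

Lemma cmodM z w : cmod (z * w) = cmod z * cmod w.
Proof. by rewrite !cmodE ComplexField.Normc.normcM. Qed.

Lemma cmodV z : cmod z^-1 = (cmod z)^-1.
Proof. by rewrite !cmodE ComplexField.Normc.normcV. Qed.

Lemma cmodN z : cmod (- z) = cmod z.
Proof. by case: z => a b; rewrite /cmod /= !sqrrN. Qed.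

Lemma cmodD z w : cmod (z + w) <= cmod z + cmod w.
Proof.
have := ler_normD z w.
by rewrite !normc_def -rmorphD /= lecR.
Qed.

Lemma cmod_eq0 z : (cmod z == 0) = (z == 0).
Proof.
apply/eqP/eqP => [|->]; last exact: cmod0.
by rewrite cmodE => /ComplexField.Normc.eq0_normc.
Qed.

Lemma cmod_gt0 z : (0 < cmod z) = (z != 0).
Proof. by rewrite lt_def cmod_ge0 cmod_eq0 andbT. Qed.

Lemma cmod_le_parts z : cmod z <= `|complex.Re z| + `|complex.Im z|.
Proof.
rewrite -(ler_pXn2r (ltn0Sn 1)) ?nnegrE ?cmod_ge0 ?addr_ge0 //.
rewrite sqr_sqrtr ?addr_ge0 ?sqr_ge0 // sqrrD !real_normK ?num_real //.
by rewrite -addrA [_ *+ 2 + _]addrC addrA lerDl mulrn_wge0 // mulr_ge0.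
Qed.

Lemma parts_le_cmod z : `|complex.Re z| <= cmod z /\ `|complex.Im z| <= cmod z.
Proof.
by split; rewrite -(ler_pXn2r (ltn0Sn 1)) ?nnegrE ?cmod_ge0 ?normr_ge0 //
  sqr_sqrtr ?addr_ge0 ?sqr_ge0 // real_normK ?num_real // ?lerDl ?lerDr sqr_ge0.
Qed.

End Modulus.

Section UltraLimits.
Variables (R : realType) (U : set_system nat).
Hypothesis UU : UltraFilter U.
Local Notation C := R[i].
Local Open Scope classical_set_scope.

Lemma ultra_meet (A B : set nat) : U A -> U B -> exists n, A n /\ B n.
Proof. by move=> UA UB; have [n []] := filter_ex (filterI UA UB); exists n. Qed.

Lemma ultra_all (T : eqType) (s : seq T) (P : T -> nat -> Prop) :
  (forall x, x \in s -> U (P x)) -> U [set n | forall x, x \in s -> P x n].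
Proof.
elim: s => [|x s IH] H; first by apply: filterS filterT.
apply: filterS2 (H x (mem_head _ _)) (IH _) => [n Px Ps y|y ys].
  by rewrite inE => /orP[/eqP->|/Ps].
by apply: H; rewrite inE ys orbT.
Qed.

(** An ultrafilter containing a finite union contains one of its members. Discrete data become
    constant along [U] in this way. *)
Lemma ultra_fin (T : eqType) (s : seq T) (g : nat -> T) :
  U [set n | g n \in s] -> exists2 x, x \in s & U [set n | g n = x].
Proof.
elim: s => [|x s IH] H.
  have /filter_ex[n] := H; by [].
have [A|A] := in_ultra_setVsetC [set n | g n = x] UU.
  by exists x; rewrite ?mem_head.
have [y ys Hy] : exists2 y, y \in s & U [set n | g n = y].
  apply: IH; apply: filterS2 H A => n /=.
  by rewrite inE => /orP[/eqP->|].
by exists y; rewrite // inE ys orbT.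
Qed.

Lemma ultra_bounded_nat (B : nat) (g : nat -> nat) :
  U [set n | (g n <= B)%N] -> exists m, U [set n | g n = m].
Proof.
move=> H; have [|m _ Hm] := @ultra_fin nat (iota 0 B.+1) g; last by exists m.
by apply: filterS H => n h; rewrite /mkset mem_iota.
Qed.

(** The limit is the supremum of the levels that [r] reaches along [U]; a level above it is not
    reached, and the ultrafilter then contains the set where [r] stays below. *)
Lemma ultra_real_lim (B : R) (r : nat -> R) :
  U [set n | `|r n| <= B] ->
  exists l, forall e, 0 < e -> U [set n | `|r n - l| < e].
Proof.
move=> H; pose A := [set x : R | U [set n | x <= r n]].
have Asup : has_sup A.
  split; first by exists (- B); apply: filterS H => n /=; rewrite ler_norml => /andP[].
  exists B => x Ax; have [n [/= h1 h2]] := ultra_meet Ax H.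
  by apply: le_trans h1 (le_trans (ler_norm _) h2).
exists (sup A) => e e0.
have [x Ax lx] := sup_adherent e0 Asup.
have nA : ~ A (sup A + e).
  by move=> /(ub_le_sup Asup.2); rewrite gerDl leNgt e0.
have [//|An] := in_ultra_setVsetC [set n | sup A + e <= r n] UU.
apply: filterS2 Ax An => n /= h1 /negP; rewrite -ltNge => h2.
by rewrite ltr_norml; apply/andP; split; move: lx h1 h2; lra.
Qed.

Definition ucv (u : nat -> C) (l : C) : Prop :=
  forall e : R, 0 < e -> U [set n | cmod (u n - l) < e].

Lemma ucv_bounded B (u : nat -> C) :
  U [set n | cmod (u n) <= B] -> exists l, ucv u l.
Proof.
move=> H.
have [a Ha] : exists l, forall e, 0 < e -> U [set n | `|complex.Re (u n) - l| < e].
  apply: (ultra_real_lim (B := B)); apply: filterS H => n /=.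
  by apply: le_trans; have [] := parts_le_cmod (u n).
have [b Hb] : exists l, forall e, 0 < e -> U [set n | `|complex.Im (u n) - l| < e].
  apply: (ultra_real_lim (B := B)); apply: filterS H => n /=.
  by apply: le_trans; have [] := parts_le_cmod (u n).
exists (a +i* b)%C => e e0; have e2 : 0 < e / 2 by rewrite divr_gt0.
apply: filterS2 (Ha _ e2) (Hb _ e2) => n /= h1 h2.
apply: le_lt_trans (cmod_le_parts _) _.
by case: (u n) h1 h2 => x y /= h1 h2; rewrite [ltRHS]splitr ltrD.
Qed.

Lemma ucv_cst l : ucv (fun=> l) l.
Proof. by move=> e e0; apply: filterS filterT => n _ /=; rewrite subrr cmod0. Qed.

Lemma ucv_near (u v : nat -> C) l : U [set n | u n = v n] -> ucv u l -> ucv v l.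
Proof. by move=> H cu e e0; apply: filterS2 H (cu e e0) => n /= ->. Qed.

Lemma ucvD (u v : nat -> C) l m : ucv u l -> ucv v m -> ucv (fun n => u n + v n) (l + m).
Proof.
move=> cu cv e e0; have e2 : 0 < e / 2 by rewrite divr_gt0.
apply: filterS2 (cu _ e2) (cv _ e2) => n /= h1 h2.
rewrite opprD addrACA; apply: le_lt_trans (cmodD _ _) _.
by rewrite [ltRHS]splitr ltrD.
Qed.

Lemma ucv_ubound (u : nat -> C) l : ucv u l -> U [set n | cmod (u n) <= cmod l + 1].
Proof.
move=> /(_ 1 ltr01); apply: filterS => n /= h.
rewrite -[u n](subrK l) addrC; apply: le_trans (cmodD _ _) _.
by rewrite lerD2l ltW.
Qed.

Lemma ucv0M (u v : nat -> C) (B : R) :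
  ucv u 0 -> U [set n | cmod (v n) <= B] -> ucv (fun n => u n * v n) 0.
Proof.
move=> cu bv e e0.
have B1 : 0 < `|B| + 1 by rewrite ltr_wpDl.
have e2 : 0 < e / (`|B| + 1) by rewrite divr_gt0.
apply: filterS2 (cu _ e2) bv => n /=; rewrite !subr0 cmodM ltr_pdivlMr // => h1 h2.
apply: le_lt_trans h1; rewrite ler_wpM2l ?cmod_ge0 //.
by apply: le_trans h2 (le_trans (ler_norm _) _); rewrite lerDl.
Qed.

Lemma ucv_sub0 (u : nat -> C) l : ucv u l <-> ucv (fun n => u n - l) 0.
Proof. by split=> cu e e0; have := cu e e0; apply: filterS => n /=; rewrite subr0. Qed.

Lemma ucvM (u v : nat -> C) l m : ucv u l -> ucv v m -> ucv (fun n => u n * v n) (l * m).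
Proof.
move=> cu cv; apply/ucv_sub0.
have h1 : ucv (fun n => (u n - l) * v n) 0.
  exact: ucv0M (proj1 (ucv_sub0 _ _) cu) (ucv_ubound cv).
have h2 : ucv (fun n => (v n - m) * l) 0.
  apply: (@ucv0M _ _ (cmod l)); first exact: (proj1 (ucv_sub0 _ _) cv).
  apply: filterS filterT => n _; exact: lexx.
have := ucvD h1 h2; rewrite addr0; apply: ucv_near.
by apply: filterS filterT => n _ /=; ring.
Qed.

Lemma ucvN (u : nat -> C) l : ucv u l -> ucv (fun n => - u n) (- l).
Proof. by move=> cu e e0; have := cu e e0; apply: filterS => n /=; rewrite -opprD cmodN. Qed.

Lemma ucvB (u v : nat -> C) l m : ucv u l -> ucv v m -> ucv (fun n => u n - v n) (l - m).
Proof. by move=> cu cv; apply: ucvD => //; apply: ucvN. Qed.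

Lemma ucv_sum (I : Type) (s : seq I) (P : pred I) (u : I -> nat -> C) (l : I -> C) :
  (forall i, ucv (u i) (l i)) ->
  ucv (fun n => \sum_(i <- s | P i) u i n) (\sum_(i <- s | P i) l i).
Proof.
move=> H; elim: s => [|i s IH].
  rewrite big_nil; apply: ucv_near (ucv_cst 0).
  by apply: filterS filterT => n _ /=; rewrite big_nil.
rewrite big_cons; case: ifP => Pi.
  apply: ucv_near (ucvD (H i) IH).
  by apply: filterS filterT => n _ /=; rewrite big_cons Pi.
apply: ucv_near IH.
by apply: filterS filterT => n _ /=; rewrite big_cons Pi.
Qed.

Lemma ucv_unique (u : nat -> C) l m : ucv u l -> ucv u m -> l = m.
Proof.
move=> cu cv; apply/eqP; rewrite -subr_eq0 -cmod_eq0 eq_le cmod_ge0 andbT.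
rewrite leNgt; apply/negP => h.
have h2 : 0 < cmod (l - m) / 2 by rewrite divr_gt0.
have [n [/= h3 h4]] := ultra_meet (cu _ h2) (cv _ h2).
have := cmodD (l - u n) (u n - m).
rewrite addrA subrK leNgt => /negP; apply.
rewrite [ltRHS]splitr ltrD //.
by rewrite -cmodN opprB.
Qed.

Lemma ucv_neq0 (u : nat -> C) l : ucv u l -> l != 0 -> U [set n | u n != 0].
Proof.
rewrite -cmod_gt0 => cu /cu; apply: filterS => n /= h.
by apply/eqP => u0; move: h; rewrite u0 sub0r cmodN ltxx.
Qed.

(* Dividing a finite family by its largest member keeps it bounded. *)
Lemma ultra_normalize (I : finType) (u : I -> nat -> C) :
  U [set n | exists i, u i n != 0] ->
  exists (lam : nat -> C) (l : I -> C) (i0 : I),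
    [/\ forall n, lam n != 0, forall i, ucv (fun n => lam n * u i n) (l i) & l i0 = 1].
Proof.
move=> H.
have /filter_ex[n0 [j0 _]] := H.
pose m n := [arg max_(i > j0) cmod (u i n)]%O.
have mP n i : cmod (u i n) <= cmod (u (m n) n).
  by rewrite /m; case: arg_maxP => // k _; apply.
have [i0 _ Hi0] : exists2 i, i \in enum I & U [set n | m n = i].
  by apply: ultra_fin; apply: filterS filterT => n _ /=; rewrite mem_enum.
pose lam n := if u (m n) n == 0 then 1 else (u (m n) n)^-1.
have lam0 n : lam n != 0 by rewrite /lam; case: ifP => [_|/negbT h]; rewrite ?oner_neq0 ?invr_neq0.
have Hne : U [set n | u (m n) n != 0].
  apply: filterS H => n [j] /=; rewrite -!cmod_gt0 => h.
  exact: lt_le_trans h (mP n j).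
have [l Hl] : exists l : I -> C, forall i, ucv (fun n => lam n * u i n) (l i).
  suff H1 i : exists l, ucv (fun n => lam n * u i n) l.
    by have [l] := boolp.choice H1; exists l.
  apply: (@ucv_bounded 1).
  apply: filterS Hne => n /= h; rewrite /lam (negbTE h) cmodM cmodV mulrC.
  by rewrite ler_pdivrMr ?cmod_gt0 // mul1r.
exists lam, l, i0; split => //.
apply: ucv_unique (Hl i0) _; apply: ucv_near (ucv_cst 1).
by apply: filterS2 Hi0 Hne => n /= <- h; rewrite /lam (negbTE h) mulVf.
Qed.

End UltraLimits.

Lemma free_ultrafilter_exists :
  exists2 U : set_system nat, UltraFilter U & forall N, U [set n | (N <= n)%N]%classic.
Proof.
have [U [UU sU]] := @ultraFilterLemma nat \oo%classic _.
by exists U => // N; apply: sU; exists N.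
Qed.

(** * Homogeneous coordinates on the sphere *)

Section HomogeneousCoordinates.
Variable R : realType.
Local Notation C := R[i].
Local Notation vec := (C * C)%type.
Implicit Types (z w : Chat R) (u v : vec) (k : C) (A B : 'M[C]_2).

Definition hat z : vec := if z is Some c then (c, 1) else (1, 0).
Definition proj v : Chat R := if v.2 != 0 then Some (v.1 / v.2) else None.
(** The determinant of two vectors: for nonzero vectors it vanishes exactly when they name the same
    point, and it is the numerator of the chordal distance. *)
Definition wedge u v : C := u.1 * v.2 - u.2 * v.1.
Definition scv k v : vec := (k * v.1, k * v.2).
Definition mulv A v : vec :=
  (A i0 i0 * v.1 + A i0 i1 * v.2, A i1 i0 * v.1 + A i1 i1 * v.2).

Lemma vec_neq0 v : (v != 0) = (v.1 != 0) || (v.2 != 0).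
Proof. by case: v => a b; rewrite -negb_and. Qed.

Lemma hat_neq0 z : hat z != 0.
Proof. by case: z => [c|]; rewrite vec_neq0 /= oner_neq0 ?orbT. Qed.

Lemma hatK z : proj (hat z) = z.
Proof. by case: z => [c|]; rewrite /proj /= ?oner_neq0 ?divr1 // eqxx. Qed.

Lemma hat_proj v : v != 0 -> exists2 k, k != 0 & hat (proj v) = scv k v.
Proof.
case: v => a b; rewrite vec_neq0 /proj /scv /=; have [->|b0] := eqVneq b 0.
  rewrite orbF => a0; exists a^-1; rewrite ?invr_eq0 //=.
  by rewrite mulVf // mulr0.
move=> _; exists b^-1; rewrite ?invr_eq0 //=.
by rewrite mulVf // mulrC.
Qed.

Lemma scv_neq0 k v : k != 0 -> (scv k v != 0) = (v != 0).
Proof. by move=> k0; rewrite !vec_neq0 /scv /= !mulf_eq0 (negbTE k0). Qed.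

Lemma proj_scv k v : k != 0 -> proj (scv k v) = proj v.
Proof.
move=> k0; rewrite /proj /scv /= mulf_eq0 (negbTE k0) /=.
by case: ifP => // v0; congr Some; field; rewrite k0 v0.
Qed.

Lemma wedge_scl k u v : wedge (scv k u) v = k * wedge u v.
Proof. by rewrite /wedge /scv /=; ring. Qed.

Lemma wedge_scr k u v : wedge u (scv k v) = k * wedge u v.
Proof. by rewrite /wedge /scv /=; ring. Qed.

Lemma wedge_hat z w : (wedge (hat z) (hat w) == 0) = (z == w).
Proof.
case: z w => [c|] [c'|]; rewrite /wedge /=.
- by rewrite mulr1 mul1r subr_eq0 -[in RHS](inj_eq Some_inj).
- by rewrite mulr0 mulr1 sub0r oppr_eq0 oner_eq0.
- by rewrite mulr1 mul0r subr0 oner_eq0.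
- by rewrite mulr0 mul0r subrr !eqxx.
Qed.

Lemma wedge_proj u v : u != 0 -> v != 0 -> (wedge u v == 0) = (proj u == proj v).
Proof.
move=> /hat_proj[k k0 hu] /hat_proj[l l0 hv].
by rewrite -wedge_hat hu hv wedge_scl wedge_scr !mulf_eq0 (negbTE k0) (negbTE l0).
Qed.

Lemma mobE A z : mob A z = proj (mulv A (hat z)).
Proof. by case: z => [c|]; rewrite /mob /proj /mulv /= ?mulr1 ?mulr0 ?addr0. Qed.

Lemma mulvM A B v : mulv (A *m B) v = mulv A (mulv B v).
Proof.
rewrite /mulv !mxE !big_ord_recl !big_ord0 !addr0 /=.
have -> : lift ord0 ord0 = i1 :> 'I_2 by apply/val_inj.
by rewrite -/i0; congr (_, _); ring.
Qed.

Lemma mulv1 v : mulv 1%:M v = v.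
Proof. by case: v => a b; rewrite /mulv !mxE /= !mulr1n !mulr0n !mul1r !mul0r addr0 add0r. Qed.

Lemma mulv_scv A k v : mulv A (scv k v) = scv k (mulv A v).
Proof. by rewrite /mulv /scv /=; congr (_, _); ring. Qed.

Lemma mulv_scale A k v : mulv (k *: A) v = scv k (mulv A v).
Proof. by rewrite /mulv /scv !mxE /=; congr (_, _); ring. Qed.

Lemma ord2P (i : 'I_2) : i = i0 \/ i = i1.
Proof. by case: i => [[|[|//]] h]; [left|right]; apply/val_inj. Qed.

Lemma det2 A : \det A = A i0 i0 * A i1 i1 - A i0 i1 * A i1 i0.
Proof.
rewrite (expand_det_row _ i0) !big_ord_recl big_ord0 /cofactor !det_mx11 !mxE /=.
have e1 (x : 'I_1) : lift i0 x = i1 by case: x => [[|//] ?]; apply/val_inj.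
have e0 (x : 'I_1) : lift i1 x = i0 by case: x => [[|//] ?]; apply/val_inj.
by rewrite -/i0 !e1 e0 /bump /= expr0 expr1; ring.
Qed.

Lemma wedge_mulv A u v : wedge (mulv A u) (mulv A v) = \det A * wedge u v.
Proof. by rewrite det2 /wedge /mulv /=; ring. Qed.

Lemma mulv_neq0 A v : A \in unitmx -> v != 0 -> mulv A v != 0.
Proof.
move=> Au; apply: contraNneq => h.
rewrite -(mulv1 v) -(mulVmx Au) mulvM h /mulv /=.
by rewrite !mulr0 addr0.
Qed.

Lemma mob_proj A v : v != 0 -> mob A (proj v) = proj (mulv A v).
Proof. by rewrite mobE => /hat_proj[k k0 ->]; rewrite mulv_scv proj_scv. Qed.

Lemma mobM A B z : B \in unitmx -> mob (A *m B) z = mob A (mob B z).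
Proof. by move=> Bu; rewrite [mob B z]mobE mob_proj ?mulv_neq0 ?hat_neq0 // -mulvM -mobE. Qed.

Lemma mob1 z : mob 1%:M z = z.
Proof. by rewrite mobE mulv1 hatK. Qed.

Lemma mobK A z : A \in unitmx -> mob (invmx A) (mob A z) = z.
Proof. by move=> Au; rewrite -mobM // mulVmx // mob1. Qed.

Lemma mobVK A z : A \in unitmx -> mob A (mob (invmx A) z) = z.
Proof. by move=> Au; rewrite -mobM ?unitmx_inv // mulmxV // mob1. Qed.

Lemma mob_inj A : A \in unitmx -> injective (mob A).
Proof. by move=> Au z w h; rewrite -(mobK z Au) h mobK. Qed.

Lemma mob_scale A k z : k != 0 -> mob (k *: A) z = mob A z.
Proof. by move=> k0; rewrite !mobE mulv_scale proj_scv. Qed.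

Lemma unit2 A : (A \in unitmx) = (\det A != 0).
Proof. by rewrite unitmxE unitfE. Qed.

Definition vnorm v : R := Num.sqrt (cmod v.1 ^+ 2 + cmod v.2 ^+ 2).

Lemma vnorm_scv k v : vnorm (scv k v) = cmod k * vnorm v.
Proof.
rewrite /vnorm /scv /= !cmodM !exprMn -mulrDr sqrtrM ?sqr_ge0 //.
by rewrite sqrtr_sqr ger0_norm // cmod_ge0.
Qed.

Lemma vnorm_ge v : cmod v.1 <= vnorm v /\ cmod v.2 <= vnorm v.
Proof.
have h x y : 0 <= x -> x <= Num.sqrt (x ^+ 2 + y ^+ 2) :> R.
  move=> x0; rewrite -[leLHS]ger0_norm // -sqrtr_sqr.
  by rewrite ler_sqrt ?lerDl ?addr_ge0 ?sqr_ge0.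
by rewrite /vnorm; split; [|rewrite addrC]; apply: h; apply: cmod_ge0.
Qed.

Lemma chord_hat z w :
  chord z w = 2 * cmod (wedge (hat z) (hat w)) / (vnorm (hat z) * vnorm (hat w)).
Proof.
have h1 (c : C) : vnorm (c, 1) = Num.sqrt (1 + cmod c ^+ 2).
  by rewrite /vnorm /= cmod1 expr1n addrC.
have h2 : vnorm (1, 0) = 1.
  by rewrite /vnorm /= cmod1 cmod0 expr1n expr0n /= addr0 sqrtr1.
case: z w => [c|] [c'|]; rewrite /chord /hat /wedge ?h1 ?h2 /=.
- by rewrite mulr1 mul1r.
- by rewrite mulr0 mulr1 sub0r cmodN cmod1 !mulr1.
- by rewrite mulr1 mul0r subr0 cmod1 mulr1 mul1r.
- by rewrite mulr0 mul0r subrr cmod0 mulr0 mul0r.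
Qed.

(** The formula is homogeneous of degree 0 in each vector, so distances can be estimated on the
    scaled representatives that converge. *)
Lemma chord_scv k l z w : k != 0 -> l != 0 ->
  chord z w = 2 * cmod (wedge (scv k (hat z)) (scv l (hat w))) /
              (vnorm (scv k (hat z)) * vnorm (scv l (hat w))).
Proof.
rewrite -!cmod_gt0 => k0 l0; rewrite chord_hat wedge_scl wedge_scr !cmodM !vnorm_scv.
have n0 x : 0 < vnorm (hat x).
  have [h1 h2] := vnorm_ge (hat x); have := hat_neq0 x.
  rewrite vec_neq0 -!cmod_gt0 => /orP[h|h].
    exact: lt_le_trans h h1.
  exact: lt_le_trans h h2.
field.
by rewrite !gt_eqF.
Qed.

End HomogeneousCoordinates.

(** * Convergence of points on the sphere and comparison of two moving frames *)

Section ProjectiveLimits.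
Variables (R : realType) (U : set_system nat).
Hypothesis UU : UltraFilter U.
Local Notation C := R[i].
Local Notation vec := (C * C)%type.
Local Open Scope classical_set_scope.

Definition vcv (w : nat -> vec) (v : vec) : Prop :=
  ucv U (fun n => (w n).1) v.1 /\ ucv U (fun n => (w n).2) v.2.

Definition mcv (N : nat -> 'M[C]_2) (B : 'M[C]_2) : Prop :=
  forall i j, ucv U (fun n => N n i j) (B i j).

(** Convergence on the sphere without a special case at infinity: suitable nonzero multiples of the
    representatives converge to the representative of the limit. *)
Definition pcv (u : nat -> Chat R) (r : Chat R) : Prop :=
  exists2 lam : nat -> C, (forall n, lam n != 0) &
    vcv (fun n => scv (lam n) (hat (u n))) (hat r).

Lemma vcv_near w w' v : U [set n | w n = w' n] -> vcv w v -> vcv w' v.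
Proof.
by move=> H [c1 c2]; split; [apply: (ucv_near UU) c1|apply: (ucv_near UU) c2];
  apply: filterS H => n /= ->.
Qed.

Lemma vcv_scv (lam : nat -> C) l w v :
  ucv U lam l -> vcv w v -> vcv (fun n => scv (lam n) (w n)) (scv l v).
Proof. by move=> cl [c1 c2]; split; apply: (ucvM UU). Qed.

Lemma vcv_mulv (N : nat -> 'M[C]_2) B w v :
  mcv N B -> vcv w v -> vcv (fun n => mulv (N n) (w n)) (mulv B v).
Proof. by move=> cN [c1 c2]; split; apply: (ucvD UU); apply: (ucvM UU). Qed.

Lemma ucv_wedge w w' v v' : vcv w v -> vcv w' v' ->
  ucv U (fun n => wedge (w n) (w' n)) (wedge v v').
Proof. by move=> [c1 c2] [c3 c4]; apply: (ucvB UU); apply: (ucvM UU). Qed.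

Lemma vcv_neq0 w v : vcv w v -> v != 0 -> U [set n | w n != 0].
Proof.
move=> [c1 c2]; rewrite vec_neq0 => /orP[h|h].
  by apply: filterS (ucv_neq0 UU c1 h) => n /=; rewrite vec_neq0 => ->.
by apply: filterS (ucv_neq0 UU c2 h) => n /=; rewrite vec_neq0 => ->; rewrite orbT.
Qed.

Lemma pcv_proj w v : vcv w v -> v != 0 -> pcv (fun n => proj (w n)) (proj v).
Proof.
move=> cw v0; have [k k0 hk] := hat_proj v0.
have H n : exists mu : C, mu != 0 /\ (w n != 0 -> scv mu (hat (proj (w n))) = w n).
  have [->|wn0] := eqVneq (w n) 0; first by exists 1; rewrite oner_neq0.
  have [m m0 hm] := hat_proj wn0; exists m^-1; split; rewrite ?invr_eq0 // => _.
  by rewrite hm /scv /= !mulrA mulVf // !mul1r; case: (w n).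
have {}[mu Hmu] := boolp.choice H.
exists (fun n => k * mu n) => [n|]; first by rewrite mulf_neq0 // (Hmu n).1.
rewrite hk; apply: vcv_near (vcv_scv (ucv_cst UU k) cw).
apply: filterS (vcv_neq0 cw v0) => n wn0 /=.
by rewrite -[in LHS]((Hmu n).2 wn0) /scv /= !mulrA.
Qed.

Lemma pcv_near u u' r : U [set n | u n = u' n] -> pcv u r -> pcv u' r.
Proof.
move=> H [lam l0 c]; exists lam => //; apply: vcv_near c.
by apply: filterS H => n /= ->.
Qed.

Lemma pcv_cst r : pcv (fun=> r) r.
Proof.
exists (fun=> 1) => [n|]; first exact: oner_neq0.
by rewrite /vcv /scv /= !mul1r; split; apply: (ucv_cst UU).
Qed.

Lemma pcv_unique u r s : pcv u r -> pcv u s -> r = s.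
Proof.
move=> [l l0 c] [l' l0' c']; apply/eqP; rewrite -wedge_hat.
have := ucv_wedge c c'; have h n : wedge (scv (l n) (hat (u n))) (scv (l' n) (hat (u n))) = 0.
  by rewrite /wedge /scv /=; ring.
have -> : (fun n => wedge (scv (l n) (hat (u n))) (scv (l' n) (hat (u n)))) = fun=> 0.
  by apply/funext.
by move/(ucv_unique UU (ucv_cst UU 0)) => <-.
Qed.

(** Compactness of the sphere: after division by the larger coordinate both coordinates are bounded,
    and one of the limits is 1. *)
Lemma pcv_exists u : exists r, pcv u r.
Proof.
pose c (b : bool) n := if b then (hat (u n)).1 else (hat (u n)).2.
have [|lam [l [b0 [l0 Hl l1]]]] := ultra_normalize UU (u := c).
  apply: filterS filterT => n _; have := hat_neq0 (u n).
  by rewrite vec_neq0 => /orP[h|h]; [exists true|exists false].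
have v0 : (l true, l false) != 0 :> vec.
  by rewrite vec_neq0 /=; case: b0 l1 => ->; rewrite oner_neq0 ?orbT.
exists (proj (l true, l false)).
have cv : vcv (fun n => scv (lam n) (hat (u n))) (l true, l false).
  by split; [have := Hl true|have := Hl false].
apply: pcv_near (pcv_proj cv v0).
by apply: filterS filterT => n _ /=; rewrite proj_scv // hatK.
Qed.

(** [B] may be singular as long as its kernel misses the limit point; the collapsing case of
    [frame_dichotomy] rests on this. *)
Lemma pcv_mob (N : nat -> 'M[C]_2) B u r :
  mcv N B -> pcv u r -> mulv B (hat r) != 0 ->
  pcv (fun n => mob (N n) (u n)) (mob B r).
Proof.
move=> cN [lam l0 c] h; rewrite mobE; apply: pcv_near (pcv_proj (vcv_mulv cN c) h).
by apply: filterS filterT => n _ /=; rewrite mulv_scv proj_scv // mobE.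
Qed.

(** One coordinate of [hat r] equals 1, so that coordinate of the scaled vector is eventually at
    least 1/2 in modulus. *)
Lemma pcv_vnorm u r lam : vcv (fun n => scv (lam n) (hat (u n))) (hat r) ->
  U [set n | 2^-1 <= vnorm (scv (lam n) (hat (u n)))].
Proof.
have key (c : nat -> C) : ucv U c 1 -> U [set n | 2^-1 <= cmod (c n)].
  move=> /(_ 2^-1); rewrite invr_gt0 ltr0n => /(_ isT); apply: filterS => n /= h.
  have := cmodD (1 - c n) (c n); rewrite subrK cmod1 -cmodN opprB => h2.
  by move: h h2; lra.
case: r => [c|] [c1 c2].
  apply: filterS (key _ c2) => n h; apply: le_trans h _.
  by have [] := vnorm_ge (scv (lam n) (hat (u n))).
apply: filterS (key _ c1) => n h; apply: le_trans h _.
by have [] := vnorm_ge (scv (lam n) (hat (u n))).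
Qed.

Lemma pcv_chord u u' r : pcv u r -> pcv u' r ->
  forall e : R, 0 < e -> U [set n | chord (u n) (u' n) < e].
Proof.
move=> [l l0 c] [l' l0' c'] e e0.
have := ucv_wedge c c'; rewrite [X in ucv _ _ X](_ : _ = 0); last by rewrite /wedge; ring.
(* Both norms are at least 1/2 along [U], so the chord is at most 8 times the modulus of the
   determinant. *)
have e8 : 0 < e / 8 by rewrite divr_gt0.
move=> /(_ _ e8) h; apply: filterS3 (pcv_vnorm c) (pcv_vnorm c') h => n /=.
rewrite subr0 (chord_scv (u n) (u' n) (l0 n) (l0' n)).
set a := vnorm _; set b := vnorm _; set w := cmod _ => ha hb hw.
have ab : 4^-1 <= a * b.
  by rewrite (_ : 4^-1 = 2^-1 * 2^-1); [apply: ler_pM; rewrite ?invr_ge0|field].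
rewrite ltr_pdivrMr; last by apply: lt_le_trans ab; rewrite invr_gt0.
by nra.
Qed.

(* Two frames either agree up to a bounded change of coordinates, or each collapses
   everything but one direction of the other. *)
Lemma frame_dichotomy (phi psi : nat -> 'M[C]_2) :
  U [set n | phi n \in unitmx] -> U [set n | psi n \in unitmx] ->
  (exists (lam : nat -> C) (B : 'M[C]_2),
     [/\ forall n, lam n != 0, B \in unitmx,
         mcv (fun n => lam n *: (phi n *m invmx (psi n))) B &
         forall u al be, pcv (fun n => mob (psi n) (u n)) al ->
           pcv (fun n => mob (phi n) (u n)) be -> be = mob B al])
  \/ (exists ka io : Chat R, forall u al be, pcv (fun n => mob (psi n) (u n)) al ->
        pcv (fun n => mob (phi n) (u n)) be -> al = ka \/ be = io).
Proof.
move=> Hphi Hpsi; pose N n := phi n *m invmx (psi n).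
have Nu : U [set n | N n \in unitmx].
  by apply: filterS2 Hphi Hpsi => n /= h1 h2; rewrite unitmx_mul h1 unitmx_inv.
pose c (ij : 'I_2 * 'I_2) n := N n ij.1 ij.2.
have [|lam [l [ij0 [l0 Hl l1]]]] := ultra_normalize UU (u := c).
  apply: filterS Nu => n /= h; apply: contrapT => /forallNP h0.
  have Nz : N n = 0.
    apply/matrixP => i j; rewrite [RHS]mxE; apply/eqP/negPn/negP; exact: (h0 (i, j)).
  by move: h; rewrite Nz unit2 det0 eqxx.
pose B : 'M[C]_2 := \matrix_(i, j) l (i, j).
have cB : mcv (fun n => lam n *: N n) B.
  move=> i j; rewrite mxE; apply: (ucv_near UU) (Hl (i, j)).
  by apply: filterS filterT => n _; rewrite /mkset [RHS]mxE.
have key u al be : pcv (fun n => mob (psi n) (u n)) al ->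
    pcv (fun n => mob (phi n) (u n)) be -> mulv B (hat al) != 0 -> be = mob B al.
  move=> ca cb h; apply: pcv_unique cb _; apply: pcv_near (pcv_mob cB ca h).
  apply: filterS Hpsi => n /= hn; rewrite mob_scale // /N mobM ?unitmx_inv //.
  by rewrite mobK.
have [Bu|Bn] := boolP (B \in unitmx).
  left; exists lam, B; split => // u al be ca cb.
  by apply: key ca cb _; rewrite mulv_neq0 // hat_neq0.
(* A nonzero singular limit has rank one: below, [(- b, a)] spans its kernel, read off from the
   nonzero row [p], and [mulv B v0], its nonzero column [q], spans its image. *)
right; move: Bn; rewrite unit2 negbK => /eqP dB.
have B0 : B ij0.1 ij0.2 != 0 by rewrite mxE -surjective_pairing l1 oner_neq0.
move: B0; set p := ij0.1; set q := ij0.2 => B0.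
pose a := B p i0; pose b := B p i1.
have ab0 : (- b, a) != 0 :> vec.
  rewrite vec_neq0 /= oppr_eq0; move: B0; rewrite /a /b.
  by case: (ord2P q) => -> ->; rewrite ?orbT.
pose v0 : vec := if q == i0 then (1, 0) else (0, 1).
have Bv0 : mulv B v0 != 0.
  rewrite vec_neq0 /v0; move: B0.
  by case: (ord2P p) => ->; case: (ord2P q) => -> h /=;
    rewrite ?mulr1 ?mulr0 ?addr0 ?add0r h ?orbT.
exists (proj (- b, a)), (proj (mulv B v0)) => u al be ca cb.
have [Bal|Bal] := eqVneq (mulv B (hat al)) 0.
  left; apply/eqP; rewrite -[al]hatK -wedge_proj ?hat_neq0 // /wedge /=.
  have : a * (hat al).1 + b * (hat al).2 = 0.
    move/eqP: Bal; rewrite /mulv xpair_eqE => /andP[/eqP h1 /eqP h2].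
    by rewrite /a /b; case: (ord2P p) => ->.
  by rewrite mulrN opprK mulrC [_ * b]mulrC => ->.
right; rewrite (key _ _ _ ca cb Bal) mobE; apply/eqP.
by rewrite -wedge_proj // wedge_mulv dB mul0r.
Qed.

End ProjectiveLimits.

(** * Binary forms *)

Section BinaryForms.
Variable R : realType.
Local Notation C := R[i].
Local Notation vec := (C * C)%type.
Implicit Types (N : nat) (p q : {poly C}) (v : vec) (k : C) (a r : Chat R).

(* A polynomial of size at most N+1 stands for a binary form of degree N; hev N evaluates
   that form, and fmul N p a is the order of vanishing of the form at the point a. *)
Definition hev N p v : C := \sum_(i < N.+1) p`_i * v.1 ^+ i * v.2 ^+ (N - i).

(** The linear form vanishing at [r], dehomogenized. For [r = None] it is the constant -1, which as
    a form of degree 1 vanishes at infinity. *)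
Definition lin r : {poly C} := (hat r).2 *: 'X - (hat r).1%:P.

Definition fmul N p a : nat :=
  if a is Some x then mup x p else (N - (size p).-1)%N.

Lemma hevD N p q v : hev N (p + q) v = hev N p v + hev N q v.
Proof. by rewrite /hev -big_split; apply: eq_bigr => i _; rewrite coefD !mulrDl. Qed.

Lemma hevZ N k p v : hev N (k *: p) v = k * hev N p v.
Proof. by rewrite /hev mulr_sumr; apply: eq_bigr => i _; rewrite coefZ !mulrA. Qed.

Lemma hevN N p v : hev N (- p) v = - hev N p v.
Proof. by rewrite -scaleN1r hevZ mulN1r. Qed.

Lemma hev_sum N I (s : seq I) (P : pred I) (F : I -> {poly C}) v :
  hev N (\sum_(i <- s | P i) F i) v = \sum_(i <- s | P i) hev N (F i) v.
Proof.
elim/big_rec2: _ => [|i x y _ <-]; last by rewrite hevD.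
by rewrite /hev big1 // => i _; rewrite coef0 !mul0r.
Qed.

Lemma hev_scv N p k v : hev N p (scv k v) = k ^+ N * hev N p v.
Proof.
rewrite /hev mulr_sumr; apply: eq_bigr => i _ /=.
have iN : (i <= N)%N by rewrite -ltnS.
have -> : k ^+ N = k ^+ i * k ^+ (N - i) by rewrite -exprD subnKC.
by rewrite !exprMn; ring.
Qed.

Lemma hev_fin N p x : (size p <= N.+1)%N -> hev N p (x, 1) = p.[x].
Proof.
move=> sp; rewrite (horner_coef_wide _ sp); apply: eq_bigr => i _ /=.
by rewrite expr1n mulr1.
Qed.

Lemma hev_inf N p x : hev N p (x, 0) = p`_N * x ^+ N.
Proof.
rewrite /hev big_ord_recr /= subnn expr0 mulr1 big1 ?add0r // => i _.
by rewrite expr0n subn_eq0 leqNgt ltn_ord /= mulr0.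
Qed.

Lemma hev_nz N p x y : (size p <= N.+1)%N -> y != 0 -> hev N p (x, y) = y ^+ N * p.[x / y].
Proof.
move=> sp y0; rewrite -(hev_fin _ sp) -hev_scv /scv /=.
by rewrite mulr1 mulrC divfK.
Qed.

Lemma size_formM N N' p q : (size p <= N.+1)%N -> (size q <= N'.+1)%N ->
  (size (p * q)%R <= (N + N').+1)%N.
Proof. by move=> sp sq; apply: leq_trans (size_polyMleq _ _) _; move: sp sq; lia. Qed.

Lemma hevM N N' p q v : (size p <= N.+1)%N -> (size q <= N'.+1)%N ->
  hev (N + N')%N (p * q) v = hev N p v * hev N' q v.
Proof.
move=> sp sq; case: v => x y; have [->|y0] := eqVneq y 0; last first.
  by rewrite !hev_nz ?size_formM // hornerM exprD; ring.
rewrite !hev_inf exprD [RHS]mulrACA; congr (_ * _).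
have hN : (N < (N + N').+1)%N by rewrite ltnS leq_addr.
rewrite coefM (bigD1 (Ordinal hN)) //= addKn big1 ?addr0 // => i.
rewrite -val_eqE /= neq_ltn => /orP[h|h].
  rewrite [X in _ * X]nth_default ?mulr0 //; apply: leq_trans sq _.
  by rewrite ltn_subRL ltn_add2r.
by rewrite [X in X * _]nth_default ?mul0r //; apply: leq_trans sp _.
Qed.

Lemma size_formX n p : (size p <= 2)%N -> (size (p ^+ n)%R <= n.+1)%N.
Proof.
move=> sp; elim: n => [|n IH]; first by rewrite expr0 size_poly1.
by rewrite exprS; exact: (@size_formM 1 n p (p ^+ n)).
Qed.

Lemma hevX n p v : (size p <= 2)%N -> hev n (p ^+ n) v = hev 1 p v ^+ n.
Proof.
move=> sp; elim: n => [|n IH].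
  by rewrite !expr0 /hev big_ord1 coef1 /= !mulr1.
by rewrite !exprS -add1n hevM ?IH ?size_formX.
Qed.

Lemma poly_ext p q : (forall x, p.[x] = q.[x]) -> p = q.
Proof.
move=> H; apply/eqP; rewrite -subr_eq0; apply/negPn/negP => pq0.
have := max_poly_roots pq0 (rs := [seq n%:R | n <- iota 0 (size (p - q)).+1]).
rewrite size_map size_iota ltnNge leqnSn => /(_ _ _)/negP; apply => //.
  by apply/allP => x _; rewrite rootE hornerD hornerN H subrr.
rewrite map_inj_uniq ?iota_uniq // => m n /eqP.
by rewrite eqr_nat => /eqP.
Qed.

Lemma hev_inj N p q : (size p <= N.+1)%N -> (size q <= N.+1)%N ->
  (forall v, hev N p v = hev N q v) -> p = q.
Proof. by move=> sp sq H; apply: poly_ext => x; rewrite -(hev_fin _ sp) H hev_fin. Qed.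

Lemma size_lin r : (size (lin r) <= 2)%N.
Proof.
rewrite /lin (leq_trans (size_polyD _ _)) // geq_max size_polyN.
by rewrite (leq_trans (size_scale_leq _ _)) ?size_polyX //= (leq_trans (size_polyC_leq1 _)).
Qed.

Lemma hev_lin r v : hev 1 (lin r) v = wedge v (hat r).
Proof.
rewrite /hev !big_ord_recl big_ord0 /lin /wedge /= !(coefB, coefZ, coefX, coefC) /=.
by ring.
Qed.

Lemma lin_fin x : lin (Some x) = 'X - x%:P.
Proof. by rewrite /lin /= scale1r. Qed.

Lemma lin_inf : lin None = - 1.
Proof. by rewrite /lin /= scale0r sub0r. Qed.

Lemma lin_neq0 r : lin r != 0.
Proof. by case: r => [x|]; rewrite ?lin_fin ?polyXsubC_eq0 // lin_inf oppr_eq0 oner_neq0. Qed.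

Lemma fmulM N N' p q a : p != 0 -> q != 0 ->
  (size p <= N.+1)%N -> (size q <= N'.+1)%N ->
  fmul (N + N')%N (p * q) a = (fmul N p a + fmul N' q a)%N.
Proof.
move=> p0 q0 sp sq; case: a => [x|] /=; first exact: mupM.
rewrite size_mul //; move: p0 q0; rewrite -!size_poly_gt0; move: sp sq.
by set m := size p; set n := size q; lia.
Qed.

Lemma fmulC N k a : k != 0 -> fmul N k%:P a = if a == None then N else 0%N.
Proof.
move=> k0; case: a => [x|] /=; last by rewrite size_polyC k0 subn0.
by apply: mupNroot; rewrite rootC.
Qed.

Lemma fmulZ N k p a : k != 0 -> fmul N (k *: p) a = fmul N p a.
Proof.
move=> k0; case: a => [x|] /=; last by rewrite size_scale.
by rewrite -mul_polyC; apply: mupMr; rewrite rootC.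
Qed.

Lemma fmul_lin r a : fmul 1 (lin r) a = (r == a) :> nat.
Proof.
case: r => [y|]; last first.
  rewrite lin_inf -polyCN fmulC ?oppr_eq0 ?oner_neq0 // eq_sym.
  by case: (_ == _).
rewrite lin_fin; case: a => [x|] /=; last by rewrite size_XsubC.
have := @mup_XsubCX C 1 x y; rewrite expr1 => ->.
by rewrite -(inj_eq Some_inj) eq_sym; case: (_ == _).
Qed.

Lemma fmulX m r a : fmul m (lin r ^+ m) a = if r == a then m else 0%N.
Proof.
elim: m => [|m IH].
  rewrite expr0 -[1]/(1%:P) fmulC ?oner_neq0 //.
  by case: ifP; case: ifP.
rewrite exprS -add1n fmulM ?expf_neq0 ?lin_neq0 ?size_lin ?size_formX ?size_lin //.
by rewrite IH fmul_lin; case: ifP.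
Qed.

Section Products.
Variables (I : Type) (r : I -> Chat R) (m : I -> nat).
Implicit Types (s : seq I) (P : pred I).

Lemma dprod_neq0 s P : \prod_(i <- s | P i) lin (r i) ^+ m i != 0.
Proof.
apply: (big_ind (fun x => x != 0)) => [|x y x0 y0|i _]; first exact: oner_neq0.
  exact: mulf_neq0.
by rewrite expf_neq0 ?lin_neq0.
Qed.

Lemma size_dprod s P :
  (size (\prod_(i <- s | P i) lin (r i) ^+ m i)%R
     <= (\sum_(i <- s | P i) m i).+1)%N.
Proof.
elim/big_rec2: _ => [|i x y _ h]; first by rewrite size_poly1.
by apply: size_formM => //; apply: size_formX (size_lin _).
Qed.

Lemma hev_dprod s P v :
  hev (\sum_(i <- s | P i) m i)%N (\prod_(i <- s | P i) lin (r i) ^+ m i) v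
  = \prod_(i <- s | P i) wedge v (hat (r i)) ^+ m i.
Proof.
elim: s => [|i s IH]; first by rewrite !big_nil /hev big_ord1 coef1 /= !mulr1.
rewrite !big_cons; case: ifP => // Pi.
by rewrite hevM ?size_dprod ?size_formX ?size_lin // hevX ?size_lin // hev_lin IH.
Qed.

Lemma fmul_dprod s P a :
  fmul (\sum_(i <- s | P i) m i)%N (\prod_(i <- s | P i) lin (r i) ^+ m i) a
  = (\sum_(i <- s | P i && (r i == a)) m i)%N.
Proof.
elim: s => [|i s IH].
  by rewrite !big_nil -[1]/(1%:P) fmulC ?oner_neq0 //; case: ifP.
rewrite !big_cons; case: ifP => //= Pi.
rewrite fmulM ?dprod_neq0 ?expf_neq0 ?lin_neq0 ?size_dprod ?size_formX ?size_lin //.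
by rewrite fmulX IH; case: ifP.
Qed.

End Products.

Lemma fmul_eq0 N p a : p != 0 -> (size p <= N.+1)%N ->
  (fmul N p a == 0%N) = (hev N p (hat a) != 0).
Proof.
move=> p0 sp; case: a => [x|] /=.
  by rewrite hev_fin // -[LHS]negbK -lt0n -XsubC_dvd // dvdp_XsubCl rootE.
rewrite hev_inf expr1n mulr1 subn_eq0; apply/idP/idP => h.
  have -> : N = (size p).-1.
    by apply/eqP; rewrite eqn_leq h -ltnS prednK ?size_poly_gt0.
  by rewrite -lead_coefE lead_coef_eq0.
by rewrite -ltnS prednK ?size_poly_gt0 // ltnNge; apply: contra h => /leq_sizeP->.
Qed.

Lemma form_factor N p : p != 0 -> (size p <= N.+1)%N ->
  exists (s : seq (Chat R)) (k : C),
    [/\ size s = N, k != 0 & p = k *: \prod_(r <- s) lin r].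
Proof.
move=> p0 sp; have [t Dp] := closed_field_poly_normal p.
have lp0 : lead_coef p != 0 by rewrite lead_coef_eq0.
have st : size p = (size t).+1.
  by rewrite Dp size_scale // size_prod_XsubC.
(* The missing degree is the multiplicity of the root at infinity; each factor [lin None] is -1,
   whence the sign in the constant. *)
pose j := (N - size t)%N.
exists (map Some t ++ nseq j None), (lead_coef p * (-1) ^+ j); split.
- by rewrite size_cat size_map size_nseq /j subnKC // -ltnS -st.
- by rewrite mulf_neq0 // signr_eq0.
rewrite big_cat big_map /= big_nseq iter_mulr_1 lin_inf.
under eq_bigr do rewrite lin_fin.
have -> : (- 1) ^+ j = ((- 1) ^+ j)%:P :> {poly C} by rewrite rmorphXn rmorphN1.
by rewrite [_ * _%:P]mulrC mul_polyC scalerA -mulrA -expr2 sqrr_sign mulr1.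
Qed.

(** Sorting the linear factors by their root gives both claims; points of [L] that are not zeros
    contribute exponent 0. *)
Lemma form_div N p (L : seq (Chat R)) : p != 0 -> (size p <= N.+1)%N -> uniq L ->
  (forall a, (0 < fmul N p a)%N -> a \in L) ->
  (\sum_(a <- L) fmul N p a)%N = N /\
  exists2 k, k != 0 & p = k *: \prod_(a <- L) lin a ^+ fmul N p a.
Proof.
move=> p0 sp uL HL; have [s [k [ss k0 Dp]]] := form_factor p0 sp.
have cnt a : fmul N p a = count_mem a s.
  have := @fmul_dprod _ id (fun=> 1%N) s xpredT a.
  rewrite !sum1_count count_predT ss /= => <-.
  by rewrite Dp fmulZ.
have sL a : a \in s -> a \in L.
  by move=> ain; apply: HL; rewrite cnt -has_count; apply/hasP; exists a => //=.
have perm : perm_eq (undup s) [seq a <- L | a \in s].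
  apply: uniq_perm; rewrite ?undup_uniq ?filter_uniq // => a.
  by rewrite mem_undup mem_filter; case: (boolP (a \in s)) => // /sL ->.
split.
  under eq_bigr do rewrite cnt.
  rewrite -ss -[in RHS]count_predT -sum1_count.
  rewrite (bigID (mem s)) /= [X in (_ + X)%N]big1 => [|a /count_memPn] //.
  rewrite addn0 -big_filter -(perm_big _ perm) /=.
  rewrite -[RHS]big_undup_iterop_count /=.
  by apply: eq_bigr => a _; rewrite Monoid.iteropE iter_addn_0 mul1n.
exists k => //; rewrite {1}Dp; congr (_ *: _).
rewrite [RHS](bigID (mem s)) /= [X in _ * X]big1 => [|a]; last first.
  by rewrite cnt => /count_memPn->; rewrite expr0.
rewrite mulr1 -[RHS]big_filter -[RHS](perm_big _ perm) /=.
rewrite -prodr_undup_exp_count; apply: eq_bigr => a _.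
by rewrite cnt.
Qed.

Definition pull N (A : 'M[C]_2) p : {poly C} :=
  \sum_(i < N.+1) p`_i *:
    ((A i0 i0 *: 'X + (A i0 i1)%:P) ^+ i * (A i1 i0 *: 'X + (A i1 i1)%:P) ^+ (N - i)).

Lemma size_affine (a b : C) : (size (a *: 'X + b%:P)%R <= 2)%N.
Proof.
rewrite (leq_trans (size_polyD _ _)) // geq_max.
by rewrite (leq_trans (size_scale_leq _ _)) ?size_polyX //= (leq_trans (size_polyC_leq1 _)).
Qed.

Lemma size_pull N A p : (size (pull N A p) <= N.+1)%N.
Proof.
rewrite (leq_trans (size_sum _ _ _)) //; apply/bigmax_leqP => i _.
rewrite (leq_trans (size_scale_leq _ _)) //.
rewrite -[X in (_ <= X.+1)%N](subnKC (ltn_ord i : (i <= N)%N)).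
by apply: size_formM; apply: size_formX; apply: size_affine.
Qed.

Lemma hev_pull N A p v : hev N (pull N A p) v = hev N p (mulv A v).
Proof.
rewrite hev_sum {2}/hev; apply: eq_bigr => i _; rewrite hevZ -mulrA; congr (_ * _).
have hA (a b : C) : hev 1 (a *: 'X + b%:P) v = a * v.1 + b * v.2.
  rewrite /hev !big_ord_recl big_ord0 /= !(coefD, coefZ, coefX, coefC) /=; ring.
rewrite -{1}(subnKC (ltn_ord i : (i <= N)%N)) hevM ?size_formX ?size_affine //.
by rewrite (hevX i _ (size_affine _ _)) (hevX (N - i) _ (size_affine _ _)) !hA.
Qed.

Lemma pullD N A p q : pull N A (p + q) = pull N A p + pull N A q.
Proof. by apply: (@hev_inj N) => [||v]; rewrite ?size_formD ?size_pull //
  ?(leq_trans (size_polyD _ _)) ?geq_max ?size_pull // !(hevD, hev_pull). Qed.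

Lemma pullZ N A k p : pull N A (k *: p) = k *: pull N A p.
Proof.
by rewrite /pull scaler_sumr; apply: eq_bigr => i _; rewrite coefZ scalerA.
Qed.

(** With [r] written as the image under [A] of its preimage, the determinant of two images is
    [\det A] times that of the vectors. *)
Lemma wedge_mulv_hat (A : 'M[C]_2) r : A \in unitmx ->
  exists2 c : C, c != 0 &
    forall v, wedge (mulv A v) (hat r) = c * wedge v (hat (mob (invmx A) r)).
Proof.
move=> Au; have [|k k0 hk] := hat_proj (v := mulv (invmx A) (hat r)).
  by rewrite mulv_neq0 ?unitmx_inv ?hat_neq0.
exists (\det A / k) => [|v]; first by rewrite mulf_neq0 ?invr_eq0 // -unit2.
rewrite mobE hk wedge_scr mulrA divfK //.
by rewrite -wedge_mulv -mulvM mulmxV // mulv1.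
Qed.

Lemma pull_dprod I (s : seq I) (P : pred I) (r : I -> Chat R) (m : I -> nat) N A k :
  A \in unitmx -> (\sum_(i <- s | P i) m i)%N = N -> k != 0 ->
  exists2 k', k' != 0 &
    pull N A (k *: \prod_(i <- s | P i) lin (r i) ^+ m i)
    = k' *: \prod_(i <- s | P i) lin (mob (invmx A) (r i)) ^+ m i.
Proof.
move=> Au Ns k0.
have H i : exists c : C, c != 0 /\
    forall v, wedge (mulv A v) (hat (r i)) = c * wedge v (hat (mob (invmx A) (r i))).
  by have [c c0 hc] := wedge_mulv_hat (r i) Au; exists c.
have [c Hc] := boolp.choice H.
exists (k * \prod_(i <- s | P i) c i ^+ m i).
  rewrite mulf_neq0 //; apply: (big_ind (fun x => x != 0)) => [|x y x0 y0|i _].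
  - exact: oner_neq0.
  - exact: mulf_neq0.
  - by rewrite expf_neq0 // (Hc i).1.
apply: (@hev_inj N) => [||v]; first exact: size_pull.
  by rewrite (leq_trans (size_scale_leq _ _)) // -Ns size_dprod.
rewrite hev_pull !hevZ -Ns !hev_dprod -mulrA -big_split /=; congr (_ * _).
by apply: eq_bigr => i _; rewrite (Hc i).2 exprMn.
Qed.

Lemma fmul_pull N A p a : A \in unitmx -> p != 0 -> (size p <= N.+1)%N ->
  fmul N (pull N A p) a = fmul N p (mob A a).
Proof.
move=> Au p0 sp; have [s [k [ss k0 Dp]]] := form_factor p0 sp.
have sN : (\sum_(i <- s) 1)%N = N by rewrite sum1_size.
have [k' k'0 H] := pull_dprod (m := fun=> 1%N) id Au sN k0.
rewrite Dp {1}H !fmulZ // -sN !fmul_dprod; apply: eq_bigl => r /=.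
by apply/eqP/eqP => [<-|->]; rewrite ?mobVK ?mobK.
Qed.

Lemma pull_neq0 N A p : A \in unitmx -> p != 0 -> (size p <= N.+1)%N -> pull N A p != 0.
Proof.
move=> Au p0 sp; have [s [k [ss k0 Dp]]] := form_factor p0 sp.
have sN : (\sum_(i <- s) 1)%N = N by rewrite sum1_size.
have [k' k'0 H] := pull_dprod (m := fun=> 1%N) id Au sN k0.
by rewrite Dp H scaler_eq0 negb_or k'0 dprod_neq0.
Qed.

End BinaryForms.

(** * Rational maps as pairs of forms *)

Section RationalMaps.
Variable R : realType.
Local Notation C := R[i].
Local Notation vec := (C * C)%type.
Implicit Types (f : ratmap R) (p q : {poly C}) (u v : vec) (a c z : Chat R).

(** The homogeneous lift of [f] to a self-map of the plane; for [is_rat f] it vanishes at the origin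
    only. *)
Definition fpair f v : vec := (hev (rdeg f) (rnum f) v, hev (rdeg f) (rden f) v).

Lemma size_rnum f : (size (rnum f) <= (rdeg f).+1)%N.
Proof. by rewrite /rdeg; set m := maxn _ _; rewrite (leq_trans (leq_maxl _ (size (rden f)))) // leqSpred. Qed.

Lemma size_rden f : (size (rden f) <= (rdeg f).+1)%N.
Proof. by rewrite /rdeg; set m := maxn _ _; rewrite (leq_trans (leq_maxr (size (rnum f)) _)) // leqSpred. Qed.

Lemma fpair_scv f k v : fpair f (scv k v) = scv (k ^+ rdeg f) (fpair f v).
Proof. by rewrite /fpair !hev_scv. Qed.

Lemma fpair_hat_neq0 f z : is_rat f -> fpair f (hat z) != 0.
Proof.
move=> [cop nz]; rewrite vec_neq0 /fpair /=; case: z => [x|] /=.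
  rewrite !hev_fin ?size_rnum ?size_rden //.
  have [r0|] := boolP (root (rnum f) x); last by rewrite rootE => ->.
  by apply/orP; right; exact: coprimep_root cop r0.
rewrite !hev_inf !expr1n !mulr1.
have key p : p != 0 -> size p = (rdeg f).+1 -> p`_(rdeg f) != 0.
  move=> p0 h; have -> : rdeg f = (size p).-1 by rewrite h.
  by rewrite -lead_coefE lead_coef_eq0.
have m0 : (0 < maxn (size (rnum f)) (size (rden f)))%N.
  by rewrite leq_max !size_poly_gt0; apply/orP.
have : (maxn (size (rnum f)) (size (rden f)) = (rdeg f).+1)%N by rewrite /rdeg prednK.
rewrite /maxn; case: ifP => _ h.
  by rewrite [X in _ || X]key ?orbT // -size_poly_gt0 h.
by rewrite key // -size_poly_gt0 h.
Qed.

Lemma fpair_neq0 f v : is_rat f -> v != 0 -> fpair f v != 0.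
Proof.
move=> rf v0; have [k k0 hk] := hat_proj v0.
have := fpair_hat_neq0 (proj v) rf; rewrite hk fpair_scv scv_neq0 //.
by rewrite expf_neq0.
Qed.

Lemma evE f z : is_rat f -> ev f z = proj (fpair f (hat z)).
Proof.
move=> rf; have := fpair_hat_neq0 z rf; rewrite /proj vec_neq0 /fpair /ev.
case: z => [x|] /=; first by rewrite !hev_fin ?size_rnum ?size_rden.
rewrite !hev_inf !expr1n !mulr1.
have sn := size_rnum f; have sd := size_rden f.
have mx : rdeg f = (maxn (size (rnum f)) (size (rden f))).-1 by [].
have [h|h|h] := ltngtP (size (rden f)) (size (rnum f)).
- have -> : (rden f)`_(rdeg f) = 0.
    by apply: nth_default; move: h; rewrite mx; move: (size _) (size _) => m n; rewrite /maxn; case: ifP; lia.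
  by rewrite eqxx.
- have -> : (rnum f)`_(rdeg f) = 0.
    by apply: nth_default; move: h; rewrite mx; move: (size _) (size _) => m n; rewrite /maxn; case: ifP; lia.
  by rewrite eqxx /= => ->; rewrite mul0r.
- have e1 : rdeg f = (size (rnum f)).-1 by rewrite mx h maxnn.
  have e2 : rdeg f = (size (rden f)).-1 by rewrite mx h maxnn.
  have d0 : rden f != 0.
    by case: rf.2 => // n0; rewrite -size_poly_gt0 h size_poly_gt0.
  have -> : (rden f)`_(rdeg f) = lead_coef (rden f) by rewrite lead_coefE -e2.
  have -> : (rnum f)`_(rdeg f) = lead_coef (rnum f) by rewrite lead_coefE -e1.
  by rewrite [lead_coef (rden f) == 0]lead_coef_eq0 d0.
Qed.

(** Nonvanishing at the vectors [(x, 1)] is coprimality, and at [(1, 0)] it says that the degree is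
    exactly [d]. *)
Lemma nondeg_rat d p q : (size p <= d.+1)%N -> (size q <= d.+1)%N ->
  (forall v, v != 0 -> (hev d p v, hev d q v) != 0 :> vec) ->
  is_rat (RatMap p q) /\ rdeg (RatMap p q) = d.
Proof.
move=> sp sq H; split; [split|].
- apply/Pdiv.ClosedField.coprimepP => x /rootP px; apply/eqP => qx.
  rewrite /= in px qx.
  by have := H (x, 1); rewrite !vec_neq0 /= !hev_fin // px qx eqxx oner_neq0 orbT => /(_ isT).
- have := H (1, 0); rewrite !vec_neq0 /= !hev_inf oner_neq0 => /(_ isT)/orP[h|h].
    by left; apply: contraNneq h => ->; rewrite coef0 mul0r.
  by right; apply: contraNneq h => ->; rewrite coef0 mul0r.
- rewrite /rdeg /=; have := H (1, 0); rewrite !vec_neq0 /= !hev_inf oner_neq0 !expr1n !mulr1.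
  have key (r : {poly C}) : r`_d != 0 -> (d < size r)%N.
    by move=> h; rewrite ltnNge; apply: contra h => /leq_sizeP->.
  move=> /(_ isT)/orP[/key h|/key h]; move: h sp sq; move: (size p) (size q) => m n;
    rewrite /maxn; case: ifP; lia.
Qed.

(** The form whose zeros are the fibre of [f] over the point named by [u]. *)
Definition pw u f : {poly C} := u.1 *: rden f - u.2 *: rnum f.

Lemma size_pw u f : (size (pw u f) <= (rdeg f).+1)%N.
Proof.
rewrite (leq_trans (size_polyD _ _)) // geq_max size_polyN.
by rewrite !(leq_trans (size_scale_leq _ _)) ?size_rden ?size_rnum.
Qed.

Lemma hev_pw u f v : hev (rdeg f) (pw u f) v = wedge u (fpair f v).
Proof. by rewrite hevD hevN !hevZ /wedge /fpair. Qed.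

Lemma form_root d p : (0 < d)%N -> p != 0 -> (size p <= d.+1)%N ->
  exists a, hev d p (hat a) = 0.
Proof.
move=> d0 p0 sp; have [s [k [ss k0 Dp]]] := form_factor p0 sp.
case: s ss Dp => [h|r s ss Dp]; first by rewrite -h in d0.
exists r; apply/eqP; rewrite -[_ == 0]negbK -fmul_eq0 // Dp fmulZ //.
have := @fmul_dprod _ _ id (fun=> 1%N) (r :: s) xpredT r.
by rewrite sum1_size ss => ->; rewrite big_cons eqxx.
Qed.

(** Were the fibre form identically zero, a zero of the numerator (if [u.1 != 0]) or of the
    denominator (if [u.2 != 0]) would be a common zero of both. *)
Lemma pw_neq0 u f : is_rat f -> (0 < rdeg f)%N -> u != 0 -> pw u f != 0.
Proof.
move=> rf d0 u0; apply/eqP => pw0.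
have W v : wedge u (fpair f v) = 0 by rewrite -hev_pw pw0 /hev big1 // => i _; rewrite coef0 !mul0r.
have key p : (size p <= (rdeg f).+1)%N -> exists a, hev (rdeg f) p (hat a) = 0.
  have [-> _|p0] := eqVneq p 0; last exact: form_root.
  by exists None; rewrite /hev big1 // => i _; rewrite coef0 !mul0r.
have := u0; rewrite vec_neq0 => /orP[u1|u2].
  have [a ha] := key _ (size_rnum f).
  have := fpair_hat_neq0 a rf; rewrite vec_neq0 /fpair /= ha eqxx /= => /negP; apply.
  have := W (hat a); rewrite /wedge /fpair /= ha mulr0 subr0 => /eqP.
  by rewrite mulf_eq0 (negbTE u1).
have [a ha] := key _ (size_rden f).
have := fpair_hat_neq0 a rf; rewrite vec_neq0 /fpair /= ha eqxx orbF => /negP; apply.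
have := W (hat a); rewrite /wedge /fpair /= ha mulr0 sub0r => /eqP.
by rewrite oppr_eq0 mulf_eq0 (negbTE u2).
Qed.

Lemma Rb_pw f c : fmul (rdeg f) (Rb f c) =1 fmul (rdeg f) (pw (hat c) f).
Proof.
move=> a; case: c => [x|]; rewrite /pw /= ?scale1r ?scale0r ?subr0 //.
by rewrite -(@fmulZ _ _ (-1)) ?scaleN1r ?opprB // oppr_eq0 oner_neq0.
Qed.

Lemma local_degE f a : local_deg f a = fmul (rdeg f) (pw (hat (ev f a)) f) a.
Proof. by rewrite -Rb_pw; case: a. Qed.

Lemma fmul_pw f c a : is_rat f -> (0 < rdeg f)%N ->
  fmul (rdeg f) (pw (hat c) f) a = if ev f a == c then local_deg f a else 0%N.
Proof.
move=> rf d0; case: eqP => [<-|ne]; first by rewrite local_degE.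
apply/eqP; rewrite fmul_eq0 ?pw_neq0 ?hat_neq0 ?size_pw // hev_pw.
rewrite wedge_proj ?hat_neq0 ?fpair_hat_neq0 // hatK -evE //.
by apply/eqP => h; apply: ne.
Qed.

Lemma local_deg_gt0 f a : is_rat f -> (0 < rdeg f)%N -> (0 < local_deg f a)%N.
Proof.
move=> rf d0; rewrite lt0n local_degE fmul_eq0 ?pw_neq0 ?hat_neq0 ?size_pw // hev_pw negbK.
by rewrite wedge_proj ?hat_neq0 ?fpair_hat_neq0 // hatK -evE.
Qed.

Lemma local_deg_le f a : is_rat f -> (0 < rdeg f)%N -> (local_deg f a <= rdeg f)%N.
Proof.
move=> rf d0; rewrite local_degE.
have [s [k [ss k0 Dp]]] := form_factor (pw_neq0 rf d0 (hat_neq0 (ev f a))) (size_pw _ _).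
rewrite Dp fmulZ //.
have := @fmul_dprod _ _ id (fun=> 1%N) s xpredT a.
rewrite sum1_size ss => ->.
rewrite -[X in (_ <= X)%N]ss -[X in (_ <= X)%N]sum1_size.
by rewrite [X in (_ <= X)%N](bigID (fun i => i == a)) /= leq_addr.
Qed.

(** The Wronskian; for the numerator and denominator of a map its zeros are the critical points, see
    [fmul_wr]. *)
Definition wrp p q : {poly C} := p^`() * q - p * q^`().

Lemma wrp_fin p q x : p != 0 -> root p x -> ~~ root q x ->
  mup x (wrp p q) = (mup x p - 1)%N.
Proof.
move=> p0 px qx; have [m [w]] := multiplicity_XsubC p x.
rewrite p0 /= => wx Dp.
have m0 : (0 < m)%N.
  by rewrite lt0n; apply: contraNneq wx => m0; move: px; rewrite Dp m0 expr0 mulr1.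
pose l : {poly C} := 'X - x%:P.
pose t := w * q *+ m + l * (w^`() * q - w * q^`()).
have D : wrp p q = l ^+ m.-1 * t.
  rewrite /wrp Dp derivM deriv_exp derivXsubC mul1r /t -/l.
  have -> : l ^+ m = l * l ^+ m.-1 by rewrite -exprS prednK.
  by ring.
have tx : ~~ root t x.
  rewrite rootE /t hornerD hornerM hornerMn hornerM hornerXsubC subrr mul0r addr0.
  by rewrite mulrn_eq0 negb_or -lt0n m0 mulf_neq0.
rewrite D (mupMl _ tx) Dp (mupMr _ wx) /l !mup_XsubCX eqxx.
by rewrite subn1.
Qed.

(** The analogue of [wrp_fin] at infinity. For [p] of degree [n < d] the coefficient of degree
    [n + d - 1] is [n - d] times the leading coefficients, so as a form of degree [2 * d - 2] the
    Wronskian vanishes at infinity to order [d - n - 1], one less than [p] as a form of degree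
    [d]. *)
Lemma wrp_inf d p q : p != 0 -> (size p <= d)%N -> size q = d.+1 ->
  size (wrp p q) = (size p + d).-1.
Proof.
move=> p0 sp sq; have sp0 : (0 < size p)%N by rewrite size_poly_gt0.
have q0 : q != 0 by rewrite -size_poly_gt0 sq.
have d0 : (0 < d)%N by apply: leq_trans sp.
set n := (size p).-1; have Dn : size p = n.+1 by rewrite prednK.
have nd : (n < d)%N by rewrite -Dn.
have spq : (size (p * q^`())%R <= (n + d.-1).+1)%N.
  by apply: size_formM; rewrite ?Dn // prednK // -ltnS -sq lt_size_deriv.
have spq' : (size (p^`() * q)%R <= (n + d.-1).+1)%N.
  have [n0|n0] := posnP n.
    have -> : p^`() = 0 by apply/eqP; rewrite -size_poly_leq0 -ltnS -[1%N]/(0.+1) -n0 -Dn lt_size_deriv.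
    by rewrite mul0r size_poly0.
  have -> : (n + d.-1 = n.-1 + d)%N by move: n0 d0; lia.
  by apply: size_formM; rewrite ?sq // prednK // -ltnS -Dn lt_size_deriv.
have c2 : (p * q^`())`_(n + d.-1) = lead_coef p * (lead_coef q *+ d).
  have := @hevM _ n d.-1 p q^`() (1, 0); rewrite !hev_inf !expr1n !mulr1 => ->.
  - by rewrite coef_deriv prednK // !lead_coefE Dn sq.
  - by rewrite Dn.
  - by rewrite prednK // -ltnS -sq lt_size_deriv.
have c1 : (p^`() * q)`_(n + d.-1) = lead_coef p *+ n * lead_coef q.
  have [n0|n0] := posnP n.
    have -> : p^`() = 0 by apply/eqP; rewrite -size_poly_leq0 -ltnS -[1%N]/(0.+1) -n0 -Dn lt_size_deriv.
    by rewrite mul0r coef0 n0 mulr0n mul0r.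
  have -> : (n + d.-1 = n.-1 + d)%N by move: n0 d0; lia.
  have := @hevM _ n.-1 d p^`() q (1, 0); rewrite !hev_inf !expr1n !mulr1 => ->.
  - by rewrite coef_deriv prednK // !lead_coefE Dn sq.
  - by rewrite prednK // -ltnS -Dn lt_size_deriv.
  - by rewrite sq.
have c0 : (wrp p q)`_(n + d.-1) != 0.
  rewrite coefB c1 c2.
  have -> : lead_coef p *+ n * lead_coef q - lead_coef p * (lead_coef q *+ d) =
            lead_coef p * lead_coef q * - (d - n)%:R.
    by rewrite natrB 1?ltnW //; ring.
  by rewrite !mulf_neq0 ?lead_coef_eq0 // oppr_eq0 pnatr_eq0 subn_eq0 -ltnNge.
have s1 : (size (wrp p q) <= (n + d.-1).+1)%N.
  by rewrite (leq_trans (size_polyD _ _)) // geq_max size_polyN spq spq'.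
have s2 : (n + d.-1 < size (wrp p q))%N.
  by rewrite ltnNge; apply: contra c0 => /leq_sizeP->.
by rewrite Dn; move: s1 s2 d0; lia.
Qed.

Definition wr f : {poly C} := wrp (rnum f) (rden f).

Lemma wrpC p q : wrp q p = - wrp p q.
Proof. by rewrite /wrp; ring. Qed.

(** A change of basis of determinant 1 or -1 alters the Wronskian of a pair by at most a sign. So
    the fibre form over any value [c] can be one member of the pair, the other being nonzero on that
    fibre. *)
Lemma wr_shift f c : exists2 q, wrp (pw (hat c) f) q = - wr f &
  (size q <= (rdeg f).+1)%N /\ forall v, v != 0 -> is_rat f ->
    hev (rdeg f) (pw (hat c) f) v = 0 -> hev (rdeg f) q v != 0.
Proof.
case: c => [x|]; last first.
  exists (rnum f); rewrite ?size_rnum; first by rewrite /pw /= scale1r scale0r subr0 wrpC.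
  split=> // v v0 rf; rewrite /pw /= scale1r scale0r subr0 => h.
  by have := fpair_neq0 rf v0; rewrite vec_neq0 /fpair /= h eqxx orbF.
exists (rden f); rewrite ?size_rden.
  by rewrite /pw /wr /wrp /= scale1r -mul_polyC !derivE; ring.
split=> // v v0 rf; rewrite hev_pw /wedge /fpair /= mul1r => /eqP.
rewrite subr_eq0 => /eqP h; apply/eqP => h2.
have := fpair_neq0 rf v0; rewrite vec_neq0 /fpair /= h2 eqxx orbF -h h2 mulr0.
by rewrite eqxx.
Qed.

(** The evident bound on the degree is [2 * rdeg f - 1]. Taking for one member of the pair the fibre
    form over the value at infinity, which has lower degree, makes [wrp_inf] apply. *)
Lemma wr_form f : is_rat f -> (0 < rdeg f)%N ->
  wr f != 0 /\ (size (wr f) <= (2 * rdeg f - 2).+1)%N.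
Proof.
move=> rf d0; set b := ev f None; have [q Dq [sq Hq]] := wr_shift f b.
have p0 := pw_neq0 rf d0 (hat_neq0 b); have sp := size_pw (hat b) f.
have h0 : hev (rdeg f) (pw (hat b) f) (hat None) = 0.
  apply/eqP; rewrite -[_ == 0]negbK -fmul_eq0 // -local_degE -lt0n.
  exact: local_deg_gt0.
have := Hq _ (hat_neq0 None) rf h0; rewrite /= hev_inf expr1n mulr1 => qd.
have sqd : size q = (rdeg f).+1.
  apply/eqP; rewrite eqn_leq sq ltnNge; apply: contra qd => /leq_sizeP->//.
have spd : (size (pw (hat b) f) <= rdeg f)%N.
  rewrite -ltnS ltn_neqAle sp andbT; apply/eqP => h.
  move/eqP: h0; rewrite /= hev_inf expr1n mulr1.
  have -> : rdeg f = (size (pw (hat b) f)).-1 by rewrite h.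
  by rewrite -lead_coefE lead_coef_eq0 (negbTE p0).
have := wrp_inf p0 spd sqd; rewrite Dq size_polyN => sw.
have sp0 : (0 < size (pw (hat b) f))%N by rewrite size_poly_gt0.
split; first by rewrite -size_poly_gt0 sw; move: sp0 d0; lia.
by rewrite sw; move: spd d0; lia.
Qed.

Lemma fmul_wr f a : is_rat f -> (0 < rdeg f)%N ->
  fmul (2 * rdeg f - 2) (wr f) a = (local_deg f a - 1)%N.
Proof.
move=> rf d0; set b := ev f a; have [q Dq [sq Hq]] := wr_shift f b.
have p0 := pw_neq0 rf d0 (hat_neq0 b); have sp := size_pw (hat b) f.
have h0 : hev (rdeg f) (pw (hat b) f) (hat a) = 0.
  apply/eqP; rewrite -[_ == 0]negbK -fmul_eq0 // -local_degE -lt0n.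
  exact: local_deg_gt0.
have := Hq _ (hat_neq0 a) rf h0; rewrite local_degE -/b.
rewrite -(@fmulZ _ _ (-1) (wr f)) ?oppr_eq0 ?oner_neq0 // scaleN1r -Dq.
case: a @b q Dq sq Hq p0 sp h0 => [x|] b q Dq sq Hq p0 sp h0 /=.
  rewrite hev_fin // => qx; apply: wrp_fin => //.
  by rewrite rootE -(hev_fin _ sp) h0.
rewrite hev_inf expr1n mulr1 => qd.
have sqd : size q = (rdeg f).+1.
  apply/eqP; rewrite eqn_leq sq ltnNge; apply: contra qd => /leq_sizeP->//.
have spd : (size (pw (hat b) f) <= rdeg f)%N.
  rewrite -ltnS ltn_neqAle sp andbT; apply/eqP => h.
  move/eqP: h0; rewrite /= hev_inf expr1n mulr1.
  have -> : rdeg f = (size (pw (hat b) f)).-1 by rewrite h.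
  by rewrite -lead_coefE lead_coef_eq0 (negbTE p0).
rewrite (wrp_inf p0 spd sqd).
have sp0 : (0 < size (pw (hat b) f))%N by rewrite size_poly_gt0.
move: spd sp0 d0 {Dq Hq h0 qd sqd sq sp}; move: (size _) (rdeg f) => m d; lia.
Qed.

(* The map psi o f o A, as a pair of forms. *)
Definition tmap (psi A : 'M[C]_2) f : ratmap R :=
  let P := pull (rdeg f) A (rnum f) in let Q := pull (rdeg f) A (rden f) in
  RatMap (psi i0 i0 *: P + psi i0 i1 *: Q) (psi i1 i0 *: P + psi i1 i1 *: Q).

Lemma size_tmap psi A f : (size (rnum (tmap psi A f)) <= (rdeg f).+1)%N /\
  (size (rden (tmap psi A f)) <= (rdeg f).+1)%N.
Proof.
by split; rewrite (leq_trans (size_polyD _ _)) // geq_max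
  !(leq_trans (size_scale_leq _ _)) ?size_pull.
Qed.

Lemma hev_tmap psi A f v :
  (hev (rdeg f) (rnum (tmap psi A f)) v, hev (rdeg f) (rden (tmap psi A f)) v)
  = mulv psi (fpair f (mulv A v)).
Proof. by rewrite /tmap /= !hevD !hevZ !hev_pull. Qed.

Lemma tmap_rat psi A f : is_rat f -> psi \in unitmx -> A \in unitmx ->
  is_rat (tmap psi A f) /\ rdeg (tmap psi A f) = rdeg f.
Proof.
move=> rf pu Au; have [s1 s2] := size_tmap psi A f.
have := @nondeg_rat (rdeg f) _ _ s1 s2; case: (tmap _ _ _) (hev_tmap psi A f) => P Q /= h.
by apply=> v v0; rewrite h mulv_neq0 // fpair_neq0 // mulv_neq0.
Qed.

Lemma fpair_tmap psi A f v : is_rat f -> psi \in unitmx -> A \in unitmx ->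
  fpair (tmap psi A f) v = mulv psi (fpair f (mulv A v)).
Proof. by move=> rf pu Au; rewrite -hev_tmap /fpair (tmap_rat rf pu Au).2. Qed.

Lemma ev_tmap psi A f z : is_rat f -> psi \in unitmx -> A \in unitmx ->
  ev (tmap psi A f) z = mob psi (ev f (mob A z)).
Proof.
move=> rf pu Au; have [rt _] := tmap_rat rf pu Au.
rewrite [LHS]evE // fpair_tmap //.
have A0 : mulv A (hat z) != 0 by rewrite mulv_neq0 ?hat_neq0.
rewrite -mob_proj ?fpair_neq0 //; congr mob.
rewrite mobE evE //; have [k k0 ->] := hat_proj A0.
by rewrite fpair_scv proj_scv // expf_neq0.
Qed.

Lemma pw_tmap psi A f u : is_rat f -> psi \in unitmx -> A \in unitmx ->
  pw (mulv psi u) (tmap psi A f) = \det psi *: pull (rdeg f) A (pw u f).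
Proof.
move=> rf pu Au; have [rt dt] := tmap_rat rf pu Au.
apply: (@hev_inj _ (rdeg f)) => [||v]; first by rewrite -dt size_pw.
  by rewrite (leq_trans (size_scale_leq _ _)) // size_pull.
by rewrite -{1}dt hev_pw fpair_tmap // wedge_mulv hevZ hev_pull hev_pw.
Qed.

Lemma local_deg_tmap psi A f a : is_rat f -> (0 < rdeg f)%N ->
  psi \in unitmx -> A \in unitmx ->
  local_deg (tmap psi A f) a = local_deg f (mob A a).
Proof.
move=> rf d0 pu Au; have [rt dt] := tmap_rat rf pu Au.
rewrite !local_degE ev_tmap // dt mobE.
have [|k k0 hk] := hat_proj (v := mulv psi (hat (ev f (mob A a)))).
  by rewrite mulv_neq0 ?hat_neq0.
rewrite hk.
have -> : pw (scv k (mulv psi (hat (ev f (mob A a))))) (tmap psi A f) =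
          k *: pw (mulv psi (hat (ev f (mob A a)))) (tmap psi A f).
  by rewrite /pw /scv /= scalerBr !scalerA.
by rewrite pw_tmap // !fmulZ // -?unit2 // fmul_pull // ?pw_neq0 ?hat_neq0 ?size_pw.
Qed.

End RationalMaps.

(** * Marked maps and limits of forms *)

Section CompleteMarkings.
Variable R : realType.
Local Notation C := R[i].
Local Notation vec := (C * C)%type.

(** The last two clauses put the whole fibre over each mark of [Z], and all critical points, among
    the marks of [Y]. The fibre forms and the Wronskian are then determined up to constants by the
    marks and [dg]. *)
Definition complete_marking (d : nat) (Y Z : seq nat) (Fp dg : nat -> nat)
    (f : ratmap R) (y z : nat -> Chat R) : Prop :=
  [/\ is_rat f /\ rdeg f = d,
      {in Y &, injective y} /\ {in Z &, injective z},
      (forall a, a \in Y -> [/\ Fp a \in Z, ev f (y a) = z (Fp a) & local_deg f (y a) = dg a]),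
      (forall x b, b \in Z -> ev f x = z b -> exists2 a, a \in Y & x = y a) &
      (forall x, local_deg f x <> 1%N -> exists2 a, a \in Y & x = y a)].

Variables (d : nat) (Y Z : seq nat) (Fp dg : nat -> nat).
Hypotheses (d0 : (0 < d)%N) (uY : uniq Y).

Lemma complete_marking_tmap f y z psi phi :
  psi \in unitmx -> phi \in unitmx -> complete_marking d Y Z Fp dg f y z ->
  complete_marking d Y Z Fp dg (tmap psi (invmx phi) f)
    (fun a => mob phi (y a)) (fun b => mob psi (z b)).
Proof.
move=> pu hu [[rf df] [yi zi] yz ful crt].
have iu : invmx phi \in unitmx by rewrite unitmx_inv.
have [rt dt] := tmap_rat rf pu iu.
have d0' : (0 < rdeg f)%N by rewrite df.
split.
- by rewrite dt df.
- by split=> [a b aY bY /(mob_inj hu)/(yi _ _ aY bY)|a b aY bY /(mob_inj pu)/(zi _ _ aY bY)].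
- move=> a /yz[h1 h2 h3]; split=> //; first by rewrite ev_tmap // mobK // h2.
  by rewrite local_deg_tmap // mobK.
- move=> x b bZ; rewrite ev_tmap // => /(mob_inj pu)/(ful _ _ bZ)[a aY h].
  by exists a => //; rewrite -h mobVK.
- move=> x; rewrite local_deg_tmap // => /crt[a aY h].
  by exists a => //; rewrite -h mobVK.
Qed.

Section Divisors.
Variables (f : ratmap R) (y z : nat -> Chat R).
Hypothesis mk : complete_marking d Y Z Fp dg f y z.

Lemma marking_fiber b u : b \in Z -> u != 0 -> proj u = z b ->
  (\sum_(a <- Y | Fp a == b) dg a)%N = d /\
  exists2 k, k != 0 & pw u f = k *: \prod_(a <- Y | Fp a == b) lin (y a) ^+ dg a.
Proof.
move: mk => [[rf df] [yi zi] yz ful crt] bZ u0 pu.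
have df0 : (0 < rdeg f)%N by rewrite df.
have [m m0 hm] := hat_proj u0.
have fm a : fmul (rdeg f) (pw u f) a = if ev f a == z b then local_deg f a else 0%N.
  rewrite -fmul_pw // -pu hm -(fmulZ _ _ a m0); congr fmul.
  by rewrite /pw /scv /= scalerBr !scalerA.
pose Yb := [seq a <- Y | Fp a == b].
have uL : uniq [seq y a | a <- Yb].
  rewrite map_inj_in_uniq ?filter_uniq // => a a'; rewrite !mem_filter => /andP[_ h] /andP[_ h'].
  exact: yi.
have HL x : (0 < fmul (rdeg f) (pw u f) x)%N -> x \in [seq y a | a <- Yb].
  rewrite fm; case: eqP => // h _; have [a aY xa] := ful _ _ bZ h.
  apply/mapP; exists a => //; rewrite mem_filter aY andbT.
  have [h1 h2 _] := yz _ aY; apply/eqP; apply: zi => //.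
  by rewrite -h2 -xa.
have [h1 [k k0 h2]] := form_div (pw_neq0 rf df0 u0) (size_pw _ _) uL HL.
have e a : a \in Y -> Fp a == b -> fmul (rdeg f) (pw u f) (y a) = dg a.
  by move=> aY /eqP ab; have [_ h3 h4] := yz _ aY; rewrite fm h3 ab eqxx.
split.
  rewrite -df -[RHS]h1 big_map big_filter big_seq_cond [RHS]big_seq_cond.
  by apply: eq_bigr => a /andP[aY ab]; rewrite e.
exists k => //; rewrite h2 big_map big_filter; congr (_ *: _).
rewrite big_seq_cond [RHS]big_seq_cond.
by apply: eq_bigr => a /andP[aY ab]; rewrite e.
Qed.

Lemma marking_wr :
  (\sum_(a <- Y) (dg a - 1))%N = (2 * d - 2)%N /\
  exists2 k, k != 0 & wr f = k *: \prod_(a <- Y) lin (y a) ^+ (dg a - 1).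
Proof.
move: mk => [[rf df] [yi zi] yz ful crt].
have df0 : (0 < rdeg f)%N by rewrite df.
have uL : uniq [seq y a | a <- Y] by rewrite map_inj_in_uniq.
have HL x : (0 < fmul (2 * rdeg f - 2) (wr f) x)%N -> x \in [seq y a | a <- Y].
  rewrite fmul_wr // => h; have [|a aY ->] := crt x; last exact: map_f.
  by move=> e; rewrite e in h.
have [w0 sw] := wr_form rf df0.
have [h1 [k k0 h2]] := form_div w0 sw uL HL.
have e a : a \in Y -> fmul (2 * rdeg f - 2) (wr f) (y a) = (dg a - 1)%N.
  by move=> aY; have [_ h3 h4] := yz _ aY; rewrite fmul_wr // h4.
split.
  rewrite -df -[RHS]h1 big_map big_seq [RHS]big_seq.
  by apply: eq_bigr => a aY; rewrite e.
exists k => //; rewrite {1}h2 big_map; congr (_ *: _).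
rewrite big_seq [RHS]big_seq.
by apply: eq_bigr => a aY; rewrite e.
Qed.

End Divisors.
End CompleteMarkings.

(** * Convergence of forms and Hurwitz' theorem *)

Section PolynomialLimits.
Variables (R : realType) (U : set_system nat).
Hypothesis UU : UltraFilter U.
Local Notation C := R[i].
Local Notation vec := (C * C)%type.
Local Open Scope classical_set_scope.

Definition polcv (p : nat -> {poly C}) (q : {poly C}) : Prop :=
  forall i, ucv U (fun n => (p n)`_i) q`_i.

Lemma polcv_near p p' q : U [set n | p n = p' n] -> polcv p q -> polcv p' q.
Proof. by move=> H c i; apply: (ucv_near UU) (c i); apply: filterS H => n /= ->. Qed.

Lemma polcv_cst q : polcv (fun=> q) q.
Proof. by move=> i; apply: (ucv_cst UU). Qed.

Lemma polcvM p p' q q' : polcv p q -> polcv p' q' -> polcv (fun n => p n * p' n) (q * q').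
Proof.
move=> c c' i; rewrite coefM.
apply: (ucv_near UU); last first.
  apply: (ucv_sum UU (index_enum 'I_i.+1) xpredT (u := fun j n => (p n)`_j * (p' n)`_(i - j))).
  by move=> j; apply: (ucvM UU).
by apply: filterS filterT => n _ /=; rewrite coefM.
Qed.

Lemma polcvD p p' q q' : polcv p q -> polcv p' q' -> polcv (fun n => p n + p' n) (q + q').
Proof.
move=> c c' i; rewrite coefD; apply: (ucv_near UU) (ucvD UU (c i) (c' i)).
by apply: filterS filterT => n _ /=; rewrite coefD.
Qed.

Lemma polcvZ (l : nat -> C) k p q : ucv U l k -> polcv p q -> polcv (fun n => l n *: p n) (k *: q).
Proof.
move=> c c' i; rewrite coefZ; apply: (ucv_near UU) (ucvM UU c (c' i)).
by apply: filterS filterT => n _ /=; rewrite coefZ.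
Qed.

Lemma polcvB p p' q q' : polcv p q -> polcv p' q' -> polcv (fun n => p n - p' n) (q - q').
Proof.
move=> c c' i; rewrite coefB; apply: (ucv_near UU) (ucvB UU (c i) (c' i)).
by apply: filterS filterT => n _ /=; rewrite coefB.
Qed.

Lemma polcv_deriv p q : polcv p q -> polcv (fun n => (p n)^`()) q^`().
Proof.
move=> c i; rewrite coef_deriv -mulr_natr.
apply: (ucv_near UU) (ucvM UU (c i.+1) (ucv_cst UU (i.+1)%:R)).
by apply: filterS filterT => n _ /=; rewrite coef_deriv mulr_natr.
Qed.

Lemma polcv_wrp p p' q q' : polcv p q -> polcv p' q' ->
  polcv (fun n => wrp (p n) (p' n)) (wrp q q').
Proof. by move=> c c'; apply: polcvB; apply: polcvM => //; apply: polcv_deriv. Qed.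

Lemma polcvX p q m : polcv p q -> polcv (fun n => p n ^+ m) (q ^+ m).
Proof.
move=> c; elim: m => [|m IH]; first exact: polcv_cst.
rewrite exprS; apply: polcv_near (polcvM c IH).
by apply: filterS filterT => n _ /=; rewrite exprS.
Qed.

Lemma polcv_hev d p q w v : polcv p q -> vcv U w v ->
  ucv U (fun n => hev d (p n) (w n)) (hev d q v).
Proof.
move=> c [c1 c2].
have cX (u : nat -> C) l m : ucv U u l -> ucv U (fun n => u n ^+ m) (l ^+ m).
  move=> cu; elim: m => [|m IH]; first exact: (ucv_cst UU).
  rewrite exprS; apply: (ucv_near UU) (ucvM UU cu IH).
  by apply: filterS filterT => n _ /=; rewrite exprS.
rewrite /hev.
apply: (ucv_sum UU (index_enum 'I_d.+1) xpredT
  (u := fun j n => (p n)`_j * (w n).1 ^+ j * (w n).2 ^+ (d - j))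
  (l := fun j : 'I_d.+1 => q`_j * v.1 ^+ j * v.2 ^+ (d - j))) => j.
by apply: (ucvM UU); [apply: (ucvM UU)|]; [apply: c|apply: cX|apply: cX].
Qed.

Lemma polcv_lin u r : pcv U u r ->
  exists2 lam : nat -> C, (forall n, lam n != 0) & polcv (fun n => lam n *: lin (u n)) (lin r).
Proof.
move=> [lam l0 [c1 c2]]; exists lam => // i; rewrite /lin coefB coefZ coefC coefX.
rewrite [X in ucv _ _ X](_ : _ = (hat r).2 * (i == 1%N)%:R -
  (hat r).1 * (if i == 0%N then 1 else 0)); last by case: (i == 0%N) => /=; ring.
apply: (ucv_near UU) (ucvB UU (ucvM UU c2 (ucv_cst UU (i == 1%N)%:R))
  (ucvM UU c1 (ucv_cst UU (if i == 0%N then 1 else 0)))).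
apply: filterS filterT => n _ /=.
by rewrite coefZ coefB coefZ coefC coefX /scv /=; case: (i == 0%N) => /=; ring.
Qed.

Section Products.
Variables (I : Type) (rn : nat -> I -> Chat R) (r : I -> Chat R) (m : I -> nat).
Hypothesis cr : forall i, pcv U (fun n => rn n i) (r i).

Lemma polcv_dprod (s : seq I) (P : pred I) :
  exists2 k : nat -> C, (forall n, k n != 0) &
    polcv (fun n => k n *: \prod_(i <- s | P i) lin (rn n i) ^+ m i)
          (\prod_(i <- s | P i) lin (r i) ^+ m i).
Proof.
elim: s => [|i s [k k0 c]].
  exists (fun=> 1) => [n|]; first exact: oner_neq0.
  rewrite big_nil; apply: polcv_near (polcv_cst 1).
  by apply: filterS filterT => n _ /=; rewrite big_nil scale1r.
case Pi : (P i); last first.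
  exists k => //; rewrite big_cons Pi; apply: polcv_near c.
  by apply: filterS filterT => n _ /=; rewrite big_cons Pi.
have [l l0 cl] := polcv_lin (cr i).
exists (fun n => l n ^+ m i * k n) => [n|]; first by rewrite mulf_neq0 ?expf_neq0.
rewrite big_cons Pi; apply: polcv_near (polcvM (polcvX (m i) cl) c).
apply: filterS filterT => n _ /=; rewrite big_cons Pi.
by rewrite exprZn -scalerAl -scalerAr scalerA.
Qed.

(** The normalized products of linear forms converge to the product over the limit points, which is
    not zero. Two proportional sequences with nonzero limits have proportional limits: [prop] is the
    cross-multiplied identity between coefficients. *)
Lemma hurwitz (s : seq I) (P : pred I) (p : nat -> {poly C}) q :
  polcv p q -> q != 0 ->
  U [set n | exists2 k, k != 0 & p n = k *: \prod_(i <- s | P i) lin (rn n i) ^+ m i] ->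
  exists2 k, k != 0 & q = k *: \prod_(i <- s | P i) lin (r i) ^+ m i.
Proof.
move=> cp q0 H; have [k k0 ck] := polcv_dprod s P.
set p' := fun n => k n *: _ in ck; set Q := \prod_(i <- s | P i) _ in ck *.
have Q0 : Q != 0 by apply: dprod_neq0.
have [kap Hk] : exists kap : nat -> C, U [set n | p n = kap n *: p' n].
  have h n : exists c : C, (exists2 k, k != 0 & p n = k *: \prod_(i <- s | P i) lin (rn n i) ^+ m i) ->
      p n = c *: p' n.
    have [[c c0 hc]|ne] := pselect (exists2 k, k != 0 & p n = k *: \prod_(i <- s | P i) lin (rn n i) ^+ m i).
      by exists (c / k n) => _; rewrite hc /p' scalerA divfK.
    by exists 0.
  have [kap hkap] := boolp.choice h; exists kap; apply: filterS H => n; exact: hkap.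
have prop i j : Q`_i * q`_j = Q`_j * q`_i.
  have h1 := ucvM UU (ck i) (cp j); have h2 := ucvM UU (ck j) (cp i).
  apply: (ucv_unique UU) h1 _; apply: (ucv_near UU) h2.
  by apply: filterS Hk => n /= ->; rewrite !coefZ; ring.
pose i := (size Q).-1; have Qi : Q`_i != 0 by rewrite -lead_coefE lead_coef_eq0.
have Dq : q = (q`_i / Q`_i) *: Q.
  apply/polyP => j; rewrite coefZ mulrAC; apply: (canRL (mulfK Qi)).
  by rewrite mulrC prop mulrC.
exists (q`_i / Q`_i) => //; apply: contraNneq q0 => h.
by rewrite Dq h scale0r.
Qed.

End Products.
End PolynomialLimits.

(** * Reduction in moving coordinates *)

Section Reduction.
Variables (R : realType) (U : set_system nat).
Hypothesis UU : UltraFilter U.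
Local Notation C := R[i].
Local Notation vec := (C * C)%type.
Local Open Scope classical_set_scope.
Variables (d : nat) (f : nat -> ratmap R).
Hypotheses (d0 : (0 < d)%N) (rf : forall n, is_rat (f n) /\ rdeg (f n) = d).

Lemma pw_rat (P Q : {poly C}) (u : vec) : pw u (RatMap P Q) = u.1 *: Q - u.2 *: P.
Proof. by []. Qed.

(* psi o f o phi^-1 converges, as a pair of forms, to the non-constant pair P, Q. *)
Definition reduces (phi psi : nat -> 'M[C]_2) (P Q : {poly C}) : Prop :=
  (exists2 lam : nat -> C, (forall n, lam n != 0) &
     polcv U (fun n => lam n *: rnum (tmap (psi n) (invmx (phi n)) (f n))) P /\
     polcv U (fun n => lam n *: rden (tmap (psi n) (invmx (phi n)) (f n))) Q) /\
  (forall u : vec, u != 0 -> pw u (RatMap P Q) != 0).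

Lemma size_limit (p : nat -> {poly C}) q :
  (forall n, (size (p n) <= d.+1)%N) -> polcv U p q -> (size q <= d.+1)%N.
Proof.
move=> sp c; apply/leq_sizeP => j hj; apply: (ucv_unique UU) (c j) _.
apply: (ucv_near UU) (ucv_cst UU 0).
by apply: filterS filterT => n _ /=; rewrite nth_default // (leq_trans (sp n)).
Qed.

Lemma reduces_size phi psi P Q : reduces phi psi P Q ->
  (size P <= d.+1)%N /\ (size Q <= d.+1)%N.
Proof.
move=> [[lam l0 [cP cQ]] _].
have s n := size_tmap (psi n) (invmx (phi n)) (f n).
split; [apply: size_limit cP|apply: size_limit cQ] => n;
  rewrite (leq_trans (size_scale_leq _ _)) //; have [] := s n; by rewrite (rf n).2.
Qed.

(** The coefficient of index [h] has limit 1: the limit form is nonzero and [h] can serve as a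
    pivot. *)
Lemma normalize_form (p : nat -> {poly C}) :
  (forall n, (size (p n) <= d.+1)%N) -> U [set n | p n != 0] ->
  exists (lam : nat -> C) (q : {poly C}) (h : nat),
    [/\ forall n, lam n != 0, polcv U (fun n => lam n *: p n) q & q`_h = 1].
Proof.
move=> sp p0; pose u (i : 'I_d.+1) n := (p n)`_i.
have [|lam [l [h [l0 Hl l1]]]] := ultra_normalize UU (u := u).
  apply: filterS p0 => n /= pn0.
  have hs : ((size (p n)).-1 < d.+1)%N.
    by rewrite (leq_trans _ (sp n)) // prednK // size_poly_gt0.
  by exists (Ordinal hs); rewrite /u /= -lead_coefE lead_coef_eq0.
exists lam, (\poly_(i < d.+1) l (inord i)), h; split=> //; last first.
  by rewrite coef_poly ltn_ord inord_val.
move=> i; rewrite coef_poly; case: ltnP => hi.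
  apply: (ucv_near UU) (Hl (inord i)).
  by apply: filterS filterT => n _ /=; rewrite coefZ /u inordK.
apply: (ucv_near UU) (ucv_cst UU 0).
by apply: filterS filterT => n _ /=; rewrite coefZ [X in _ * X]nth_default ?mulr0 // (leq_trans (sp n)).
Qed.

(** Gaussian elimination on the pair of forms: normalize the numerator, use its coefficient of index
    [h] as a pivot to clear that coefficient in the denominator, and normalize again. In the limit
    [P] has coefficient 1 and [Q] coefficient 0 at [h], and [Q] is nonzero, so they are independent.
    The matrix [psi] records these row operations. *)
Lemma reduces_exists (phi : nat -> 'M[C]_2) : U [set n | phi n \in unitmx] ->
  exists (psi : nat -> 'M[C]_2) (P Q : {poly C}),
    U [set n | psi n \in unitmx] /\ reduces phi psi P Q.
Proof.
move=> hu; pose P' n := pull d (invmx (phi n)) (rnum (f n)).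
pose Q' n := pull d (invmx (phi n)) (rden (f n)).
have pwn n (u : vec) : u != 0 -> pw u (f n) != 0.
  by move=> u0; apply: pw_neq0 => //; [exact: (rf n).1|rewrite (rf n).2].
have pln n (p : {poly C}) : phi n \in unitmx -> p != 0 -> (size p <= d.+1)%N -> pull d (invmx (phi n)) p != 0.
  by move=> h p0 sp; apply: pull_neq0 => //; rewrite unitmx_inv.
have [||lam1 [P [h [l10 cP Ph]]]] := @normalize_form P'.
- by move=> n; apply: size_pull.
- apply: filterS hu => n /= hn; apply: pln => //; last by rewrite -(rf n).2 size_rnum.
  have /(pwn n) : ((0, 1) : vec) != 0 by rewrite vec_neq0 /= oner_neq0 orbT.
  by rewrite /pw /= scale0r scale1r sub0r oppr_eq0.
pose Q'' n := (P' n)`_h *: Q' n - (Q' n)`_h *: P' n.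
have Ph0 : U [set n | (P' n)`_h != 0].
  have := ucv_neq0 UU (cP h); rewrite Ph oner_neq0 => /(_ isT).
  by apply: filterS => n /=; rewrite coefZ mulf_eq0 negb_or => /andP[].
have [||lam2 [Q [j [l20 cQ Qj]]]] := @normalize_form Q''.
- move=> n; rewrite (leq_trans (size_polyD _ _)) // geq_max size_polyN.
  by rewrite !(leq_trans (size_scale_leq _ _)) ?size_pull.
- apply: filterS2 hu Ph0 => n /= hn ph.
  have -> : Q'' n = pull d (invmx (phi n)) (pw ((P' n)`_h, (Q' n)`_h) (f n)).
    by rewrite /pw /= -!scaleNr pullD !pullZ /Q'' !scaleNr.
  apply: pln => //; last by rewrite -(rf n).2 size_pw.
  by apply: pwn; rewrite vec_neq0 /= ph.
pose psi n : 'M[C]_2 := \matrix_(i, j) if i == i0 then (if j == i0 then lam1 n else 0)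
  else (if j == i0 then - lam2 n * (Q' n)`_h else lam2 n * (P' n)`_h).
exists psi, P, Q; split.
  apply: filterS Ph0 => n /= ph; rewrite unit2 det2 !mxE /= mul0r subr0.
  by rewrite !mulf_neq0.
split.
  exists (fun=> 1) => [n|]; first exact: oner_neq0.
  split; [apply: (polcv_near UU) cP|apply: (polcv_near UU) cQ];
    apply: filterS filterT => n _ /=; rewrite !mxE /= (rf n).2 scale1r -/(P' n) -/(Q' n).
    by rewrite scale0r addr0.
  by rewrite scalerBr !scalerA addrC mulNr scaleNr.
have Qh : Q`_h = 0.
  apply: (ucv_unique UU) (cQ h) _; apply: (ucv_near UU) (ucv_cst UU 0).
  by apply: filterS filterT => n _ /=; rewrite coefZ coefB !coefZ mulrC [X in _ - X]mulrC subrr mul0r.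
move=> u u0; apply/eqP; rewrite pw_rat => e.
have := congr1 (fun p : {poly C} => p`_h) e; rewrite coefB !coefZ Qh Ph mulr0 mulr1 sub0r coef0.
move=> /eqP; rewrite oppr_eq0 => /eqP u2.
have := congr1 (fun p : {poly C} => p`_j) e; rewrite u2 scale0r subr0 coefZ Qj mulr1 coef0 => u1.
by move: u0; rewrite vec_neq0 u1 u2 eqxx.
Qed.

Lemma reduces_change phi psi chi (mu : nat -> C) B P Q :
  reduces phi psi P Q -> U [set n | psi n \in unitmx] -> (forall n, mu n != 0) ->
  B \in unitmx -> mcv U (fun n => mu n *: (chi n *m invmx (psi n))) B ->
  reduces phi chi (B i0 i0 *: P + B i0 i1 *: Q) (B i1 i0 *: P + B i1 i1 *: Q).
Proof.
move=> [[lam l0 [cP cQ]] ind] pu mu0 Bu cB; split.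
  exists (fun n => mu n * lam n) => [n|]; first by rewrite mulf_neq0.
  have key (i : 'I_2) : polcv U (fun n => (mu n * lam n) *:
      (chi n i i0 *: pull (rdeg (f n)) (invmx (phi n)) (rnum (f n)) +
       chi n i i1 *: pull (rdeg (f n)) (invmx (phi n)) (rden (f n))))
      (B i i0 *: P + B i i1 *: Q).
    apply: (polcv_near UU) (polcvD UU (polcvZ UU (cB i i0) cP) (polcvZ UU (cB i i1) cQ)).
    apply: filterS pu => n /= pn.
    have D : chi n = (chi n *m invmx (psi n)) *m psi n by rewrite mulmxKV.
    set N := chi n *m invmx (psi n) in D *.
    have Dk k : chi n i k = N i i0 * psi n i0 k + N i i1 * psi n i1 k.
      rewrite {1}D mxE !big_ord_recl big_ord0 addr0 -/i0.
      by have -> : lift i0 ord0 = i1 by apply/val_inj.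
    rewrite !Dk ![(mu n *: N) _ _]mxE -!mul_polyC !(polyCM, polyCD); ring.
  by split; apply: key.
(* [v] is the adjugate of [B] applied to [u]; applying [B] to it gives [\det B] times [u], so [v] is
   not zero. *)
move=> u u0; pose v : vec := (B i1 i1 * u.1 - B i0 i1 * u.2, - B i1 i0 * u.1 + B i0 i0 * u.2).
have -> : pw u (RatMap (B i0 i0 *: P + B i0 i1 *: Q) (B i1 i0 *: P + B i1 i1 *: Q)) =
          pw v (RatMap P Q).
  rewrite !pw_rat /v /= -!mul_polyC !(polyCB, polyCD, polyCM, polyCN); ring.
apply: ind; apply: contraNneq u0 => v0.
have dB : \det B != 0 by rewrite -unit2.
have [v1 v2] : v.1 = 0 /\ v.2 = 0 by rewrite v0.
rewrite /v /= in v1 v2.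
have e1 : \det B * u.1 = B i0 i0 * (B i1 i1 * u.1 - B i0 i1 * u.2) +
                         B i0 i1 * (- B i1 i0 * u.1 + B i0 i0 * u.2) by rewrite det2; ring.
have e2 : \det B * u.2 = B i1 i0 * (B i1 i1 * u.1 - B i0 i1 * u.2) +
                         B i1 i1 * (- B i1 i0 * u.1 + B i0 i0 * u.2) by rewrite det2; ring.
move: e1 e2; rewrite v1 v2 !mulr0 addr0 => /eqP + /eqP.
rewrite !mulf_eq0 (negbTE dB) /= => /eqP u1 /eqP u2.
by rewrite [u]surjective_pairing u1 u2.
Qed.

Lemma common_factor (P Q : {poly C}) : (size P <= d.+1)%N -> (size Q <= d.+1)%N ->
  (forall u : vec, u != 0 -> pw u (RatMap P Q) != 0) ->
  exists (G : {poly C}) (g : ratmap R),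
    [/\ is_rat g /\ (0 < rdeg g <= d)%N, G != 0 /\ (size G <= (d - rdeg g).+1)%N,
        P = G * rnum g & Q = G * rden g].
Proof.
move=> sP sQ ind.
have Q0 : Q != 0.
  have /ind : ((1, 0) : vec) != 0 by rewrite vec_neq0 /= oner_neq0.
  by rewrite pw_rat /= scale1r scale0r subr0.
pose G := gcdp P Q; have G0 : G != 0 by rewrite gcdp_eq0 negb_and Q0 orbT.
have DP : P = G * (P %/ G) by rewrite mulrC divpK // dvdp_gcdl.
have DQ : Q = G * (Q %/ G) by rewrite mulrC divpK // dvdp_gcdr.
pose g := RatMap (P %/ G) (Q %/ G).
have rg : is_rat g.
  split; first by rewrite /= coprimep_div_gcd // Q0 orbT.
  by right; apply: contraNneq Q0 => /= h; rewrite DQ h mulr0.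
have sG0 : (0 < size G)%N by rewrite size_poly_gt0.
have key (p q : {poly C}) : p = G * q -> q != 0 -> (size p <= d.+1)%N ->
    (size G + size q <= d.+2)%N.
  by move=> Dp q0; rewrite Dp size_mul //; move: (size G) (size q) => x y; lia.
have sG : (size G + rdeg g <= d.+1)%N.
  rewrite /rdeg /=.
  have q0 : Q %/ G != 0 by apply: contraNneq Q0 => /= h; rewrite DQ h mulr0.
  have h2 := key _ _ DQ q0 sQ.
  have [p0|p0] := eqVneq (P %/ G) 0.
    rewrite p0 size_poly0 max0n; rewrite -size_poly_gt0 in q0.
    by move: h2 sG0 q0; move: (size (Q %/ G)) (size G) => x y; lia.
  have h1 := key _ _ DP p0 sP.
  rewrite -!size_poly_gt0 in p0 q0.
  by move: h1 h2 p0 q0; move: (size _) (size _) (size _) => x y t; rewrite /maxn; case: ifP; lia.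
exists G, g; split=> //; last by split=> //; move: sG sG0; move: (size _) (rdeg g); lia.
split=> //; apply/andP; split; last by move: sG sG0; move: (size _) (rdeg g); lia.
rewrite lt0n; apply/eqP => e0.
(* A constant [g] would make [P] and [Q] constant multiples of [G], hence dependent. *)
have sp : (size (P %/ G)%R <= 1)%N by have := size_rnum g; rewrite e0.
have sq : (size (Q %/ G)%R <= 1)%N by have := size_rden g; rewrite e0.
have Dp := size1_polyC sp; have Dq := size1_polyC sq.
have /ind : (((P %/ G)`_0, (Q %/ G)`_0) : vec) != 0.
  rewrite vec_neq0 /=; apply/orP; right; apply: contraNneq Q0 => h.
  by rewrite DQ Dq h mulr0.
have eP : P = G * ((P %/ G)`_0)%:P by rewrite -Dp.
have eQ : Q = G * ((Q %/ G)`_0)%:P by rewrite -Dq.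
rewrite pw_rat /= subr_eq0 => /eqP; apply.
transitivity ((P %/ G)`_0 *: (G * ((Q %/ G)`_0)%:P)); first by congr (_ *: _).
transitivity ((Q %/ G)`_0 *: (G * ((P %/ G)`_0)%:P)); last by congr (_ *: _).
by rewrite -!mul_polyC; ring.
Qed.

Section Counting.
Variables (Y Z : seq nat) (Fp dg : nat -> nat) (y z : nat -> nat -> Chat R).
Hypotheses (uY : uniq Y)
  (mk : U [set n | complete_marking d Y Z Fp dg (f n) (y n) (z n)]).

(** [s al] is the order at [al] of the common factor of the limit pair. By [hurwitz] the limits of
    the fibre form and of the Wronskian vanish at the directions of the marks, with exponents summed
    over the marks that share a direction; both limits also factor through the common factor and
    [g]. *)
Lemma reduction_counts phi psi P Q (dir be : nat -> Chat R) :
  U [set n | phi n \in unitmx] -> U [set n | psi n \in unitmx] ->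
  reduces phi psi P Q ->
  (forall a, pcv U (fun n => mob (phi n) (y n a)) (dir a)) ->
  (forall b, pcv U (fun n => mob (psi n) (z n b)) (be b)) ->
  exists (g : ratmap R) (s : Chat R -> nat),
    [/\ is_rat g /\ (0 < rdeg g)%N,
        forall al b, b \in Z -> (\sum_(a <- Y | (Fp a == b) && (dir a == al)) dg a =
          s al + (if ev g al == be b then local_deg g al else 0))%N,
        forall al, (\sum_(a <- Y | dir a == al) (dg a - 1) = 2 * s al + (local_deg g al - 1))%N &
        forall al, s al = 0%N -> (hev d P (hat al), hev d Q (hat al)) != 0 :> vec /\
          ev g al = proj (hev d P (hat al), hev d Q (hat al))].
Proof.
move=> hu pu red cy cz; have [sP sQ] := reduces_size red.
have [[lam l0 [cP cQ]] ind] := red.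
have [G [g [[rg /andP[g0 gd]] [G0 sG] DP DQ]]] := common_factor sP sQ ind.
have dE : (d - rdeg g + rdeg g)%N = d by rewrite subnK.
exists g, (fmul (d - rdeg g) G); split=> //.
- move=> al b bZ.
  have [mu mu0 cb] := cz b.
  pose u n := scv (mu n) (hat (mob (psi n) (z n b))).
  pose t n := tmap (psi n) (invmx (phi n)) (f n).
  have c : polcv U (fun n => lam n *: pw (u n) (t n)) (pw (hat (be b)) (RatMap P Q)).
    rewrite pw_rat; have [c1 c2] := cb.
    apply: (polcv_near UU) (polcvB UU (polcvZ UU c1 cQ) (polcvZ UU c2 cP)).
    apply: filterS filterT => n _ /=; rewrite /pw scalerBr !scalerA.
    by congr (_ *: _ - _ *: _); rewrite mulrC.
  have [k k0 Dk] : exists2 k, k != 0 & pw (hat (be b)) (RatMap P Q) =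
      k *: \prod_(a <- Y | Fp a == b) lin (dir a) ^+ dg a.
    apply: (hurwitz UU cy) c (ind _ (hat_neq0 _)) _.
    apply: filterS3 mk hu pu => n /= mkn hn pn.
    have mkt := complete_marking_tmap d0 pn hn mkn.
    have un0 : u n != 0 by rewrite scv_neq0 ?hat_neq0.
    have pun : proj (u n) = mob (psi n) (z n b) by rewrite proj_scv // hatK.
    have [_ [k k0 Dk]] := marking_fiber d0 uY mkt bZ un0 pun.
    by exists (lam n * k); rewrite ?mulf_neq0 // -scalerA -Dk.
  have dS : (\sum_(a <- Y | Fp a == b) dg a)%N = d.
    have [n mkn] := filter_ex mk.
    by have [] := marking_fiber d0 uY mkn bZ (hat_neq0 (z n b)) (hatK _).
  have := fmulZ d (\prod_(a <- Y | Fp a == b) lin (dir a) ^+ dg a) al k0.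
  rewrite -Dk -{2}dS fmul_dprod => <-.
  have -> : pw (hat (be b)) (RatMap P Q) = G * pw (hat (be b)) g.
    by rewrite pw_rat {1}DP {1}DQ /pw -!mul_polyC; ring.
  rewrite -{1}dE fmulM ?fmul_pw // ?size_pw //.
  by rewrite pw_neq0 ?hat_neq0.
- move=> al; pose t n := tmap (psi n) (invmx (phi n)) (f n).
  have c : polcv U (fun n => lam n ^+ 2 *: wr (t n)) (wrp P Q).
    apply: (polcv_near UU) (polcv_wrp UU cP cQ).
    apply: filterS filterT => n _; rewrite /mkset /wr /wrp !derivZ.
    by rewrite -!scalerAl -!scalerAr !scalerA -scalerBr.
  (* The terms with the derivative of [G] cancel, so a common factor enters the Wronskian squared:
     hence [2 * s al]. *)
  have Dw : wrp P Q = G * G * wr g by rewrite DP DQ /wr /wrp !derivM; ring.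
  have [w0 sw] := wr_form rg g0.
  have wPQ : wrp P Q != 0 by rewrite Dw !mulf_neq0.
  have [k k0 Dk] : exists2 k, k != 0 & wrp P Q = k *: \prod_(a <- Y) lin (dir a) ^+ (dg a - 1).
    apply: (hurwitz UU cy (m := fun a => (dg a - 1)%N)) c wPQ _.
    apply: filterS3 mk hu pu => n /= mkn hn pn.
    have mkt := complete_marking_tmap d0 pn hn mkn.
    have [_ [k k0 Dk]] := marking_wr d0 uY mkt.
    exists (lam n ^+ 2 * k); first by rewrite mulf_neq0 ?expf_neq0.
    by rewrite -[in RHS]scalerA; congr (_ *: _); exact: Dk.
  have dS : (\sum_(a <- Y) (dg a - 1))%N = (2 * d - 2)%N.
    have [n mkn] := filter_ex mk.
    by have [] := marking_wr d0 uY mkn.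
  have := fmulZ (2 * d - 2) (\prod_(a <- Y) lin (dir a) ^+ (dg a - 1)) al k0.
  rewrite -Dk -{2}dS fmul_dprod => <-; rewrite Dw.
  have -> : (2 * d - 2)%N = ((d - rdeg g) + (d - rdeg g) + (2 * rdeg g - 2))%N.
    by move: gd g0; lia.
  rewrite fmulM ?mulf_neq0 ?size_formM // fmulM // fmul_wr //.
  by rewrite mul2n addnn.
(* Off the zeros of [G] the pair [P], [Q] is itself a lift of [g] up to a nonzero scalar. *)
- move=> al s0; have hP : hev d P (hat al) = hev (d - rdeg g) G (hat al) * (fpair g (hat al)).1.
    by rewrite DP -{1}dE hevM ?size_rnum.
  have hQ : hev d Q (hat al) = hev (d - rdeg g) G (hat al) * (fpair g (hat al)).2.
    by rewrite DQ -{1}dE hevM ?size_rden.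
  have hG : hev (d - rdeg g) G (hat al) != 0 by rewrite -fmul_eq0 // s0.
  rewrite hP hQ -/(scv _ _) scv_neq0 // fpair_hat_neq0 // proj_scv //.
  by rewrite evE.
Qed.

End Counting.

End Reduction.

(** * Trees from systems of directions *)

Section TreeSystems.
Local Open Scope fset_scope.
Variable R : realType.
Implicit Types (Y K : {fset nat}) (dir dd : nat -> nat -> Chat R).

(* dir k a is the direction at the vertex k towards the mark a, and dd k k' the direction
   at k towards the vertex k'. *)
Definition tree_system Y K dir dd : Prop :=
  [/\ forall k, k \in K -> exists a b c, [/\ a \in Y, b \in Y, c \in Y &
        [/\ dir k a != dir k b, dir k a != dir k c & dir k b != dir k c]],
      forall k k', k \in K -> k' \in K -> k != k' ->
        forall a, a \in Y -> dir k a = dd k k' \/ dir k' a = dd k' k,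
      forall a b c, a \in Y -> b \in Y -> c \in Y -> a != b -> a != c -> b != c ->
        exists2 k, k \in K &
          [/\ dir k a != dir k b, dir k a != dir k c & dir k b != dir k c] &
      (3 <= #|` Y|)%N].

(** Two inner vertices are joined when no mark lies between them, that is, in the direction of the
    other one from both. A leaf is joined to a vertex where no other mark shares its direction. *)
Definition Adj Y K dir dd (u w : vtx) : Prop :=
  match u, w with
  | inr k, inr k' => [/\ k \in K, k' \in K, k != k' &
      forall a, a \in Y -> dir k a = dd k k' -> dir k' a != dd k' k]
  | inr k, inl a | inl a, inr k =>
      [/\ k \in K, a \in Y & forall b, b \in Y -> dir k b = dir k a -> b = a]
  | inl _, inl _ => False
  end.

Definition towards dir dd (k : nat) (u : vtx) : Chat R :=
  match u with inl a => dir k a | inr k' => dd k k' end.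

Definition system_tree Y K dir dd : tsph R :=
  TS (Tree Y K (fun u w => `[< Adj Y K dir dd u w >]))
     (fun v w => if v is inr k then towards dir dd k w else None).

Section OneSystem.
Variables (Y K : {fset nat}) (dir dd : nat -> nat -> Chat R).
Hypothesis T : tree_system Y K dir dd.
Local Notation Adj := (Adj Y K dir dd).
Local Notation D := (towards dir dd).
Local Notation S := (system_tree Y K dir dd).

Lemma inV_system u : inV S u = match u with inl a => a \in Y | inr k => k \in K end.
Proof.
rewrite /inV /verts !inE /=; case: u => [a|k]; apply/orP/idP.
- by case=> /imfsetP[x /= xY] // [->].
- by move=> aY; left; apply/imfsetP; exists a.
- by case=> /imfsetP[x /= xY] // [->].
- by move=> aY; right; apply/imfsetP; exists k.
Qed.

Lemma dir_third k al be : k \in K -> exists2 a, a \in Y & dir k a != al /\ dir k a != be.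
Proof.
move: T => [t1 _ _ _] /t1[a [b [c [aY bY cY [ab ac bc]]]]].
have [ea|na] := eqVneq (dir k a) al.
  have [eb|nb] := eqVneq (dir k b) be.
    by exists c; rewrite // -ea -eb !(eq_sym (dir k c)).
  by exists b; rewrite // -ea eq_sym.
have [ea|nae] := eqVneq (dir k a) be; last by exists a.
have [eb|nb] := eqVneq (dir k b) al.
  by exists c; rewrite // -ea -eb !(eq_sym (dir k c)).
by exists b => //; split=> //; rewrite -ea eq_sym.
Qed.

Lemma dir_dd k k' a : k \in K -> k' \in K -> k != k' -> a \in Y ->
  dir k a != dd k k' -> dir k' a = dd k' k.
Proof. by move: T => [_ t2 _ _] kK kK' kk aY h; case: (t2 _ _ kK kK' kk _ aY) => // e; rewrite e eqxx in h. Qed.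

Lemma dd_dir k k' : k \in K -> k' \in K -> k != k' -> exists2 a, a \in Y & dir k a = dd k k'.
Proof.
move=> kK kK' kk; have [a aY [h _]] := dir_third (dd k' k) (dd k' k) kK'.
by exists a => //; rewrite eq_sym in kk; exact: dir_dd kk aY h.
Qed.

(** At distinct vertices, the marks off [dd k1 k2] all appear at [k2] in the single direction
    [dd k2 k1], and conversely. As each vertex has a third direction, such inclusions between fibres
    are strict, so a nonempty fibre determines its vertex. *)
Lemma fiber_uniq k1 k2 al1 al2 : k1 \in K -> k2 \in K ->
  (forall a, a \in Y -> (dir k1 a == al1) = (dir k2 a == al2)) ->
  (exists2 a, a \in Y & dir k1 a = al1) -> k1 = k2.
Proof.
move=> K1 K2 H [a aY ha]; apply/eqP; apply: contraT => k12.
have k21 : k2 != k1 by rewrite eq_sym.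
have [x xY [x1 x2]] := dir_third al1 (dd k1 k2) K1.
have e1 : dd k2 k1 != al2 by rewrite -(dir_dd K1 K2 k12 xY x2) -H.
have [x' xY' [x1' x2']] := dir_third al2 (dd k2 k1) K2.
have e2 : dd k1 k2 != al1 by rewrite -(dir_dd K2 K1 k21 xY' x2') H.
have : dir k2 a == al2 by rewrite -H // ha.
by rewrite (dir_dd K1 K2 k12 aY) ?(negbTE e1) // ha eq_sym.
Qed.

Lemma Adj_sym u w : Adj u w -> Adj w u.
Proof.
case: u w => [a|k] [b|k'] //= [kK kK' kk H]; split; rewrite 1?eq_sym // => a aY h.
by apply/eqP => e; have := H a aY e; rewrite h eqxx.
Qed.

Lemma Adj_inV u w : Adj u w -> inV S u && inV S w.
Proof.
rewrite !inV_system; case: u w => [a|k] [b|k'] //=; by [case=> -> ->|case=> -> -> _ _].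
Qed.

Lemma Adj_irr u : ~ Adj u u.
Proof. by case: u => [a|k] //= [_ _]; rewrite eqxx. Qed.

(** The direction of [k1] contains marks other than [a]: at [k1] some mark avoids both the direction
    of [k] and that of [a]. *)
Lemma leaf_inner_side k a k1 : Adj (inr k) (inl a) -> Adj (inr k) (inr k1) ->
  dir k a <> dd k k1.
Proof.
move=> /= [kK aY Ha] [_ K1 kk H] e.
have [x xY [x1 x2]] := dir_third (dd k1 k) (dir k1 a) K1.
have : dir k x != dd k k1.
  by apply/eqP => ex; move: x2; rewrite (Ha x xY) ?eqxx // ex e.
by move/(dir_dd kK K1 kk xY) => h; rewrite h eqxx in x1.
Qed.

Lemma Adj_towards_inj k u w : Adj (inr k) u -> Adj (inr k) w -> D k u = D k w -> u = w.
Proof.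
case: u w => [a|k1] [b|k2] /=.
- by move=> [kK aY Ha] [_ bY Hb] e; rewrite (Hb a).
- by move=> h1 h2 /(leaf_inner_side h1 h2).
- by move=> h1 h2 /esym/(leaf_inner_side h2 h1).
move=> [kK K1 n1 H1] [_ K2 n2 H2] e; congr inr.
apply: (@fiber_uniq _ _ (dd k1 k) (dd k2 k)) => // [a aY|].
  have [h|h] := eqVneq (dir k a) (dd k k1).
    by rewrite (negbTE (H1 _ aY h)) (negbTE (H2 _ aY _)) // -e.
  by rewrite (dir_dd kK K1 n1 aY h) (dir_dd kK K2 n2 aY) -?e // !eqxx.
by apply: dd_dir; rewrite // eq_sym.
Qed.

Lemma leaf_nbr_uniq a k1 k2 : Adj (inl a) (inr k1) -> Adj (inl a) (inr k2) -> k1 = k2.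
Proof.
move=> /= [K1 aY H1] [K2 _ H2].
apply: (@fiber_uniq _ _ (dir k1 a) (dir k2 a)) => // [b bY|]; last by exists a.
by apply/eqP/eqP => [/(H1 _ bY)->|/(H2 _ bY)->].
Qed.

(** If the ends of an edge lay in different directions at [k], some mark would lie between two
    adjacent inner vertices, or a second mark would share the direction of a leaf at its
    neighbour. *)
Lemma Adj_same_side k u w : k \in K -> Adj u w -> u <> inr k -> w <> inr k -> D k u = D k w.
Proof.
move=> kK; have key a k' : Adj (inl a) (inr k') -> inr k' <> inr k :> vtx -> dir k a = dd k k'.
  move=> /= [K' aY H] nk; have kk : k != k' by apply: contra_notN nk => /eqP->.
  apply/eqP; apply: contraT => h; have e := dir_dd kK K' kk aY h.
  have [x xY [x1 x2]] := dir_third (dd k k') (dir k a) kK.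
  by move: x2; rewrite (H x xY) ?eqxx // e (dir_dd kK K' kk xY x1).
case: u w => [a|k1] [b|k2] //= A n1 n2; [exact: key A n2|by rewrite (key _ _ A n1)|].
have {}n1 : k != k1 by apply: contra_notN n1 => /eqP->.
have {}n2 : k != k2 by apply: contra_notN n2 => /eqP->.
have main k1' k2' : k != k1' -> k != k2' -> Adj (inr k1') (inr k2') ->
    forall x, x \in Y -> dir k x != dd k k1' -> dir k x != dd k k2' ->
    dir k1' x = dd k1' k2' -> dd k k1' = dd k k2'.
  move=> m1 m2 /= [K1 K2 n12 H] x xY x1 x2 ex.
  apply/eqP; apply: contraT => ne.
  have g1 := dir_dd kK K1 m1 xY x1; have g2 := dir_dd kK K2 m2 xY x2.
  have nb : dd k2' k != dd k2' k1' by rewrite -g2 H.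
  have [y yY ey] := dd_dir K2 K1 (introN eqP (fun e => elimN eqP n12 (esym e))).
  have [h|h] := eqVneq (dir k y) (dd k k1').
    have : dir k y != dd k k2' by rewrite h.
    by move/(dir_dd kK K2 m2 yY) => e; rewrite -e ey eqxx in nb.
  have e1 := dir_dd kK K1 m1 yY h.
  by have := H y yY; rewrite e1 -g1 ex ey eqxx => /(_ erefl).
have [x xY [x1 x2]] := dir_third (dd k k1) (dd k k2) kK.
have [K1 K2 n12 H] := A.
have [e|e] := eqVneq (dir k1 x) (dd k1 k2); first exact: main A _ xY x1 x2 e.
have e2 := dir_dd K1 K2 n12 xY e.
by symmetry; apply: (main _ _ n2 n1 (@Adj_sym (inr k1) (inr k2) A) _ xY).
Qed.

Lemma separated_dd k k'' a b : k \in K -> k'' \in K -> a \in Y -> b \in Y ->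
  dir k a = dir k b -> dir k'' a != dir k'' b -> k != k'' /\ dd k k'' = dir k a.
Proof.
move=> kK K'' aY bY e ne.
have kk : k != k'' by apply: contraNneq ne => <-; rewrite e.
split=> //; apply/esym/eqP; apply: contraT => h.
by move: ne; rewrite (dir_dd kK K'' kk aY h) (dir_dd kK K'' kk bY) ?eqxx // -e.
Qed.

Definition fib k al : {fset nat} := [fset x in Y | dir k x == al].

Lemma in_fib k al x : (x \in fib k al) = (x \in Y) && (dir k x == al).
Proof. by rewrite !inE. Qed.

Lemma fib_ltn k al k' al' : (forall x, x \in Y -> dir k x = al -> dir k' x = al') ->
  (exists2 x, x \in Y & dir k' x = al' /\ dir k x != al) -> (#|` fib k al| < #|` fib k' al'|)%N.
Proof.
move=> H [x xY [h1 h2]]; apply: fproper_ltn_card; rewrite fproperE; apply/andP; split.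
  by apply/fsubsetP => t; rewrite !in_fib => /andP[tY /eqP/(H _ tY)->]; rewrite tY eqxx.
apply/negP => /fsubsetP/(_ x); rewrite !in_fib xY h1 eqxx (negbTE h2).
by move=> /(_ isT).
Qed.

(** If [k] and [k'] are not adjacent, take a mark [a] between them, [b] beyond [k'] and [c] beyond
    [k]. The vertex separating [a], [b], [c] lies between [k] and [k'], and fewer marks are on its
    side towards [k]. *)
Lemma inner_neighbor k k' : k \in K -> k' \in K -> k != k' ->
  exists2 k2, Adj (inr k) (inr k2) & dd k k2 = dd k k'.
Proof.
move=> kK; have [m] := ubnP #|` fib k' (dd k' k)|.
elim: m k' => // m IH k' hm K' kk.
have [A|nA] := pselect (Adj (inr k) (inr k')); first by exists k'.
have [a aY [a1 a2]] : exists2 a, a \in Y & dir k a = dd k k' /\ dir k' a = dd k' k.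
  apply: contrapT => ne; apply: nA; split=> // a aY e; apply/eqP => e'.
  by apply: ne; exists a.
have [b bY [b1 _]] := dir_third (dd k' k) (dd k' k) K'.
have kk' : k' != k by rewrite eq_sym.
have b2 : dir k b = dd k k' := dir_dd K' kK kk' bY b1.
have [c cY [c1 _]] := dir_third (dd k k') (dd k k') kK.
have c2 := dir_dd kK K' kk cY c1.
have ab : a != b by apply: contraNneq b1 => <-; rewrite a2.
have ac : a != c by apply: contraNneq c1 => <-; rewrite a1.
have bc : b != c by apply: contraNneq c1 => <-; rewrite b2.
move: T => [_ _ t3 _]; have [k'' K'' [ab' ac' bc']] := t3 _ _ _ aY bY cY ab ac bc.
have [n1 e1] := separated_dd kK K'' aY bY (etrans a1 (esym b2)) ab'.
have [n2 e2] := separated_dd K' K'' aY cY (etrans a2 (esym c2)) ac'.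
have g1 : dir k'' c = dd k'' k by apply: dir_dd n1 cY _; rewrite // e1 a1.
have g2 : dir k'' b = dd k'' k' by apply: dir_dd n2 bY _; rewrite // e2 a2.
have [|||k2 A2 e3] // := IH k''.
  rewrite -ltnS (leq_trans _ hm) // ltnS; apply: fib_ltn => [x xY hx|].
    rewrite -a2 -e2; apply: dir_dd => //; first by rewrite eq_sym.
    by rewrite hx -g1 -g2 eq_sym.
  by exists a; rewrite // a2 -g1.
by exists k2; rewrite // e3 e1 a1.
Qed.

Lemma neighbor_exists k a : k \in K -> a \in Y -> exists2 u, Adj (inr k) u & D k u = dir k a.
Proof.
move=> kK aY.
have [A|nA] := pselect (Adj (inr k) (inl a)); first by exists (inl a).
have [b bY [b1 b2]] : exists2 b, b \in Y & dir k b = dir k a /\ b != a.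
  apply: contrapT => ne; apply: nA; split=> // b bY e.
  by apply/eqP; apply: contraT => h; case: ne; exists b.
have [c cY [c1 _]] := dir_third (dir k a) (dir k a) kK.
have ac : a != c by apply: contraNneq c1 => <-.
have bc : b != c by apply: contraNneq c1 => <-; rewrite b1.
have ab : a != b by rewrite eq_sym.
move: T => [_ _ t3 _]; have [k'' K'' [ab' ac' bc']] := t3 _ _ _ aY bY cY ab ac bc.
have [n1 e1] := separated_dd kK K'' aY bY (esym b1) ab'.
have [k2 A e] := inner_neighbor kK K'' n1.
by exists (inr k2); rewrite //= e e1.
Qed.

Lemma three_marks : exists a b c, [/\ a \in Y, b \in Y, c \in Y & [/\ a != b, a != c & b != c]].
Proof.
move: T => [_ _ _ c3]; have uY := fset_uniq Y; have : (3 <= size Y)%N := c3.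
have mY x : x \in (Y : seq nat) -> x \in Y by [].
case: (Y : seq nat) uY mY => [|a [|b [|c s]]] //= uY mY _.
exists a, b, c; split; try by apply: mY; rewrite !inE eqxx ?orbT.
by move: uY; rewrite !inE !negb_or => /andP[/and3P[-> -> _] /andP[/andP[-> _] _]].
Qed.

Lemma system_inner : exists k, k \in K.
Proof.
have [a [b [c [aY bY cY [ab ac bc]]]]] := three_marks.
by move: T => [_ _ t3 _]; have [k kK _] := t3 _ _ _ aY bY cY ab ac bc; exists k.
Qed.

(** While another mark [b] shares the direction of [a] at [k], the vertex separating [a], [b] and a
    mark outside that direction sees fewer marks in the direction of [a]. *)
Lemma leaf_neighbor a : a \in Y -> exists k, Adj (inl a) (inr k).
Proof.
move=> aY; have [k kK] := system_inner.
have [m] := ubnP #|` fib k (dir k a)|; elim: m k kK => // m IH k kK hm.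
have [A|nA] := pselect (Adj (inl a) (inr k)); first by exists k.
have [b bY [b1 b2]] : exists2 b, b \in Y & dir k b = dir k a /\ b != a.
  apply: contrapT => ne; apply: nA; split=> // b bY e.
  by apply/eqP; apply: contraT => h; case: ne; exists b.
have [c cY [c1 _]] := dir_third (dir k a) (dir k a) kK.
have ac : a != c by apply: contraNneq c1 => <-.
have bc : b != c by apply: contraNneq c1 => <-; rewrite b1.
have ab : a != b by rewrite eq_sym.
move: T => [_ _ t3 _]; have [k'' K'' [ab' ac' bc']] := t3 _ _ _ aY bY cY ab ac bc.
have [n1 e1] := separated_dd kK K'' aY bY (esym b1) ab'.
have g1 : dir k'' c = dd k'' k by apply: dir_dd n1 cY _; rewrite // e1.
apply: (IH k'') => //; rewrite -ltnS (leq_trans _ hm) // ltnS; apply: fib_ltn => [x xY hx|].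
  rewrite -e1; apply: dir_dd => //; first by rewrite eq_sym.
  by rewrite hx -g1.
by exists b; rewrite // b1 eq_sym.
Qed.

Local Notation adjS := (adj S).

Lemma adjSP u w : reflect (Adj u w) (adjS u w).
Proof. exact: asboolP. Qed.

Definition inner (u : vtx) := if u is inr _ then true else false.

(** Each step goes to the neighbour in the direction of [k]; the set of marks on the side of [k]
    shrinks strictly, so the walk reaches a neighbour of [k]. *)
Lemma path_towards k w : k \in K -> inV S w -> w <> inr k ->
  exists p, [/\ all (fun x => inV S x && (x != inr k)) (w :: p), path adjS w p,
                Adj (last w p) (inr k) & all inner p].
Proof.
move=> kK; have main k' : k' \in K -> k' != k -> exists p,
    [/\ all (fun x => inV S x && (x != inr k)) (inr k' :: p), path adjS (inr k') p,
        Adj (last (inr k') p) (inr k) & all inner p].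
  have [m] := ubnP #|` fib k' (dd k' k)|; elim: m k' => // m IH k' hm K' n.
  have hk' : inV S (inr k') && (inr k' != inr k :> vtx) by rewrite inV_system K'.
  have [k2 A e] := inner_neighbor K' kK n.
  have [ek|nk] := eqVneq k2 k.
    by exists [::]; split=> //; [apply/andP; split|rewrite -ek].
  have [_ K2 n2 H2] := A.
  have kk : k != k' by rewrite eq_sym.
  have kk2 : k != k2 by rewrite eq_sym.
  have kn2 : k2 != k' by rewrite eq_sym.
  have hne : dd k2 k != dd k2 k'.
    have [x xY [x1 x2]] := dir_third (dd k k') (dd k k2) kK.
    rewrite -(dir_dd kK K2 kk2 xY x2); apply: H2 => //.
    by rewrite e; apply: dir_dd kk xY x1.
  have [|||p [p1 p2 p3 p4]] // := IH k2.
    rewrite -ltnS (leq_trans _ hm) // ltnS; apply: fib_ltn => [x xY hx|].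
      by rewrite -e; apply: dir_dd kn2 xY _; rewrite // hx.
    have [x xY [x1 x2]] := dir_third (dd k2 k) (dd k2 k') K2.
    exists x => //; split=> //; rewrite -e; exact: dir_dd kn2 xY x2.
  exists (inr k2 :: p); split=> //.
    by rewrite /= hk'; move: p1.
  by apply/andP; split=> //; apply/adjSP.
case: w => [a|k']; last first.
  by rewrite inV_system => K' n; apply: main => //; apply: contra_notN n => /eqP->.
rewrite inV_system => aY _; have [k1 A] := leaf_neighbor aY.
have ha : inV S (inl a) && (inl a != inr k :> vtx) by rewrite inV_system aY.
have [ek|nk] := eqVneq k1 k.
  by exists [::]; split=> //; [apply/andP; split|rewrite -ek].
have [K1 _ _] := A; have [p [p1 p2 p3 p4]] := main _ K1 nk.
exists (inr k1 :: p); split=> //; first by rewrite /= ha; move: p1.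
by apply/andP; split=> //; apply/adjSP.
Qed.

Lemma adjS_sym u w : adjS u w = adjS w u.
Proof. by apply/adjSP/adjSP => /Adj_sym. Qed.

Lemma in_branch_trans v w u x : in_branch S v w u -> in_branch S v u x -> in_branch S v w x.
Proof.
move=> [p /and3P[p1 p2 /eqP p3]] [q /and3P[q1 q2 /eqP q3]].
exists (p ++ q); rewrite cat_path last_cat p3 p2 q2 q3 eqxx andbT /=.
by move: p1 q1 => /= /andP[-> p1] /andP[_ q1]; rewrite all_cat p1 q1.
Qed.

Lemma in_branch_sym v w u : in_branch S v w u -> in_branch S v u w.
Proof.
move=> [p /and3P[p1 p2 /eqP p3]]; exists (rev (belast w p)).
apply/and3P; split.
- rewrite -p3 -[X in all _ X]/(last w p :: rev (belast w p)) -rev_rcons -lastI.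
  by rewrite all_rev.
- rewrite -p3 rev_path (eq_path (e' := adjS)) // => x y; exact: adjS_sym.
- case: p p3 {p1 p2} => [|x p] /= p3; first by rewrite p3.
  by rewrite rev_cons last_rcons.
Qed.

Lemma in_branch_side k w u : k \in K -> in_branch S (inr k) w u -> D k w = D k u.
Proof.
move=> kK [p /and3P[p1 p2 /eqP <-]].
elim: p w p1 p2 => [//|x p IH] w /and3P[/andP[_ h1] h2 h3] /andP[/adjSP A p2].
have /andP[_ h2'] := h2.
transitivity (D k x); first exact: Adj_same_side kK A (elimN eqP h1) (elimN eqP h2').
by apply: IH p2; apply/andP; split.
Qed.

(** A walk towards [k] stays in one branch and ends at a neighbour of [k], and neighbours in the
    same direction coincide: branches at [k] are directions. *)
Lemma in_branchE k w u : k \in K -> inV S w -> inV S u -> w != inr k -> u != inr k ->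
  in_branch S (inr k) w u <-> D k w = D k u.
Proof.
move=> kK wV uV wk uk; split; first exact: in_branch_side.
move=> e; have [p [p1 p2 p3 _]] := path_towards kK wV (elimN eqP wk).
have [q [q1 q2 q3 _]] := path_towards kK uV (elimN eqP uk).
have b1 : in_branch S (inr k) w (last w p) by exists p; rewrite p1 p2 eqxx.
have b2 : in_branch S (inr k) u (last u q) by exists q; rewrite q1 q2 eqxx.
have h : last w p = last u q.
  apply: (Adj_towards_inj (Adj_sym p3) (Adj_sym q3)).
  by rewrite -(in_branch_side kK b1) -(in_branch_side kK b2).
by apply: in_branch_trans b1 _; rewrite h; apply: in_branch_sym.
Qed.

Lemma path_inner k w : k \in K -> inV S w -> exists p, [/\ all inner p,
  all (inV S) (w :: p), path adjS w p & last w p = inr k].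
Proof.
move=> kK wV; have [->|n] := eqVneq w (inr k).
  by exists [::]; split=> //=; rewrite inV_system kK.
have [p [p1 p2 p3 p4]] := path_towards kK wV (elimN eqP n).
exists (rcons p (inr k)); split.
- by rewrite all_rcons p4.
- rewrite -rcons_cons all_rcons inV_system kK /=.
  by move: p1 => /= /andP[/andP[-> _] p1]; apply: sub_all p1 => x /andP[].
- by rewrite rcons_path p2; apply/adjSP.
- by rewrite last_rcons.
Qed.

(** Any vertex is joined to a given inner vertex through inner vertices only, so removing a leaf
    disconnects nothing. *)
Lemma in_branch_leaf a w u : inV S w -> inV S u -> w != inl a -> u != inl a ->
  in_branch S (inl a) w u.
Proof.
move=> wV uV wa ua; have [k kK] := system_inner.
have key x : inV S x -> x != inl a -> in_branch S (inl a) x (inr k).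
  move=> xV xa; have [p [p1 p2 p3 p4]] := path_inner kK xV.
  exists p; rewrite p3 p4 eqxx !andbT /= xV xa /=.
  move: p2 => /= /andP[_ p2]; apply/allP => t tp.
  by rewrite (allP p2) //=; move: (allP p1 _ tp); case: t {tp}.
exact: in_branch_trans (key _ wV wa) (in_branch_sym (key _ uV ua)).
Qed.

Lemma path_inV x p : path adjS x p -> inV S x -> all (inV S) (x :: p).
Proof.
elim: p x => [x _ xV|y p IH x /andP[/adjSP/Adj_inV/andP[_ yV] pp] xV]; apply/andP; split=> //.
exact: IH.
Qed.

Lemma system_is_tree : is_tree S.
Proof.
split.
- exact: adjS_sym.
- by move=> u; apply/negP => /adjSP/Adj_irr.
- by move=> u w /adjSP/Adj_inV.
- move=> u w uV wV; have [k kK] := system_inner.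
  have [p [_ p2 p3 p4]] := path_inner kK uV; have [q [_ q2 q3 q4]] := path_inner kK wV.
  exists (p ++ rev (belast w q)); apply/and3P; split.
  + move: p2 => /= /andP[_ p2]; rewrite all_cat p2 all_rev.
    by apply/allP => x /mem_belast xq; apply: (allP q2).
  + rewrite cat_path p3 p4 -q4 rev_path (eq_path (e' := adjS)) // => x y; exact: adjS_sym.
  + rewrite last_cat p4; case: q q4 {q2 q3} => [|x q] /= q4; first by rewrite q4.
    by rewrite rev_cons last_rcons.
(* In a cycle through [v] the two neighbours of [v] are distinct. A leaf has a single neighbour; at
   an inner vertex the rest of the cycle joins them away from [v], so they lie in one direction and
   coincide. *)
- move=> v p [sp up pp lp].
  case: p sp up pp lp => [//|x [//|y p]] _ up pp0 lp0.
  have /and3P[vx xy pp] : [&& adjS v x, adjS x y & path adjS y p] := pp0.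
  have lp : adjS (last y p) v := lp0.
  have pp1 : path adjS x (y :: p) by apply/andP.
  have xl : x != last y p.
    move: up; rewrite !cons_uniq => /and3P[_ h _].
    by apply: contra h => /eqP->; rewrite mem_last.
  case: v vx lp up {pp0 lp0} => [a|k] vx lp up.
    move/adjSP: vx => vx; rewrite adjS_sym in lp; move/adjSP: lp => lp.
    case: x (last y p) vx lp xl {xy up pp1} => [?|k1] [?|k2] // vx lp.
    by rewrite (leaf_nbr_uniq vx lp) eqxx.
  move/adjSP: (vx) => A1; rewrite adjS_sym in lp; move/adjSP: lp => A2.
  have kK : k \in K by have /andP[] := Adj_inV A1; rewrite inV_system.
  move/eqP: xl; apply; apply: (Adj_towards_inj A1 A2).
  have iV := path_inV pp1 (proj2 (andP (Adj_inV A1))).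
  apply: in_branch_side kK _; exists (y :: p); apply/and3P; split=> //.
  apply/allP => t tp; rewrite (allP iV) //=.
  by apply: contraTneq up => e; rewrite -e cons_uniq tp.
Qed.

Lemma system_is_tsph : is_tsph S.
Proof.
split; last by move=> k kK u w /adjSP A1 /adjSP A2; apply: Adj_towards_inj A1 A2.
split; first exact: system_is_tree.
- by move: T => [].
- move=> a aY; have [k A] := leaf_neighbor aY.
  rewrite /valence; have -> : [fset u in verts S | adjS (inl a) u] = [fset (inr k : vtx)].
    apply/fsetP => u; rewrite !inE; apply/andP/eqP => [[_ /adjSP]|->].
      by case: u => [b|k1] // A1; rewrite (leaf_nbr_uniq A1 A).
    by have /andP[_ h] := Adj_inV A; split; [move: h; rewrite /inV /verts !inE|apply/adjSP].
  by rewrite cardfs1.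
- move=> k kK; move: T => [t1 _ _ _]; have [a [b [c [aY bY cY [ab ac bc]]]]] := t1 _ kK.
  have [u1 A1 e1] := neighbor_exists kK aY.
  have [u2 A2 e2] := neighbor_exists kK bY.
  have [u3 A3 e3] := neighbor_exists kK cY.
  have n12 : u1 != u2 by apply: contraNneq ab => h; rewrite -e1 -e2 h.
  have n13 : u1 != u3 by apply: contraNneq ac => h; rewrite -e1 -e3 h.
  have n23 : u2 != u3 by apply: contraNneq bc => h; rewrite -e2 -e3 h.
  have c3 : #|` [fset u1; u2; u3]| = 3%N.
    by rewrite fsetUC cardfsU1 cardfs2 !inE n12 !(eq_sym u3) (negbTE n13) (negbTE n23).
  have nb u : Adj (inr k) u -> u \in [fset u in verts S | adjS (inr k) u].
    move=> A; have /andP[_ h] := Adj_inV A; rewrite !inE; apply/andP.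
    by split; [move: h; rewrite /inV /verts !inE|apply/adjSP].
  rewrite /valence -c3; apply: fsubset_leq_card; apply/fsubsetP => u.
  by rewrite !in_fsetU !in_fset1 => /orP[/orP[]|] /eqP->; apply: nb.
Qed.

Lemma aval_system k x q : k \in K -> x \in Y -> aval S (inr k) x q <-> q = dir k x.
Proof.
move=> kK xY; split=> [[w [/adjSP A [b ->]]]|->].
  by rewrite /= (in_branch_side kK b).
have [u A e] := neighbor_exists kK xY.
exists u; split; first exact/adjSP.
split; last by rewrite /= e.
have /andP[_ uV] := Adj_inV A.
apply/in_branchE; rewrite // ?inV_system //.
by apply/eqP => h; rewrite h in A; exact: Adj_irr A.
Qed.

Lemma separates_inner k v1 v2 v3 : k \in K -> inV S v1 -> inV S v2 -> inV S v3 ->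
  separates S (inr k) v1 v2 v3 <->
  [/\ v1 != inr k, v2 != inr k & v3 != inr k] /\
  [/\ D k v1 <> D k v2, D k v1 <> D k v3 & D k v2 <> D k v3].
Proof.
move=> kK V1 V2 V3; split=> -[[n1 n2 n3] [h1 h2 h3]]; split=> //;
  by split=> h; [apply: h1|apply: h2|apply: h3]; apply/in_branchE.
Qed.

Lemma separates_leaf a v1 v2 v3 : inV S v1 -> inV S v2 -> inV S v3 ->
  ~ separates S (inl a) v1 v2 v3.
Proof. by move=> V1 V2 V3 [[n1 n2 _] [h _ _]]; apply: h; apply: in_branch_leaf. Qed.

End OneSystem.

(** Separation at an inner vertex is distinctness of directions, and a leaf separates nothing;
    compatibility is thus a matter of equal directions. *)
Lemma system_tri Y K dir dd Y' K' dir' dd' :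
  tree_system Y K dir dd -> tree_system Y' K' dir' dd' -> Y `<=` Y' -> K `<=` K' ->
  (forall k a, k \in K -> a \in Y -> dir k a = dir' k a) ->
  (forall k k', k \in K -> k' \in K -> k != k' -> dd k k' = dd' k k') ->
  tri (system_tree Y K dir dd) (system_tree Y' K' dir' dd').
Proof.
move=> T T' sY sK eY eK; split; last first.
  move=> k x q kK xY; rewrite (aval_system T) // (aval_system T') ?eY //.
    exact: (fsubsetP sK).
  exact: (fsubsetP sY).
have V u : inV (system_tree Y K dir dd) u -> inV (system_tree Y' K' dir' dd') u.
  by rewrite !inV_system; case: u => [a|k]; [apply: (fsubsetP sY)|apply: (fsubsetP sK)].
split=> //; case=> [a|k] v1 v2 v3 V0 V1 V2 V3.
  by split=> h; exfalso; move: h; apply: separates_leaf; rewrite ?V.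
rewrite inV_system in V0; rewrite (separates_inner T) // (separates_inner T') ?V //; last first.
  exact: (fsubsetP sK).
have e u : inV (system_tree Y K dir dd) u -> u != inr k ->
    towards dir dd k u = towards dir' dd' k u.
  rewrite inV_system; case: u => [a|k'] hu n /=; first exact: eY.
  by apply: eK => //; apply: contra n => /eqP->.
by split=> -[[n1 n2 n3]]; rewrite !e // => h; split.
Qed.

End TreeSystems.

(** * Trees of moving coordinates *)

Definition labels (N : nat) : {fset nat} := [fset x in iota 0 N]%fset.

Lemma in_labels N x : (x \in labels N) = (x < N)%N.
Proof. by rewrite inE /= mem_iota. Qed.

Lemma card_labels N : #|` labels N|%fset = N.
Proof. by rewrite card_fseq undup_id ?iota_uniq // size_iota. Qed.

Section Frames.
Variable R : realType.
Local Notation C := R[i].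
Local Notation vec := (C * C)%type.

(* The Moebius map sending p, q, r to 0, 1, oo. *)
Definition frame (p q r : Chat R) : 'M[C]_2 :=
  let p' := hat p in let q' := hat q in let r' := hat r in
  \matrix_(i, j) if i == i0 then wedge r' q' * (if j == i0 then - p'.2 else p'.1)
                 else wedge p' q' * (if j == i0 then - r'.2 else r'.1).

Lemma mulv_frame p q r v : mulv (frame p q r) v =
  (wedge (hat r) (hat q) * wedge (hat p) v, wedge (hat p) (hat q) * wedge (hat r) v).
Proof. by rewrite /mulv !mxE /= /wedge; congr (_, _); ring. Qed.

Section Distinct.
Variables p q r : Chat R.
Hypotheses (pq : p != q) (pr : p != r) (qr : q != r).

Lemma frame_unit : frame p q r \in unitmx.
Proof.
rewrite unit2 det2 !mxE /=.
set a := wedge (hat r) _; set b := wedge (hat p) _.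
rewrite (_ : _ - _ = a * b * wedge (hat p) (hat r)); last by rewrite /wedge; ring.
by rewrite !mulf_neq0 ?wedge_hat // eq_sym.
Qed.

Lemma frame_values :
  [/\ mob (frame p q r) p = Some 0, mob (frame p q r) q = Some 1 & mob (frame p q r) r = None].
Proof.
have wpq : wedge (hat p) (hat q) != 0 by rewrite wedge_hat.
have wpr : wedge (hat r) (hat p) != 0 by rewrite wedge_hat eq_sym.
have wrq : wedge (hat r) (hat q) != 0 by rewrite wedge_hat eq_sym.
have ww x : wedge (hat x) (hat x) = 0 by apply/eqP; rewrite wedge_hat.
split; rewrite mobE mulv_frame /proj /= ?ww ?mulr0 ?eqxx //.
  by rewrite mulf_neq0 // mul0r.
by rewrite mulf_neq0 // [X in X / _]mulrC divff // mulf_neq0.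
Qed.

End Distinct.

Variable U : set_system nat.
Hypothesis UU : UltraFilter U.
Local Open Scope classical_set_scope.

(** In the collapsing case each of the three marks would sit at [ka] in one frame or at [io] in the
    other, and each place can hold only one of them. *)
Lemma frames_equivalent (phi psi : nat -> 'M[C]_2) (x : nat -> nat -> Chat R)
    (al be : nat -> Chat R) (a b c : nat) :
  U [set n | phi n \in unitmx] -> U [set n | psi n \in unitmx] ->
  (forall i, pcv U (fun n => mob (psi n) (x n i)) (al i)) ->
  (forall i, pcv U (fun n => mob (phi n) (x n i)) (be i)) ->
  [/\ al a != al b, al a != al c & al b != al c] ->
  [/\ be a != be b, be a != be c & be b != be c] ->
  exists (lam : nat -> C) (B : 'M[C]_2),
    [/\ forall n, lam n != 0, B \in unitmx &
        mcv U (fun n => lam n *: (phi n *m invmx (psi n))) B].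
Proof.
move=> hp hq ca cb [a1 a2 a3] [b1 b2 b3].
have [[lam [B [h1 h2 h3 _]]]|[ka [io H]]] := frame_dichotomy UU hp hq; first by exists lam, B.
have h i := H _ _ _ (ca i) (cb i).
exfalso; move: a1 a2 a3 b1 b2 b3.
by case: (h a) => ->; case: (h b) => ->; case: (h c) => ->; rewrite ?eqxx.
Qed.

Section System.
Variables (N : nat) (y : nat -> nat -> Chat R).
Hypotheses (N3 : (3 <= N)%N) (yi : U [set n | {in labels N &, injective (y n)}]).

Let good (t : nat * nat * nat) : bool :=
  [&& t.1.1 != t.1.2, t.1.1 != t.2, t.1.2 != t.2,
      (t.1.1 < N)%N, (t.1.2 < N)%N & (t.2 < N)%N].
(** Put first in the list, so that vertex 0 is the frame of the marks 0, 1, 2, which the markings of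
    source and target share. *)
Let t0 : nat * nat * nat := (0, 1, 2)%N.
Let triples := t0 :: [seq t <-
  [seq (ab, c) | ab <- [seq (a, b) | a <- iota 0 N, b <- iota 0 N], c <- iota 0 N] | good t].
Let tri i := nth t0 triples i.
Let phi n i := frame (y n (tri i).1.1) (y n (tri i).1.2) (y n (tri i).2).

Let good0 : good t0.
Proof. by rewrite /good /= !(leq_trans _ N3). Qed.

Let tri_good i : good (tri i).
Proof.
rewrite /tri; case: (ltnP i (size triples)) => [/(mem_nth t0)|h]; last by rewrite nth_default.
by rewrite inE => /orP[/eqP->//|]; rewrite mem_filter => /andP[].
Qed.

Let tri_all t : good t -> exists2 i, (i < size triples)%N & tri i = t.
Proof.
move=> gt; have tin : t \in triples.
  rewrite inE mem_filter gt; apply/orP; right.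
  case: t gt => [[a b] c] /and5P[_ _ _ /= ha /andP[hb hc]].
  apply/allpairsP; exists ((a, b), c) => /=; split; rewrite ?mem_iota //.
  by apply/allpairsP; exists (a, b); rewrite /= !mem_iota.
by exists (index t triples); rewrite ?index_mem // /tri nth_index.
Qed.

Let phi_good n i : {in labels N &, injective (y n)} ->
  phi n i \in unitmx /\ [/\ mob (phi n i) (y n (tri i).1.1) = Some 0,
    mob (phi n i) (y n (tri i).1.2) = Some 1 & mob (phi n i) (y n (tri i).2) = None].
Proof.
move=> inj; have /and5P[n1 n2 n3 h1 /andP[h2 h3]] := tri_good i.
have key a b : (a < N)%N -> (b < N)%N -> a != b -> y n a != y n b.
  by move=> ha hb; apply: contraNneq => /inj->//; rewrite in_labels.
by split; [apply: frame_unit|apply: frame_values]; apply: key.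
Qed.

Lemma frame_system : exists (K : {fset nat}) (phi : nat -> nat -> 'M[C]_2)
    (dir dd : nat -> nat -> Chat R),
  [/\ tree_system (labels N) K dir dd,
      0%N \in K /\ (forall n, phi n 0%N = frame (y n 0%N) (y n 1%N) (y n 2%N)),
      forall n k, {in labels N &, injective (y n)} -> phi n k \in unitmx &
      forall k a, pcv U (fun n => mob (phi n k) (y n a)) (dir k a)].
Proof.
have [dir' Hdir'] : exists dir', forall ka : nat * nat,
    pcv U (fun n => mob (phi n ka.1) (y n ka.2)) (dir' ka).
  have h (ka : nat * nat) : exists r, pcv U (fun n => mob (phi n ka.1) (y n ka.2)) r.
    exact: (pcv_exists UU).
  by have [g hg] := boolp.choice h; exists g.
pose dir k a := dir' (k, a).
have Hdir k a : pcv U (fun n => mob (phi n k) (y n a)) (dir k a) := Hdir' (k, a).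
(* Two frames name the same vertex when they separate the same pairs of marks; [K] keeps the least
   index of each class. *)
pose same i j := forall a b, a \in labels N -> b \in labels N ->
  (dir i a == dir i b) = (dir j a == dir j b).
have [M eM] : exists M, M = size triples by exists (size triples).
pose K := [fset i in iota 0 M | `[< forall j, (j < i)%N -> ~ same i j >]]%fset.
have inK i : (i \in K) = (i < M)%N && `[< forall j, (j < i)%N -> ~ same i j >].
  by rewrite !inE /= mem_iota.
have rep i : (i < M)%N -> exists2 k, k \in K & same i k.
  elim/ltn_ind: i => i IH hi.
  have [h|h] := pselect (forall j, (j < i)%N -> ~ same i j).
    by exists i => //; rewrite inK hi; apply/asboolP.
  have [j [ji sij]] : exists j, (j < i)%N /\ same i j.
    by apply: contrapT => ne; apply: h => j ji sij; apply: ne; exists j.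
  have [k kK sjk] := IH j ji (ltn_trans ji hi).
  by exists k => // a b aY bY; rewrite sij // sjk.
have units k : U [set n | phi n k \in unitmx].
  by apply: filterS yi => n /(phi_good k)[].
have vals k : [/\ dir k (tri k).1.1 = Some 0, dir k (tri k).1.2 = Some 1 & dir k (tri k).2 = None].
  split; apply: (pcv_unique UU) (Hdir k _) _; apply: (pcv_near UU) (pcv_cst UU _);
    by apply: filterS yi => n /(phi_good k)[_ []].
have sep k : [/\ dir k (tri k).1.1 != dir k (tri k).1.2, dir k (tri k).1.1 != dir k (tri k).2 &
                 dir k (tri k).1.2 != dir k (tri k).2].
  have [-> -> ->] := vals k; split=> //.
  by apply/eqP => -[] /eqP; rewrite eq_sym oner_eq0.
(* Equivalent frames separate the same pairs, which the minimality of [k'] excludes; the collapsing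
   case provides the two directions. *)
have dich k k' : k \in K -> k' \in K -> (k < k')%N -> exists ab : Chat R * Chat R,
    forall a, dir k a = ab.1 \/ dir k' a = ab.2.
  move=> kK K' kk'.
  have [[lam [B [_ Bu _ HB]]]|[ka [io H]]] := frame_dichotomy UU (units k') (units k); last first.
    by exists (ka, io) => a; apply: H (Hdir k a) (Hdir k' a).
  move: K'; rewrite inK => /andP[_ /asboolP/(_ _ kk')[]] a b _ _.
  rewrite (HB _ _ _ (Hdir k a) (Hdir k' a)) (HB _ _ _ (Hdir k b) (Hdir k' b)).
  exact: (inj_eq (mob_inj Bu)).
have [e He] : exists e : nat * nat -> Chat R * Chat R, forall kk, kk.1 \in K -> kk.2 \in K ->
    (kk.1 < kk.2)%N -> forall a, dir kk.1 a = (e kk).1 \/ dir kk.2 a = (e kk).2.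
  have h (kk : nat * nat) : exists ab : Chat R * Chat R, kk.1 \in K -> kk.2 \in K ->
      (kk.1 < kk.2)%N -> forall a, dir kk.1 a = ab.1 \/ dir kk.2 a = ab.2.
    have [h|h] := pselect [/\ kk.1 \in K, kk.2 \in K & (kk.1 < kk.2)%N].
      by have [h1 h2 h3] := h; have [ab Hab] := dich _ _ h1 h2 h3; exists ab.
    by exists (None, None) => h1 h2 h3; case: h.
  by have [e He] := boolp.choice h; exists e.
pose dd k k' := if (k < k')%N then (e (k, k')).1 else (e (k', k)).2.
exists K, phi, dir, dd; split=> //.
- split.
  + move=> k _; have /and5P[_ _ _ h1 /andP[h2 h3]] := tri_good k.
    by exists (tri k).1.1, (tri k).1.2, (tri k).2; rewrite !in_labels; split.
  + move=> k k' kK K'; rewrite neq_ltn => /orP[h|h] a _.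
      by rewrite /dd h ltnNge ltnW //=; apply: (He (k, k')).
    by rewrite /dd h ltnNge ltnW //=; case: (He (k', k) K' kK h a); [right|left].
  + move=> a b c; rewrite !in_labels => aN bN cN ab ac bc.
    have [|i hi ti] := @tri_all (a, b, c); first by rewrite /good /= ab ac bc aN bN cN.
    rewrite -eM in hi; have [k kK sik] := rep i hi; exists k => //.
    by have := sep i; rewrite ti /= !sik // ?in_labels.
  + by rewrite card_labels.
- split; last by [].
  by rewrite inK eM /=; apply/asboolP.
- by move=> n k /(phi_good k)[].
Qed.

End System.
End Frames.

(** * Counting along edges and at vertices *)

Lemma sum_by_value (I V : eqType) (s : seq I) (P : pred I) (h : I -> V)
    (F : I -> nat) (D : seq V) : uniq D -> (forall i, i \in s -> P i -> h i \in D) ->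
  (\sum_(i <- s | P i) F i = \sum_(al <- D) \sum_(i <- s | P i && (h i == al)) F i)%N.
Proof.
move=> uD hD; under [RHS]eq_bigr do rewrite big_mkcondr.
rewrite exchange_big /= big_seq_cond [RHS]big_seq_cond; apply: eq_bigr => i /andP[si Pi].
rewrite -big_mkcond (eq_bigl (fun al => al == h i)) => [|al]; last by rewrite eq_sym.
by rewrite -big_filter filter_pred1_uniq ?big_seq1 // hD.
Qed.

Section CoverCounting.
Local Open Scope fset_scope.
Variable R : realType.
Variables (d : nat) (Y Z K : {fset nat}) (dir dd : nat -> nat -> Chat R).
Variables (Fp dg : nat -> nat).
Variables (ge : nat -> Chat R -> Chat R) (s m : nat -> Chat R -> nat) (be : nat -> nat -> Chat R).
Hypotheses (T : tree_system Y K dir dd) (d0 : (0 < d)%N) (Z3 : (3 <= #|` Z|)%N).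
Hypotheses (FZ : forall a, a \in Y -> Fp a \in Z) (dg0 : forall a, a \in Y -> (0 < dg a)%N).
Hypothesis crit : (\sum_(a <- Y) (dg a - 1))%N = (2 * d - 2)%N.
Hypothesis fiber : forall b, b \in Z -> (\sum_(a <- Y | Fp a == b) dg a)%N = d.
Hypothesis HN : forall k al b, k \in K -> b \in Z ->
  (\sum_(a <- Y | (Fp a == b) && (dir k a == al)) dg a =
    s k al + (if ge k al == be k b then m k al else 0))%N.
Hypothesis HC : forall k al, k \in K ->
  (\sum_(a <- Y | dir k a == al) (dg a - 1) = 2 * s k al + (m k al - 1))%N.
Hypothesis m0 : forall k al, k \in K -> (0 < m k al)%N.
Local Notation adjY := (Adj Y K dir dd).

Lemma Z_two b : exists2 b', b' \in Z & b' != b.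
Proof.
have uZ := fset_uniq Z; have : (3 <= size Z)%N := Z3.
have mZ x : x \in (Z : seq nat) -> x \in Z by [].
case: (Z : seq nat) uZ mZ => [|x [|x' t]] //= /andP[h _] mZ _.
have [e|n] := eqVneq x b; last by exists x => //; apply: mZ; rewrite inE eqxx.
exists x'; first by apply: mZ; rewrite !inE eqxx orbT.
by rewrite -e; apply: contraNneq h => ->; rewrite inE eqxx.
Qed.

(** Let [m], [m'] be the two local degrees and [S] the sum of the two orders [s]. The critical
    points give [2 * d = 2 * S + m + m']; the fibre of [b] gives [d = S] plus the degree of each end
    whose image direction is that of [b]. Both degrees being positive, neither end and both ends are
    impossible, and exactly one forces [m = m']. *)
Lemma edge_count k k' : adjY (inr k) (inr k') ->
  m k (dd k k') = m k' (dd k' k) /\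
  forall b, b \in Z -> (ge k (dd k k') == be k b) = ~~ (ge k' (dd k' k) == be k' b).
Proof.
move=> [kK K' kk H]; set al := dd k k'; set al' := dd k' k.
have sw a : a \in Y -> (dir k a != al) = (dir k' a == al').
  move=> aY; apply/idP/idP => [h|/eqP h].
    by apply/eqP; apply: (dir_dd T).
  by apply/eqP => e; have := H a aY e; rewrite h eqxx.
have split P (F : nat -> nat) : (\sum_(a <- Y | P a) F a =
    \sum_(a <- Y | P a && (dir k a == al)) F a + \sum_(a <- Y | P a && (dir k' a == al')) F a)%N.
  rewrite (bigID (fun a => dir k a == al)) /=; congr (_ + _)%N.
  rewrite big_seq_cond [RHS]big_seq_cond; apply: eq_bigl => a.
  by case: (boolP (a \in _)) => //= aY; rewrite sw.
have hC := split xpredT (fun a => (dg a - 1)%N); rewrite /= crit !HC // in hC.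
have hN b : b \in Z -> (d = s k al + (if ge k al == be k b then m k al else 0) +
    (s k' al' + (if ge k' al' == be k' b then m k' al' else 0)))%N.
  by move=> bZ; rewrite -(fiber bZ) (split (fun a => Fp a == b)) !HN.
have := m0 al kK; have := m0 al' K'; move: hC hN.
move: (m k al) (m k' al') (s k al) (s k' al') => x x' t t' hC hN x0 x0'.
have key b : b \in Z -> x = x' /\ (ge k al == be k b) = ~~ (ge k' al' == be k' b).
  move=> /hN; case: (ge k al == _); case: (ge k' al' == _) => /= e; split=> //; lia.
split; last by move=> b /key[].
by have [b /key[]] := Z_two 0%N.
Qed.

(** The only mark in this direction is [a]. A mark [b] other than [Fp a] has count 0, so the order
    [s] vanishes and the image is not [b]; the count for [Fp a] is then the local degree. *)
Lemma leaf_count k a : adjY (inr k) (inl a) ->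
  m k (dir k a) = dg a /\ forall b, b \in Z -> (ge k (dir k a) == be k b) = (b == Fp a).
Proof.
move=> [kK aY Ha]; set al := dir k a.
have h1 b : b \in Z -> b != Fp a -> (s k al = 0)%N /\ (ge k al == be k b) = false.
  move=> bZ ba; have := HN al kK bZ; rewrite big1_seq.
    by have := m0 al kK; clear; case: ifP => _; lia.
  move=> x /andP[/andP[/eqP xb /eqP xa] xY].
  by move: ba; rewrite -xb (Ha x xY xa) eqxx.
have [b0 b0Z nb0] := Z_two (Fp a); have [s0 _] := h1 _ b0Z nb0.
have : dg a = if ge k al == be k (Fp a) then m k al else 0%N.
  have := HN al kK (FZ aY); rewrite s0 add0n => <-.
  rewrite big_mkcond (bigD1_seq a) ?fset_uniq //= !eqxx /= big1_seq ?addn0 //.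
  move=> x /andP[nx xY]; case: ifP => // /andP[_ /eqP xa].
  by rewrite (Ha x xY xa) eqxx in nx.
case: ifP => [/eqP e hm|_ h]; last by have := dg0 aY; rewrite h.
split=> // b bZ; have [->|n] := eqVneq b (Fp a); first by rewrite e eqxx.
by have [] := h1 _ bZ n.
Qed.

(** Let [q >= 3] be the number of directions of marks, [w] the number of limits of the marks of [Z],
    and [S] and [M] the sums of [s] and [m] over the directions. Critical points give
    [2 * S + M = 2 * d - 2 + q], and the fibres, summed over the limits, give [w * S + M = w * d].
    Hence [(w - 2) * (d - S) = q - 2 > 0] with [S <= d], so [w >= 3]. *)
Lemma three_images k : k \in K ->
  (forall a, a \in Y -> exists2 b, b \in Z & ge k (dir k a) = be k b) ->
  exists b1 b2 b3, [/\ b1 \in Z, b2 \in Z, b3 \in Z &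
    [/\ be k b1 != be k b2, be k b1 != be k b3 & be k b2 != be k b3]].
Proof.
move=> kK good.
pose D := undup [seq dir k a | a <- Y]; pose W := undup [seq be k b | b <- Z].
have uD : uniq D by apply: undup_uniq. have uW : uniq W by apply: undup_uniq.
have mD a : a \in Y -> dir k a \in D by move=> aY; rewrite mem_undup map_f.
have D3 : (3 <= size D)%N.
  have [t1 _ _ _] := T; have [a [b [c [aY bY cY [ab ac bc]]]]] := t1 _ kK.
  apply: (@uniq_leq_size _ [:: dir k a; dir k b; dir k c]).
    by rewrite /= !inE negb_or ab ac bc.
  by move=> x; rewrite !inE => /or3P[] /eqP->; apply: mD.
have byD P (F : nat -> nat) : (\sum_(a <- Y | P a) F a =
    \sum_(al <- D) \sum_(a <- Y | P a && (dir k a == al)) F a)%N.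
  by apply: sum_by_value => // a aY _; apply: mD.
pose S := (\sum_(al <- D) s k al)%N; pose M := (\sum_(al <- D) m k al)%N.
have eC : (2 * S + M = 2 * d - 2 + size D)%N.
  rewrite -crit (byD xpredT) /= -[X in (_ + X)%N]muln1 -[size D]sum1_size.
  rewrite -big_split /= /S /M muln1 big_distrr -big_split /=; apply: eq_bigr => al _.
  by rewrite HC // -addnA; have := m0 al kK; lia.
have eN w : w \in W -> (S + \sum_(al <- D | ge k al == w) m k al = d)%N.
  rewrite mem_undup => /mapP[b bZ ->]; rewrite -(fiber bZ) (byD (fun a => Fp a == b)).
  rewrite /S [X in (_ + X)%N]big_mkcond -big_split /=; apply: eq_bigr => al _.
  by rewrite HN.
have eM : (M = \sum_(w <- W) \sum_(al <- D | ge k al == w) m k al)%N.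
  rewrite /M; apply: (sum_by_value (P := xpredT)) => // al.
  rewrite mem_undup => /mapP[a aY ->] _.
  by have [b bZ ->] := good a aY; rewrite mem_undup map_f.
have W3 : (2 < size W)%N.
  rewrite ltnNge; apply/negP => W2.
  have eM' : (size W * S + M = size W * d)%N.
    rewrite eM -!sum1_size !big_distrl -big_split /= big_seq [RHS]big_seq.
    by apply: eq_bigr => w /eN; rewrite !mul1n.
  have [b bZ _] := Z_two 0%N.
  have Sd : (S <= d)%N by rewrite -(eN (be k b)) ?leq_addr // mem_undup map_f.
  move: eC eM' W2 Sd D3 d0; move: (size W) (size D) => w q.
  by case: w => [|[|[|w]]]; lia.
move: W3 uW (fun x => mem_undup [seq be k b | b <- Z] x); rewrite -/W.
case: W {eN eM} => [|w1 [|w2 [|w3 W]]] //= _ + mW.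
rewrite !inE !negb_or => /and3P[/and3P[n12 n13 _] /andP[n23 _] _].
have h w : w \in [:: w1, w2, w3 & W] -> exists2 b, b \in Z & w = be k b.
  by rewrite mW => /mapP.
have [|b1 b1Z e1] := h w1; first by rewrite !inE eqxx ?orbT.
have [|b2 b2Z e2] := h w2; first by rewrite !inE eqxx ?orbT.
have [|b3 b3Z e3] := h w3; first by rewrite !inE eqxx ?orbT.
by exists b1, b2, b3; rewrite -e1 -e2 -e3.
Qed.

(* A direction missing the images of the marks would force the next vertex to have a single
   image, hence another such direction further on; this cannot go on in a finite tree. *)
Lemma directions_hit k a : k \in K -> a \in Y -> exists2 b, b \in Z & ge k (dir k a) = be k b.
Proof.
have [n] := ubnP #|` fib Y dir k (dir k a)|; elim: n k a => // n IH k a hn kK aY.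
apply: contrapT => bad.
have {}bad b : b \in Z -> ge k (dir k a) != be k b.
  by move=> bZ; apply/eqP => e; apply: bad; exists b.
have [u A e] := neighbor_exists T kK aY.
case: u A e => [a'|k'] A /= e.
  have [_ h] := leaf_count A; have [_ aY' _] := A.
  by have := h _ (FZ aY'); rewrite e eqxx (negbTE (bad _ (FZ aY'))).
have [_ h] := edge_count A; have [_ K' kk H] := A.
have one b : b \in Z -> be k' b = ge k' (dd k' k).
  by move=> bZ; have := h _ bZ; rewrite e (negbTE (bad _ bZ)) => /esym/negbFE/eqP.
have [a2 a2Y bad2] : exists2 a2, a2 \in Y & forall b, b \in Z -> ge k' (dir k' a2) != be k' b.
  apply: contrapT => ne.
  have [a2 a2Y|b1 [b2 [b3 [b1Z b2Z _ [n12 _ _]]]]] := @three_images k' K'.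
    apply: contrapT => ne2; apply: ne; exists a2 => // b bZ; apply/eqP => e2.
    by apply: ne2; exists b.
  by move: n12; rewrite !one // eqxx.
have n2 : dir k' a2 != dd k' k.
  have [b bZ _] := Z_two 0%N; apply: contraTneq (bad2 _ bZ) => e2.
  by rewrite e2 -(one _ bZ) eqxx.
have kk' : k' != k by rewrite eq_sym.
have [|b bZ e2] := IH k' a2 _ K' a2Y; last by have := bad2 _ bZ; rewrite e2 eqxx.
rewrite -ltnS (leq_trans _ hn) // ltnS -e; apply: fib_ltn => [x xY hx|].
  by apply: (dir_dd T K' kK kk' xY); rewrite hx.
have [x xY [x1 x2]] := dir_third T (dd k' k) (dir k' a2) K'.
by exists x => //; split=> //; apply: (dir_dd T K' kK kk' xY).
Qed.

(** Both counts are empty sums, and the local degree is positive. *)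
Lemma off_directions k al : k \in K -> (forall a, a \in Y -> dir k a != al) ->
  [/\ s k al = 0%N, m k al = 1%N & forall b, b \in Z -> ge k al != be k b].
Proof.
move=> kK H; have z P (F : nat -> nat) : (\sum_(a <- Y | P a && (dir k a == al)) F a = 0)%N.
  by rewrite big1_seq // => a /andP[/andP[_ h] aY]; rewrite (negbTE (H a aY)) in h.
have := HC al kK; rewrite (z xpredT) => hC; have := m0 al kK => hm.
split=> [||b bZ]; try by move: hC hm; clear; lia.
by apply/eqP => e; have := HN al kK bZ; rewrite z e eqxx; move: hm; clear; lia.
Qed.

Section Target.
Variables (KZ : {fset nat}) (dirZ ddZ : nat -> nat -> Chat R) (F : nat -> nat).
Hypotheses (TZ : tree_system Z KZ dirZ ddZ) (FK : forall k, k \in K -> F k \in KZ).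
Hypothesis beF : forall k, k \in K -> be k = dirZ (F k).

Definition cover_vertex (u : vtx) : vtx :=
  match u with inl a => inl (Fp a) | inr k => inr (F k) end.

Lemma cover_leaf k a : adjY (inr k) (inl a) ->
  Adj Z KZ dirZ ddZ (inr (F k)) (inl (Fp a)) /\ ge k (dir k a) = dirZ (F k) (Fp a).
Proof.
move=> A; have [kK aY _] := A; have [_ h] := leaf_count A.
have e : ge k (dir k a) = dirZ (F k) (Fp a).
  by apply/eqP; rewrite -beF // h ?eqxx ?FZ.
split=> //; split=> [||b bZ eb]; rewrite ?FK ?FZ //.
by apply/eqP; rewrite -h // beF // e eb.
Qed.

Lemma cover_edge k k' : adjY (inr k) (inr k') ->
  Adj Z KZ dirZ ddZ (inr (F k)) (inr (F k')) /\ ge k (dd k k') = ddZ (F k) (F k').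
Proof.
move=> A; have [_ h] := edge_count A; have [kK K' kk _] := A.
have ne : F k != F k'.
  apply/eqP => eF.
  (* If both ends had the same image vertex, this mark of [Z] would avoid both image directions,
     against [edge_count]. *)
  have [b bZ [b1 b2]] := dir_third TZ (ge k (dd k k')) (ge k' (dd k' k)) (FK kK).
  have := h b bZ; rewrite !beF // -eF (eq_sym (ge k _)) (eq_sym (ge k' _)).
  by rewrite (negbTE b1) (negbTE b2).
have ne' : F k' != F k by rewrite eq_sym.
have e1 : ge k (dd k k') = ddZ (F k) (F k').
  have [b bZ [b1 b2]] := dir_third TZ (ge k' (dd k' k)) (ddZ (F k') (F k)) (FK K').
  have := h b bZ; rewrite !beF // (eq_sym (ge k' _)) b1 => /eqP->.
  exact: (dir_dd TZ (FK K') (FK kK) ne' bZ b2).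
have e2 : ge k' (dd k' k) = ddZ (F k') (F k).
  have [b bZ [b1 b2]] := dir_third TZ (ge k (dd k k')) (ddZ (F k) (F k')) (FK kK).
  have := h b bZ; rewrite !beF // (eq_sym (ge k _)) (negbTE b1) => /esym/negbFE/eqP->.
  exact: (dir_dd TZ (FK kK) (FK K') ne bZ b2).
split=> //; split=> //; rewrite ?FK // => b bZ eb.
by have := h b bZ; rewrite !beF // e1 e2 eb eqxx eq_sym => /esym.
Qed.

End Target.
End CoverCounting.

(** * Construction of the limit cover *)

Section FullMarkings.
Variable R : realType.

Definition base_points : seq (Chat R) := [:: Some 0; Some 1; None].

Lemma base_points_uniq : uniq base_points.
Proof.
rewrite /= !inE /= !andbT; apply/negP => /orP[/eqP[] /eqP|//].
by rewrite eq_sym oner_eq0.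
Qed.

(** The base points come first, so that the labels 0, 1, 2 name the same points in [Y] and in
    [Z]. *)
Definition with_base (s : seq (Chat R)) :=
  base_points ++ [seq x <- undup s | x \notin base_points].

Lemma with_base_uniq s : uniq (with_base s).
Proof.
rewrite cat_uniq base_points_uniq filter_uniq ?undup_uniq // andbT /=.
by apply/hasPn => x; rewrite mem_filter => /andP[].
Qed.

Lemma mem_with_base s x : (x \in with_base s) = (x \in base_points) || (x \in s).
Proof. by rewrite mem_cat mem_filter mem_undup; case: (x \in base_points). Qed.

Lemma size_with_base s : (3 <= size (with_base s) <= 3 + size s)%N.
Proof.
rewrite size_cat leq_addr leq_add2l size_filter (leq_trans (count_size _ _)) //.
exact: size_undup.
Qed.

Lemma nth_with_base s a : (a < 3)%N -> nth None (with_base s) a = nth None base_points a.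
Proof. by move=> a3; rewrite nth_cat a3. Qed.

Variables (d : nat) (f : ratmap R).
Hypotheses (rf : is_rat f) (df : rdeg f = d) (d0 : (0 < d)%N).

Lemma form_points N (p : {poly R[i]}) : p != 0 -> (size p <= N.+1)%N ->
  exists2 s : seq (Chat R), size s = N & forall x, (x \in s) = (0 < fmul N p x)%N.
Proof.
move=> p0 sp; have [s [k [ss k0 Dp]]] := form_factor p0 sp.
exists s => // x; have := @fmul_dprod _ _ id (fun=> 1%N) s xpredT x.
by rewrite !sum1_count count_predT ss /= -has_pred1 has_count => <-; rewrite Dp fmulZ.
Qed.

(** The bounds depend on [d] and the number of points only, so the sizes can be made constant along
    a sequence of maps. [B] bounds the number of images put into [LZ]: those of the base points, of
    [pts] and of the at most [2 * d - 2] critical points; each point of [LZ] has at most [d]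
    preimages. *)
Lemma full_marking (pts : seq (Chat R)) : exists LY LZ : seq (Chat R),
  let B := (3 + size pts + (2 * d - 2))%N in
  [/\ [/\ uniq LY, uniq LZ, (3 <= size LY <= 3 + size pts + 3 * d + B * d)%N &
          (3 <= size LZ <= 6 + B)%N],
      forall a, (a < 3)%N -> nth None LY a = nth None LZ a,
      forall x, x \in pts -> x \in LY,
      forall x, (x \in LY) = (ev f x \in LZ) &
      forall x, local_deg f x <> 1%N -> x \in LY].
Proof.
have d0' : (0 < rdeg f)%N by rewrite df.
have [w0 sw] := wr_form rf d0'.
have [cr scr crE] := form_points w0 sw.
have fibP b : exists s : seq (Chat R), size s = d /\ forall x, (x \in s) = (ev f x == b).
  have [s ss sE] := form_points (pw_neq0 rf d0' (hat_neq0 b)) (size_pw _ _).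
  exists s; rewrite ss df; split=> // x; rewrite sE fmul_pw //.
  by case: eqP => // _; rewrite local_deg_gt0.
have [fb fbP] := boolp.choice fibP.
pose LZ := with_base ([seq ev f x | x <- base_points ++ pts] ++ [seq ev f x | x <- cr]).
pose LY := with_base (pts ++ flatten [seq fb b | b <- LZ]).
exists LY, LZ => B.
have /andP[z1 z2] := size_with_base ([seq ev f x | x <- base_points ++ pts] ++ [seq ev f x | x <- cr]).
have sLZ : (size LZ <= 6 + (size pts + (2 * d - 2)))%N.
  by apply: leq_trans z2 _; rewrite size_cat !size_map size_cat scr df /=; lia.
have LYE x : (x \in LY) = (ev f x \in LZ).
  have fl : (x \in flatten [seq fb b | b <- LZ]) = (ev f x \in LZ).
    apply/flattenP/idP => [[s /mapP[b bZ ->]]|h].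
      by rewrite (fbP b).2 => /eqP->.
    by exists (fb (ev f x)); [apply: map_f|rewrite (fbP _).2].
  rewrite mem_with_base mem_cat fl orbA.
  case: (boolP ((x \in base_points) || (x \in pts))) => //= h; apply/esym.
  have hx : x \in base_points ++ pts by rewrite mem_cat.
  by rewrite mem_with_base mem_cat (map_f (ev f) hx) orbT.
split=> //.
- split; rewrite ?with_base_uniq //.
  + have /andP[-> h] := size_with_base (pts ++ flatten [seq fb b | b <- LZ]).
    apply: leq_trans h _; rewrite size_cat size_flatten /shape -map_comp.
    have -> : sumn [seq (size \o fb) b | b <- LZ] = (size LZ * d)%N.
      by elim: (LZ) => //= b s ->; rewrite (fbP b).1 mulSn.
    move: sLZ; rewrite /B; move: (size LZ) (size pts) => x t.
    rewrite -(leq_pmul2r d0); nia.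
  + apply/andP; split; first exact: z1.
    by apply: leq_trans sLZ _; rewrite /B; move: (size pts) => x; lia.
- by move=> a a3; rewrite !nth_with_base.
- by move=> x xp; rewrite mem_with_base mem_cat xp orbT.
- move=> x h; rewrite LYE mem_with_base !mem_cat (map_f (ev f) (s := cr)) ?orbT //.
  rewrite crE fmul_wr //; have := local_deg_gt0 x rf d0'.
  by move: h; lia.
Qed.

End FullMarkings.

(** * From limits along the ultrafilter to limits of a subsequence *)

Section PlainLimits.
Variables (R : realType) (U : set_system nat).
Hypotheses (UU : UltraFilter U) (Uinf : forall N, U [set n | (N <= n)%N]%classic).
Local Notation C := R[i].
Local Notation vec := (C * C)%type.
Local Open Scope classical_set_scope.

Lemma extract_subsequence (Q : nat -> nat -> Prop) : (forall m, U (Q m)) ->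
  exists sigma : nat -> nat, (forall n, (sigma n < sigma n.+1)%N) /\ forall n, Q n (sigma n).
Proof.
move=> H; have h (mN : nat * nat) : exists n, (mN.2 < n)%N /\ Q mN.1 n.
  by have [n [h1 h2]] := ultra_meet UU (Uinf mN.2.+1) (H mN.1); exists n.
have [g Hg] := boolp.choice h.
pose fix sig n := if n is n'.+1 then g (n, sig n') else g (0%N, 0%N).
exists sig; split=> [n|[|n]]; first exact: (Hg (n.+1, sig n)).1.
  exact: (Hg (0%N, 0%N)).2.
exact: (Hg (n.+1, sig n)).2.
Qed.

Lemma small_inverse (e : R) : 0 < e -> exists N, forall n, (N <= n)%N -> n.+1%:R^-1 < e.
Proof.
move=> e0; exists (Num.truncn e^-1) => n hn.
rewrite invf_plt ?posrE ?ltr0n //; apply: lt_le_trans (truncnS_gt _) _.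
by rewrite ler_nat ltnS.
Qed.

Lemma inverse_bound (r : nat -> R) : (forall n, r n < n.+1%:R^-1) ->
  forall e, 0 < e -> exists N, forall n, (N <= n)%N -> r n < e.
Proof.
move=> H e /small_inverse[N HN]; exists N => n hn.
exact: lt_trans (H n) (HN n hn).
Qed.

Lemma chordxx (z : Chat R) : chord z z = 0.
Proof.
rewrite chord_hat; have /eqP-> : wedge (hat z) (hat z) == 0 by rewrite wedge_hat.
by rewrite cmod0 mulr0 mul0r.
Qed.

(** Uniformity comes from compactness. Points at which the estimate fails for arbitrarily late
    indices have a limit along [U]; staying [dlt] away from [A], they and their limit are directions
    where [s] vanishes, and there both sides tend to the same value of [g]. *)
Lemma forms_lu_cvg d (f : nat -> ratmap R) (phi psi : nat -> 'M[C]_2) (lam : nat -> C)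
    (P Q : {poly C}) (g : ratmap R) (s : Chat R -> nat) (A : Chat R -> Prop) :
  (forall n, is_rat (f n) /\ rdeg (f n) = d) ->
  (forall n, phi n \in unitmx) -> (forall n, psi n \in unitmx) -> (forall n, lam n != 0) ->
  (size P <= d.+1)%N -> (size Q <= d.+1)%N ->
  (forall n i, (i < d.+1)%N ->
     cmod ((lam n *: rnum (tmap (psi n) (invmx (phi n)) (f n)))`_i - P`_i) < n.+1%:R^-1 /\
     cmod ((lam n *: rden (tmap (psi n) (invmx (phi n)) (f n)))`_i - Q`_i) < n.+1%:R^-1) ->
  (forall al, s al = 0%N -> (hev d P (hat al), hev d Q (hat al)) != 0 :> vec /\
     ev g al = proj (hev d P (hat al), hev d Q (hat al))) ->
  (forall al, s al <> 0%N -> A al) ->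
  lu_cvg (fun n => mob (psi n) \o ev (f n) \o mob (invmx (phi n))) (ev g) A.
Proof.
move=> rf hu pu l0 sP sQ cf gE sA dlt e dl0 e0; apply: contrapT => bad.
have bad1 N : exists nz : nat * Chat R, [/\ (N <= nz.1)%N,
    forall a, A a -> dlt <= chord nz.2 a &
    ~ chord (mob (psi nz.1) (ev (f nz.1) (mob (invmx (phi nz.1)) nz.2))) (ev g nz.2) < e].
  apply: contrapT => ne; apply: bad; exists N => n z hn hz; apply: contrapT => h.
  by apply: ne; exists (n, z).
have [nz Hnz] := boolp.choice bad1.
pose nn N := (nz N).1; pose zz N := (nz N).2.
have [z0 cz0] := pcv_exists UU zz; have [mu mu0 cz] := cz0.
have szz N : s (zz N) = 0%N.
  apply/eqP; apply: contraT => /eqP/sA h.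
  by have [_ /(_ _ h)] := Hnz N; rewrite chordxx leNgt dl0.
have sz0 : s z0 = 0%N.
  apply/eqP; apply: contraT => /eqP/sA h.
  have [N] := filter_ex (pcv_chord UU cz0 (pcv_cst UU z0) dl0).
  by rewrite /= ltNge; have [_ /(_ _ h)->] := Hnz N.
have [v0 gz0] := gE _ sz0.
pose t N := tmap (psi (nn N)) (invmx (phi (nn N))) (f (nn N)).
have st N := size_tmap (psi (nn N)) (invmx (phi (nn N))) (f (nn N)).
have pc (num : ratmap R -> {poly C}) (W : {poly C}) : (size W <= d.+1)%N ->
    (forall N, (size (num (t N)) <= d.+1)%N) ->
    (forall n i, (i < d.+1)%N -> cmod ((lam n *: num (tmap (psi n) (invmx (phi n)) (f n)))`_i - W`_i)
       < n.+1%:R^-1) -> polcv U (fun N => lam (nn N) *: num (t N)) W.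
  move=> sW sn H i; have [hi|hi] := ltnP i d.+1; last first.
    rewrite nth_default ?(leq_trans sW) //; apply: (ucv_near UU) (ucv_cst UU 0).
    apply: filterS filterT => N _ /=.
    by rewrite coefZ [X in _ * X]nth_default ?mulr0 // (leq_trans (sn N)).
  move=> e1 /small_inverse[N HN]; apply: filterS (Uinf N) => n /= hn.
  apply: lt_trans (H _ _ hi) (HN _ _).
  by apply: leq_trans hn _; have [] := Hnz n.
have cP : polcv U (fun N => lam (nn N) *: rnum (t N)) P.
  apply: pc => // [N|n i /(cf n)[]//]; by have [] := st N; rewrite (rf _).2.
have cQ : polcv U (fun N => lam (nn N) *: rden (t N)) Q.
  apply: pc => // [N|n i /(cf n)[]//]; by have [] := st N; rewrite (rf _).2.
have cw : vcv U (fun N => (hev d (lam (nn N) *: rnum (t N)) (scv (mu N) (hat (zz N))),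
                          hev d (lam (nn N) *: rden (t N)) (scv (mu N) (hat (zz N)))))
            (hev d P (hat z0), hev d Q (hat z0)).
  by split; apply: (polcv_hev UU).
have cg : vcv U (fun N => (hev d P (scv (mu N) (hat (zz N))), hev d Q (scv (mu N) (hat (zz N)))))
            (hev d P (hat z0), hev d Q (hat z0)).
  by split; apply: (polcv_hev UU) => //; apply: (polcv_cst UU).
have c1 : pcv U (fun N => mob (psi (nn N)) (ev (f (nn N)) (mob (invmx (phi (nn N))) (zz N)))) (ev g z0).
  rewrite gz0; apply: (pcv_near UU) (pcv_proj UU cw v0).
  apply: filterS filterT => N _; rewrite /mkset /t; have [rN dN] := rf (nn N).
  have iu : invmx (phi (nn N)) \in unitmx by rewrite unitmx_inv.
  have [rt dt] := tmap_rat rN (pu (nn N)) iu.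
  rewrite -ev_tmap // evE // /fpair dt dN !hevZ !hev_scv.
  rewrite -[RHS](proj_scv _ (k := lam (nn N) * mu N ^+ d)) ?mulf_neq0 ?expf_neq0 //.
  by congr proj; congr (_, _); rewrite mulrA.
have c2 : pcv U (fun N => ev g (zz N)) (ev g z0).
  rewrite gz0; apply: (pcv_near UU) (pcv_proj UU cg v0).
  apply: filterS filterT => N _ /=; rewrite (gE _ (szz N)).2 !hev_scv.
  by rewrite -[RHS](proj_scv _ (k := mu N ^+ d)) ?expf_neq0.
have [N h] := filter_ex (pcv_chord UU c1 c2 e0).
by have [_ _] := Hnz N; apply.
Qed.

End PlainLimits.

Section LimitCover.
Variables (R : realType) (U : set_system nat).
Hypothesis UU : UltraFilter U.
Local Notation C := R[i].
Local Notation vec := (C * C)%type.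
Local Open Scope classical_set_scope.
Variables (d : nat) (f : nat -> ratmap R).
Hypotheses (d0 : (0 < d)%N) (rf : forall n, is_rat (f n) /\ rdeg (f n) = d).

(** Sizes, indices of images, local degrees and labels of the prescribed points are bounded
    independently of [n], hence constant along [U]. *)
Lemma ultra_marking (J : finType) (pt : J -> nat -> Chat R) :
  exists (NY NZ : nat) (Fp dg : nat -> nat) (y z : nat -> nat -> Chat R) (lab : J -> nat),
  [/\ (3 <= NY)%N /\ (3 <= NZ)%N,
      U [set n | complete_marking d (labels NY) (labels NZ) Fp dg (f n) (y n) (z n)],
      forall n a, (a < 3)%N -> y n a = z n a &
      forall j, lab j \in labels NY /\ U [set n | y n (lab j) = pt j n]].
Proof.
pose B := (3 + #|J| + (2 * d - 2))%N.
have H n : exists L : seq (Chat R) * seq (Chat R),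
  [/\ [/\ uniq L.1, uniq L.2, (3 <= size L.1 <= 3 + #|J| + 3 * d + B * d)%N &
          (3 <= size L.2 <= 6 + B)%N],
      forall a, (a < 3)%N -> nth None L.1 a = nth None L.2 a,
      forall j, pt j n \in L.1,
      forall x, (x \in L.1) = (ev (f n) x \in L.2) &
      forall x, local_deg (f n) x <> 1%N -> x \in L.1].
  have [LY [LZ]] := full_marking (rf n).1 (rf n).2 d0 [seq pt j n | j <- enum J].
  rewrite /= size_map -cardE => -[h1 h2 h3 h4 h5]; exists (LY, LZ); split=> // j.
  by apply: h3; apply: map_f; rewrite mem_enum.
have {H}[L HL] := boolp.choice H.
pose y n a := nth None (L n).1 a; pose z n a := nth None (L n).2 a.
have [NY eNY] : exists m, U [set n | size (L n).1 = m].
  apply: (ultra_bounded_nat UU (B := 3 + #|J| + 3 * d + B * d)%N).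
  by apply: filterS filterT => n _ /=; have [[_ _ /andP[]]] := HL n.
have [NZ eNZ] : exists m, U [set n | size (L n).2 = m].
  apply: (ultra_bounded_nat UU (B := 6 + B)%N).
  by apply: filterS filterT => n _ /=; have [[_ _ _ /andP[]]] := HL n.
have [Fp HFp] : exists Fp : nat -> nat, forall a,
    U [set n | index (ev (f n) (y n a)) (L n).2 = Fp a].
  suff h a : exists m, U [set n | index (ev (f n) (y n a)) (L n).2 = m].
    by have [Fp] := boolp.choice h; exists Fp.
  apply: (ultra_bounded_nat UU (B := 6 + B)%N); apply: filterS filterT => n _ /=.
  by have [[_ _ _ /andP[_ h]] _ _ _ _] := HL n; apply: leq_trans (index_size _ _) h.
have [dg Hdg] : exists dg : nat -> nat, forall a, U [set n | local_deg (f n) (y n a) = dg a].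
  suff h a : exists m, U [set n | local_deg (f n) (y n a) = m].
    by have [dg] := boolp.choice h; exists dg.
  apply: (ultra_bounded_nat UU (B := d)); apply: filterS filterT => n _ /=.
  by rewrite -[X in (_ <= X)%N](rf n).2; apply: local_deg_le; rewrite ?(rf n).2 //; exact: (rf n).1.
have [lab Hlab] : exists lab : J -> nat, forall j, U [set n | index (pt j n) (L n).1 = lab j].
  suff h j : exists m, U [set n | index (pt j n) (L n).1 = m].
    by have [lab] := boolp.choice h; exists lab.
  apply: (ultra_bounded_nat UU (B := 3 + #|J| + 3 * d + B * d)%N); apply: filterS filterT => n _ /=.
  by have [[_ _ /andP[_ h] _] _ _ _ _] := HL n; apply: leq_trans (index_size _ _) h.
exists NY, NZ, Fp, dg, y, z, lab; split.
- have [n [/= e1 e2]] := ultra_meet UU eNY eNZ.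
  by have [[_ _ /andP[h1 _] /andP[h2 _]] _ _ _ _] := HL n; rewrite -e1 -e2.
- have HF := ultra_all UU (s := labels NY) (fun a _ => HFp a).
  have HD := ultra_all UU (s := labels NY) (fun a _ => Hdg a).
  apply: filterS (filterI (filterI eNY eNZ) (filterI HF HD)) => n [[/= sY sZ] [/= hF hD]].
  have [[uY uZ _ _] _ _ LE crt] := HL n.
  split; [exact: rf| | | |].
  + split=> a b; rewrite !in_labels => ha hb /eqP; rewrite nth_uniq ?sY ?sZ // => /eqP //.
  + move=> a aY; have aY' : (a < size (L n).1)%N by rewrite sY -in_labels.
    have ein : ev (f n) (y n a) \in (L n).2 by rewrite -LE mem_nth.
    rewrite -(hF a aY) -(hD a aY); split=> //; last by rewrite /z nth_index.
    by rewrite in_labels -sZ index_mem.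
  + move=> x b; rewrite in_labels => bZ e.
    have xin : x \in (L n).1 by rewrite LE e mem_nth // sZ.
    exists (index x (L n).1); first by rewrite in_labels -sY index_mem.
    by rewrite /y nth_index.
  + move=> x /crt xin; exists (index x (L n).1); first by rewrite in_labels -sY index_mem.
    by rewrite /y nth_index.
- by move=> n a a3; have [_ h _ _ _] := HL n; apply: h.
- move=> j; split.
    have [n [/= e1 e2]] := ultra_meet UU eNY (Hlab j).
    by have [_ _ h _ _] := HL n; rewrite in_labels -e1 -e2 index_mem.
  by apply: filterS (Hlab j) => n /= <-; have [_ _ h _ _] := HL n; rewrite /y nth_index.
Qed.

Variables (NY NZ : nat) (Fp dg : nat -> nat) (y z : nat -> nat -> Chat R).
Hypotheses (NZ3 : (3 <= NZ)%N).
Hypothesis mk : U [set n | complete_marking d (labels NY) (labels NZ) Fp dg (f n) (y n) (z n)].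

Lemma marking_portrait : portrait d (labels NY) (labels NZ) Fp dg.
Proof.
have [n mkn] := filter_ex mk; have [[rn dn] _ yz _ _] := mkn.
split.
- by move=> a /yz[].
- by move=> a /yz[_ _ <-]; apply: local_deg_gt0; rewrite // dn.
- exact: (marking_wr d0 (fset_uniq _) mkn).1.
- by move=> b bZ; have [] := marking_fiber d0 (fset_uniq _) mkn bZ (hat_neq0 (z n b)) (hatK _).
Qed.

Variables (KY KZ : {fset nat}) (phiY phiZ : nat -> nat -> 'M[C]_2).
Variables (dirY ddY dirZ ddZ : nat -> nat -> Chat R).
Hypotheses (TY : tree_system (labels NY) KY dirY ddY) (TZ : tree_system (labels NZ) KZ dirZ ddZ).
Hypotheses (uY : forall k, U [set n | phiY n k \in unitmx])
           (uZ : forall k, U [set n | phiZ n k \in unitmx]).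
Hypotheses (cY : forall k a, pcv U (fun n => mob (phiY n k) (y n a)) (dirY k a))
           (cZ : forall k b, pcv U (fun n => mob (phiZ n k) (z n b)) (dirZ k b)).

Lemma vertex_image k : k \in KY -> exists k' P Q,
  k' \in KZ /\ reduces U f (phiY^~ k) (phiZ^~ k') P Q.
Proof.
(* The reduction is done at all vertices at once, because [directions_hit] at [k] walks through
   other vertices and uses their counts. *)
have H l : exists t : (nat -> 'M[C]_2) * {poly C} * {poly C} * (nat -> Chat R) * ratmap R *
    (Chat R -> nat), let: (psi, P, Q, be, g, s) := t in
  [/\ U [set n | psi n \in unitmx] /\ reduces U f (phiY^~ l) psi P Q,
      forall b, pcv U (fun n => mob (psi n) (z n b)) (be b),
      is_rat g /\ (0 < rdeg g)%N,
      forall al b, b \in labels NZ ->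
        (\sum_(a <- labels NY | (Fp a == b) && (dirY l a == al)) dg a =
          s al + (if ev g al == be b then local_deg g al else 0))%N &
      forall al, (\sum_(a <- labels NY | dirY l a == al) (dg a - 1) =
        2 * s al + (local_deg g al - 1))%N].
  have [psi [P [Q [pu red]]]] := reduces_exists UU d0 rf (uY l).
  have [be Hbe] := boolp.choice (fun b => pcv_exists UU (fun n => mob (psi n) (z n b))).
  have [g [s [rg hN hC _]]] := reduction_counts UU d0 rf (fset_uniq _) mk (uY l) pu red (cY l) Hbe.
  by exists (psi, P, Q, be, g, s).
have [t Ht] := boolp.choice H => kK.
pose be l := (t l).1.1.2; pose g l := (t l).1.2; pose s l := (t l).2.
have [p1 p2 p3 p4] := marking_portrait.
have card3 : (3 <= #|` labels NZ|%fset)%N by rewrite card_labels.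
have hN l al b : l \in KY -> b \in labels NZ ->
    (\sum_(a <- labels NY | (Fp a == b) && (dirY l a == al)) dg a =
      s l al + (if ev (g l) al == be l b then local_deg (g l) al else 0))%N.
  move=> _; have := Ht l; rewrite /be /g /s; case: (t l) => [[[[[psi P] Q] be'] g'] s'].
  by move=> [_ _ _ h _]; apply: h.
have hC l al : l \in KY -> (\sum_(a <- labels NY | dirY l a == al) (dg a - 1) =
      2 * s l al + (local_deg (g l) al - 1))%N.
  move=> _; have := Ht l; rewrite /be /g /s; case: (t l) => [[[[[psi P] Q] be'] g'] s'].
  by move=> [_ _ _ _ h]; apply: h.
have hm l al : l \in KY -> (0 < local_deg (g l) al)%N.
  move=> _; have := Ht l; rewrite /be /g /s; case: (t l) => [[[[[psi P] Q] be'] g'] s'].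
  by move=> [_ _ [h1 h2] _ _]; apply: local_deg_gt0.
have hit a : a \in labels NY -> exists2 b, b \in labels NZ & ev (g k) (dirY k a) = be k b.
  exact: (directions_hit TY d0 card3 p1 p2 p3 p4 hN hC hm kK).
have [b1 [b2 [b3 [Z1 Z2 Z3 [n12 n13 n23]]]]] :=
  three_images TY d0 card3 p3 p4 hN hC hm kK hit.
have [_ _ t3 _] := TZ.
have m12 : b1 != b2 by apply: contraNneq n12 => ->.
have m13 : b1 != b3 by apply: contraNneq n13 => ->.
have m23 : b2 != b3 by apply: contraNneq n23 => ->.
have [k' K' sep] := t3 _ _ _ Z1 Z2 Z3 m12 m13 m23.
have := Ht k; rewrite /be in n12 n13 n23; case: (t k) n12 n13 n23 => [[[[[psi P] Q] be'] g'] s'] /=.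
move=> n12 n13 n23 [[pu red] cb _ _ _].
(* The same three marks are distinct in [psi] and at [k'], so [psi] can be exchanged for the frame
   of [k']. *)
have [lam [B [l0 Bu cB]]] := frames_equivalent UU (uZ k') pu cb (cZ k') (And3 n12 n13 n23) sep.
by do 3 eexists; split; [exact: K'|exact: (reduces_change UU red pu l0 Bu cB)].
Qed.

(** The counts are taken again with the frame of the image vertex as target coordinate; the limits
    of the marks of [Z] are then the directions [dirZ (F k)] of the target tree. *)
Lemma vertex_maps : exists (F : nat -> nat) (lam : nat -> nat -> C) (P Q : nat -> {poly C})
    (g : nat -> ratmap R) (s : nat -> Chat R -> nat), forall k, k \in KY ->
  [/\ [/\ F k \in KZ, forall n, lam k n != 0, (size (P k) <= d.+1)%N & (size (Q k) <= d.+1)%N],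
      polcv U (fun n => lam k n *: rnum (tmap (phiZ n (F k)) (invmx (phiY n k)) (f n))) (P k) /\
      polcv U (fun n => lam k n *: rden (tmap (phiZ n (F k)) (invmx (phiY n k)) (f n))) (Q k),
      is_rat (g k) /\ (0 < rdeg (g k))%N,
      (forall al b, b \in labels NZ ->
        (\sum_(a <- labels NY | (Fp a == b) && (dirY k a == al)) dg a =
          s k al + (if ev (g k) al == dirZ (F k) b then local_deg (g k) al else 0))%N) /\
      (forall al, (\sum_(a <- labels NY | dirY k a == al) (dg a - 1) =
        2 * s k al + (local_deg (g k) al - 1))%N) &
      forall al, s k al = 0%N -> (hev d (P k) (hat al), hev d (Q k) (hat al)) != 0 :> vec /\
          ev (g k) al = proj (hev d (P k) (hat al), hev d (Q k) (hat al))].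
Proof.
have H k : exists t : nat * (nat -> C) * {poly C} * {poly C} * ratmap R * (Chat R -> nat),
  let: (k', lam, P, Q, g, s) := t in k \in KY ->
  [/\ [/\ k' \in KZ, forall n, lam n != 0, (size P <= d.+1)%N & (size Q <= d.+1)%N],
      polcv U (fun n => lam n *: rnum (tmap (phiZ n k') (invmx (phiY n k)) (f n))) P /\
      polcv U (fun n => lam n *: rden (tmap (phiZ n k') (invmx (phiY n k)) (f n))) Q,
      is_rat g /\ (0 < rdeg g)%N,
      (forall al b, b \in labels NZ ->
        (\sum_(a <- labels NY | (Fp a == b) && (dirY k a == al)) dg a =
          s al + (if ev g al == dirZ k' b then local_deg g al else 0))%N) /\
      (forall al, (\sum_(a <- labels NY | dirY k a == al) (dg a - 1) =
        2 * s al + (local_deg g al - 1))%N) &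
      forall al, s al = 0%N -> (hev d P (hat al), hev d Q (hat al)) != 0 :> vec /\
          ev g al = proj (hev d P (hat al), hev d Q (hat al))].
  have [kK|nK] := boolP (k \in KY); last first.
    by exists (0%N, fun=> 0, 0, 0, f 0%N, fun=> 0%N).
  have [k' [P [Q [K' red]]]] := vertex_image kK.
  have [g [s [rg hN hC hE]]] :=
    reduction_counts UU d0 rf (fset_uniq _) mk (uY k) (uZ k') red (cY k) (cZ k').
  have [[lam l0 cc] _] := red; have [sP sQ] := reduces_size UU rf red.
  by exists (k', lam, P, Q, g, s).
have [t Ht] := boolp.choice H.
exists (fun k => (t k).1.1.1.1.1), (fun k => (t k).1.1.1.1.2), (fun k => (t k).1.1.1.2),
  (fun k => (t k).1.1.2), (fun k => (t k).1.2), (fun k => (t k).2) => k kK.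
by have := Ht k; case: (t k) => [[[[[k' lam] P] Q] g] s] /(_ kK).
Qed.

End LimitCover.

(** The tree of [X]: a star with the three base points as leaves and the shared frame 0 as
    centre. *)
Lemma three_point_system (R : realType) (dir dd : nat -> nat -> Chat R) :
  dir 0%N 0%N = Some 0 -> dir 0%N 1%N = Some 1 -> dir 0%N 2%N = None ->
  tree_system (labels 3) [fset 0%N]%fset dir dd.
Proof.
move=> e0 e1 e2.
have inj a b : a \in labels 3 -> b \in labels 3 -> a != b -> dir 0%N a != dir 0%N b.
  rewrite !in_labels; case: a b => [|[|[|a]]] // [|[|[|b]]] // _ _ _; rewrite ?e0 ?e1 ?e2 //.
    by apply/eqP => -[] /eqP; rewrite eq_sym oner_eq0.
  by apply/eqP => -[] /eqP; rewrite oner_eq0.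
split.
- move=> k; rewrite in_fset1 => /eqP->; exists 0%N, 1%N, 2%N.
  by split; rewrite ?in_labels //; split; apply: inj; rewrite ?in_labels.
- by move=> k k'; rewrite !in_fset1 => /eqP-> /eqP->; rewrite eqxx.
- move=> a b c aY bY cY ab ac bc; exists 0%N; first by rewrite in_fset1.
  by split; apply: inj.
- by rewrite card_labels.
Qed.

(** * The cover between the two limit trees *)

Section CoverAssembly.
Variable R : realType.
Variables (d : nat) (Y Z KY KZ : {fset nat}) (dirY ddY dirZ ddZ : nat -> nat -> Chat R).
Variables (Fp dg F : nat -> nat) (g : nat -> ratmap R) (s : nat -> Chat R -> nat).
Hypotheses (TY : tree_system Y KY dirY ddY) (TZ : tree_system Z KZ dirZ ddZ).
Hypotheses (d0 : (0 < d)%N) (por : portrait d Y Z Fp dg).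
Hypothesis FK : forall k, k \in KY -> F k \in KZ.
Hypothesis rg : forall k, k \in KY -> is_rat (g k) /\ (0 < rdeg (g k))%N.
Hypothesis HN : forall k al b, k \in KY -> b \in Z ->
  (\sum_(a <- Y | (Fp a == b) && (dirY k a == al)) dg a =
    s k al + (if ev (g k) al == dirZ (F k) b then local_deg (g k) al else 0))%N.
Hypothesis HC : forall k al, k \in KY ->
  (\sum_(a <- Y | dirY k a == al) (dg a - 1) = 2 * s k al + (local_deg (g k) al - 1))%N.
Local Notation SY := (system_tree Y KY dirY ddY).
Local Notation SZ := (system_tree Z KZ dirZ ddZ).

Definition vertex_map (u : vtx) : ratmap R := if u is inr k then g k else g 0%N.

Let Z3 : (3 <= #|` Z|%fset)%N. Proof. by case: TZ. Qed.
Let hm k al : k \in KY -> (0 < local_deg (g k) al)%N.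
Proof. by move=> /rg[h1 h2]; apply: local_deg_gt0. Qed.
Let FZ a : a \in Y -> Fp a \in Z. Proof. by case: por => h _ _ _; apply: h. Qed.
Let dg0 a : a \in Y -> (0 < dg a)%N. Proof. by case: por => _ h _ _; apply: h. Qed.
Let crit : (\sum_(a <- Y) (dg a - 1))%N = (2 * d - 2)%N. Proof. by case: por. Qed.
Let fiber b : b \in Z -> (\sum_(a <- Y | Fp a == b) dg a)%N = d.
Proof. by case: por => _ _ _ h; apply: h. Qed.
Let beF k : k \in KY -> dirZ (F k) = dirZ (F k). Proof. by []. Qed.

Lemma assembled_edge u w : Adj Y KY dirY ddY u w ->
  Adj Z KZ dirZ ddZ (cover_vertex Fp F u) (cover_vertex Fp F w).
Proof.
case: u w => [a|k] [b|k'] //= A.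
- apply: (@Adj_sym _ _ _ _ _ (inr (F k')) (inl (Fp a))).
  exact: (cover_leaf Z3 FZ dg0 HN hm ddZ FK beF (A : Adj _ _ _ ddY (inr k') (inl a))).1.
- exact: (cover_leaf Z3 FZ dg0 HN hm ddZ FK beF (A : Adj _ _ _ ddY (inr k) (inl b))).1.
- exact: (cover_edge TY d0 Z3 crit fiber HN HC hm TZ FK beF (A : Adj _ _ _ ddY (inr k) (inr k'))).1.
Qed.

Lemma assembled_point k u : Adj Y KY dirY ddY (inr k) u ->
  ev (g k) (towards dirY ddY k u) = towards dirZ ddZ (F k) (cover_vertex Fp F u).
Proof.
case: u => [a|k'] A /=.
- exact: (cover_leaf Z3 FZ dg0 HN hm ddZ FK beF A).2.
- exact: (cover_edge TY d0 Z3 crit fiber HN HC hm TZ FK beF A).2.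
Qed.

Lemma assembled_off k al : k \in KY ->
  (forall w, adj SY (inr k) w -> al <> att SY (inr k) w) ->
  [/\ s k al = 0%N, local_deg (g k) al = 1%N & forall b, b \in Z -> ev (g k) al != dirZ (F k) b].
Proof.
move=> kK H; apply: (off_directions HN HC hm kK) => a aY; apply/eqP => e.
have [u A eu] := neighbor_exists TY kK aY.
by apply: (H u); [apply/adjSP|rewrite /= eu e].
Qed.

Lemma assembled_cover : is_cover SY SZ (cover_vertex Fp F) vertex_map.
Proof.
split.
- by move=> a aY; exists (Fp a); split=> //; apply: FZ.
- by move=> k kK; exists (F k); split=> //; apply: FK.
- by move=> u w /adjSP/assembled_edge/adjSP.
- move=> k kK v; have [r1 r2] := rg kK; split=> //.
  + move=> al H; have [_ h1 h2] := assembled_off kK H; split=> // w' /adjSP A.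
    case: w' A => [b [_ bZ _]|k2 [_ K2 n _]]; apply/eqP; first exact: h2.
    by have [b bZ /= <-] := dd_dir TZ (FK kK) K2 n; exact: h2.
  + by move=> w /adjSP/assembled_point.
- move=> k k' kK K' /adjSP A.
  exact: (edge_count TY d0 Z3 crit fiber HN HC hm A).1.
Qed.

Lemma assembled_portrait : cover_portrait SY (cover_vertex Fp F) vertex_map Fp dg.
Proof.
move=> a aY; split=> // u /adjSP; case: u => [b|k] //= A.
exact: (leaf_count Z3 FZ dg0 HN hm (A : Adj _ _ _ ddY (inr k) (inl a))).1.
Qed.

End CoverAssembly.

Theorem theorem5p5 (R : realType) (d : nat) (f : nat -> ratmap R) (p : nat)
    (M : 'I_p -> nat -> 'M[R[i]]_2) :
  (2 <= d)%N ->
  (forall n, is_rat (f n) /\ rdeg (f n) = d) ->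
  (0 < p)%N ->
  (forall i, rescaling f (M i)) ->
  exists sigma : nat -> nat, (forall n, (sigma n < sigma n.+1)%N) /\
  exists (SX SY SZ : tsph R) (Fv : vtx -> vtx) (fv : vtx -> ratmap R)
         (Fp dg : nat -> nat) (y z : nat -> nat -> Chat R)
         (phiY phiZ : nat -> vtx -> 'M[R[i]]_2),
    [/\ [/\ is_tsph SX, is_tsph SY, is_tsph SZ & dynsys SX SY SZ],
        is_cover SY SZ Fv fv /\
        portrait d (lv SY) (lv SZ) Fp dg,
        (forall n, is_marked d (lv SX) (lv SY) (lv SZ) Fp dg (f (sigma n)) (y n) (z n)),
        dyn_conv (fun n => f (sigma n)) y z SX SY SZ Fv fv Fp dg phiY phiZ &
        exists vi : 'I_p -> nat, forall i, vi i \in iv SY /\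
          equiv_resc (fun n => phiY n (inr (vi i))) (fun n => M i (sigma n))].
Proof.
move=> d2 rf _ resc.
have d0 : (0 < d)%N by apply: leq_trans d2.
have Mu i n : M i n \in unitmx by have [h _] := resc i.
have [U UU Uinf] := free_ultrafilter_exists.
pose pt (ij : 'I_p * 'I_3) n := mob (invmx (M ij.1 n)) (nth None (base_points R) ij.2).
have [NY [NZ [Fp [dg [y [z [lab [[NY3 NZ3] mk yz Hlab]]]]]]]] := ultra_marking UU d0 rf pt.
have por := marking_portrait UU d0 mk.
have yi : U [set n | {in labels NY &, injective (y n)}]%classic.
  by apply: filterS mk => n [_ []].
have zi : U [set n | {in labels NZ &, injective (z n)}]%classic.
  by apply: filterS mk => n [_ []].
have [KY [phiY [dirY [ddY [TY [Y0 phiY0] uY cY]]]]] := frame_system UU NY3 yi.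
have [KZ [phiZ [dirZ [ddZ [TZ [Z0 phiZ0] uZ cZ]]]]] := frame_system UU NZ3 zi.
have UY k : U [set n | phiY n k \in unitmx]%classic by apply: filterS yi => n; apply: uY.
have UZ k : U [set n | phiZ n k \in unitmx]%classic by apply: filterS zi => n; apply: uZ.
(* Equality for every [n], since the same formula is applied to the same three points. *)
have phi0 n : phiY n 0%N = phiZ n 0%N by rewrite phiY0 phiZ0 !yz.
have dir0 a : (a < 3)%N -> dirY 0%N a = dirZ 0%N a.
  move=> a3; apply: (pcv_unique UU) (cY 0%N a) _; apply: (pcv_near UU) (cZ 0%N a).
  by apply: filterS filterT => n _ /=; rewrite phi0 yz.
have [v0 v1 v2] : [/\ dirY 0%N 0%N = Some 0, dirY 0%N 1%N = Some 1 & dirY 0%N 2%N = None].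
  have fv n : {in labels NY &, injective (y n)} -> [/\ mob (phiY n 0%N) (y n 0%N) = Some 0,
      mob (phiY n 0%N) (y n 1%N) = Some 1 & mob (phiY n 0%N) (y n 2%N) = None].
    move=> inj; rewrite phiY0; apply: frame_values; apply/eqP => /inj;
      by rewrite !in_labels !(leq_trans _ NY3) // => /(_ isT isT).
  by split; apply: (pcv_unique UU) (cY 0%N _) _; apply: (pcv_near UU) (pcv_cst UU _);
    apply: filterS yi => n /fv[].
have TX := three_point_system ddY v0 v1 v2.
have [F [lam [P [Q [g [s HV]]]]]] := vertex_maps UU d0 rf NZ3 mk TY TZ UY UZ cY cZ.
have FK k : k \in KY -> F k \in KZ by move=> /HV[[]].
have rg k : k \in KY -> is_rat (g k) /\ (0 < rdeg (g k))%N by move=> /HV[].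
have HN k al b : k \in KY -> b \in labels NZ ->
    (\sum_(a <- labels NY | (Fp a == b) && (dirY k a == al)) dg a =
      s k al + (if ev (g k) al == dirZ (F k) b then local_deg (g k) al else 0))%N.
  by move=> /HV[_ _ _ [h _] _]; apply: h.
have HC k al : k \in KY -> (\sum_(a <- labels NY | dirY k a == al) (dg a - 1) =
      2 * s k al + (local_deg (g k) al - 1))%N.
  by move=> /HV[_ _ _ [_ h] _]; apply: h.
(* The three points marked for [M i] have the limits 0, 1 and infinity in that coordinate. A vertex
   separating their labels is therefore a frame equivalent to [M i]. *)
have Hv i : exists t : nat * (nat -> R[i]) * 'M[R[i]]_2, let: (k, mu, B) := t in
    [/\ k \in KY, forall n, mu n != 0, B \in unitmx &
        mcv U (fun n => mu n *: (phiY n k *m invmx (M i n))) B].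
  pose l j := lab (i, j).
  have cM a : exists r, pcv U (fun n => mob (M i n) (y n a)) r by apply: (pcv_exists UU).
  have [al Hal] := boolp.choice cM.
  have alE j : al (l j) = nth None (base_points R) j.
    apply: (pcv_unique UU) (Hal (l j)) _; apply: (pcv_near UU) (pcv_cst UU _).
    by apply: filterS (Hlab (i, j)).2 => n /= ->; rewrite mobVK.
  pose j0 : 'I_3 := inord 0; pose j1 : 'I_3 := inord 1; pose j2 : 'I_3 := inord 2.
  have sal : [/\ al (l j0) != al (l j1), al (l j0) != al (l j2) & al (l j1) != al (l j2)].
    rewrite !alE !inordK //=; split=> //.
    by apply/eqP => -[] /eqP; rewrite eq_sym oner_eq0.
  have [_ _ t3 _] := TY.
  have [n01 n02 n12] := sal.
  have [k kK sk] := t3 _ _ _ (Hlab (i, j0)).1 (Hlab (i, j1)).1 (Hlab (i, j2)).1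
    (contraNneq (fun e => introT eqP (congr1 al e)) n01)
    (contraNneq (fun e => introT eqP (congr1 al e)) n02)
    (contraNneq (fun e => introT eqP (congr1 al e)) n12).
  have uM : U [set n | M i n \in unitmx]%classic by apply: filterS filterT => n _; apply: Mu.
  have [mu [B [h1 h2 h3]]] := frames_equivalent UU (UY k) uM Hal (cY k) sal sk.
  by exists (k, mu, B).
have [t Ht] := boolp.choice Hv.
pose vi i := (t i).1.1; pose mu i := (t i).1.2; pose B i := (t i).2.
have {}Ht i : [/\ vi i \in KY, forall n, mu i n != 0, B i \in unitmx &
    mcv U (fun n => mu i n *: (phiY n (vi i) *m invmx (M i n))) (B i)].
  by have := Ht i; rewrite /vi /mu /B; case: (t i) => [[]].
(* Finitely many conditions for each [m], so they hold together along [U]; imposed with error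
   [1 / (m + 1)] on the [m]-th term, they become ordinary convergence of the subsequence. *)
pose cond m n := [/\ complete_marking d (labels NY) (labels NZ) Fp dg (f n) (y n) (z n),
  forall k, k \in KY -> forall a, a \in labels NY ->
    chord (mob (phiY n k) (y n a)) (dirY k a) < m.+1%:R^-1,
  forall k, k \in KZ -> forall a, a \in labels NZ ->
    chord (mob (phiZ n k) (z n a)) (dirZ k a) < m.+1%:R^-1,
  forall k, k \in KY -> forall i, i \in labels d.+1 ->
    cmod ((lam k n *: rnum (tmap (phiZ n (F k)) (invmx (phiY n k)) (f n)))`_i - (P k)`_i) < m.+1%:R^-1 /\
    cmod ((lam k n *: rden (tmap (phiZ n (F k)) (invmx (phiY n k)) (f n)))`_i - (Q k)`_i) < m.+1%:R^-1 &
  forall i, i \in enum 'I_p -> forall ab, ab \in enum {: 'I_2 * 'I_2} ->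
    cmod ((mu i n *: (phiY n (vi i) *m invmx (M i n))) ab.1 ab.2 - B i ab.1 ab.2) < m.+1%:R^-1].
have [m|sigma [sig_inc sigP]] := extract_subsequence UU Uinf (Q := cond).
  have m0 : 0 < m.+1%:R^-1 :> R by rewrite invr_gt0 ltr0n.
  have e1 : U [set n | forall k, k \in KY -> forall a, a \in labels NY ->
    chord (mob (phiY n k) (y n a)) (dirY k a) < m.+1%:R^-1]%classic.
    apply: (ultra_all UU) => k kK; apply: (ultra_all UU) => a aY.
    exact: (pcv_chord UU (cY k a) (pcv_cst UU _) m0).
  have e2 : U [set n | forall k, k \in KZ -> forall a, a \in labels NZ ->
    chord (mob (phiZ n k) (z n a)) (dirZ k a) < m.+1%:R^-1]%classic.
    apply: (ultra_all UU) => k kK; apply: (ultra_all UU) => a aY.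
    exact: (pcv_chord UU (cZ k a) (pcv_cst UU _) m0).
  have e3 : U [set n | forall k, k \in KY -> forall i, i \in labels d.+1 ->
    cmod ((lam k n *: rnum (tmap (phiZ n (F k)) (invmx (phiY n k)) (f n)))`_i - (P k)`_i) < m.+1%:R^-1 /\
    cmod ((lam k n *: rden (tmap (phiZ n (F k)) (invmx (phiY n k)) (f n)))`_i - (Q k)`_i) < m.+1%:R^-1]%classic.
    apply: (ultra_all UU) => k kK; apply: (ultra_all UU) => i _.
    have [_ [h1 h2] _ _ _] := HV k kK.
    by apply: filterS2 (h1 i _ m0) (h2 i _ m0) => n /=; split.
  have e4 : U [set n | forall i, i \in enum 'I_p -> forall ab, ab \in enum {: 'I_2 * 'I_2} ->
    cmod ((mu i n *: (phiY n (vi i) *m invmx (M i n))) ab.1 ab.2 - B i ab.1 ab.2) < m.+1%:R^-1]%classic.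
    apply: (ultra_all UU) => i _; apply: (ultra_all UU) => ab _.
    by have [_ _ _ h] := Ht i; apply: h.
  by apply: filterS (filterI mk (filterI (filterI e1 e2) (filterI e3 e4))) => n [h [[h1 h2] [h3 h4]]].
exists sigma; split=> //.
have injY n : {in labels NY &, injective (y (sigma n))} by have [[_ []]] := sigP n.
have injZ n : {in labels NZ &, injective (z (sigma n))} by have [[_ []]] := sigP n.
pose frm (phi : nat -> nat -> 'M[R[i]]_2) n (u : vtx) : 'M[R[i]]_2 :=
  if u is inr k then phi (sigma n) k else 1%:M.
exists (system_tree (labels 3) [fset 0%N]%fset dirY ddY),
  (system_tree (labels NY) KY dirY ddY), (system_tree (labels NZ) KZ dirZ ddZ),
  (cover_vertex Fp F), (vertex_map g), Fp, dg, (fun n => y (sigma n)), (fun n => z (sigma n)),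
  (frm phiY), (frm phiZ).
have sub3 N : (3 <= N)%N -> (labels 3 `<=` labels N)%fset.
  by move=> h; apply/fsubsetP => x; rewrite !in_labels => /leq_trans; apply.
have subK (K : {fset nat}) : 0%N \in K -> ([fset 0%N] `<=` K)%fset by rewrite fsub1set.
split.
- split; [exact: system_is_tsph TX|exact: system_is_tsph TY|exact: system_is_tsph TZ|].
  split; first by rewrite fsubsetI !sub3.
  split; apply: system_tri => //; try exact: sub3; try exact: subK.
    by move=> k a; rewrite in_fset1 in_labels => /eqP-> /dir0.
  by move=> k k'; rewrite !in_fset1 => /eqP-> /eqP->; rewrite eqxx.
- split=> //; exact: assembled_cover TY TZ d0 por FK rg HN HC.
- move=> n; have [[h1 [h2 h3] h4 _ _] _ _ _ _] := sigP n; split=> //.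
    by move=> a /h4[].
  by move=> x; rewrite in_labels => /yz.
- split; first exact: assembled_portrait TZ por rg HN.
    move=> k kK v w.
    have uYk n : phiY (sigma n) k \in unitmx by apply: uY.
    have uZk n : phiZ (sigma n) (F k) \in unitmx by apply: uZ.
    have [[_ l0 sP sQ] _ _ _ hE] := HV k kK.
    split=> //.
    + move=> a q aY /(aval_system TY _ kK aY)->.
      by apply: inverse_bound => n; have [_ h _ _ _] := sigP n; apply: h.
    + move=> b q bZ /(aval_system TZ _ (FK _ kK) bZ)->.
      by apply: inverse_bound => n; have [_ _ h _ _] := sigP n; apply: h (FK _ kK) _ bZ.
    + apply: (forms_lu_cvg UU Uinf (d := d) (lam := fun n => lam k (sigma n)) (P := P k) (Q := Q k) (s := s k)) => //.
        by move=> n i hi; have [_ _ _ h _] := sigP n; apply: h => //; rewrite in_labels.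
      move=> al sal; apply: contrapT => ne; apply: sal.
      have [] // := assembled_off TY rg HN HC (al := al) kK.
      by move=> u A e; apply: ne; exists u.
  by move=> k; rewrite in_fset1 => /eqP-> n x; rewrite /= phi0.
exists vi => i; have [h1 h2 h3 _] := Ht i; split=> //.
exists (fun n => mu i (sigma n)), (B i); split=> // a b.
apply: inverse_bound => n; have [_ _ _ _ h] := sigP n.
by apply: (h i _ (a, b)); rewrite mem_enum.
Qed.
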